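(* Let $w_0\in\mathbb R$. Assume that $U$ satisfies the utility assumption and that we are in the whole-line setting. Suppose that: (i) $\mathscr S=\mathscr S^{*}$; (ii) there exist $C>0$ and $\alpha\in[0,1)$ with $U(x)\le C(x^\alpha+1)$ for all $x\ge0$; (iii) for every $S\in\mathscr S$ and $t\in\{1,\ldots,T\}$ there exist $\mathcal F_{t-1}$-measurable random variables $\beta_t^S>0$, $\kappa_t^S>0$ a.s. satisfying $$\operatorname*{ess\,inf}_{\xi\in\Xi_t^{S}}\mathbb P\big(\langle\xi,\Delta S_t\rangle\le-\beta_t^S\|\xi\|\,\big|\,\mathcal F_{t-1}\big)\ge\kappa_t^S\quad\text{a.s. on }\{D_t^{S}\neq\{0\}\},$$ where $\Xi_t^{S}=\{\xi\in L^0(\mathcal F_{t-1};\mathbb R^d):\xi\in D_t^{S}\text{ a.s.}\}$, and such that $1/\beta_t^S,\ 1/\kappa_t^S,\ \|\Delta S_t\|\in\mathscr W$. Then there exists $\hat\phi\in\mathscr L$ such that $$u(w_0)=\inf_{S\in\mathscr S}\mathbb E_{\mathbb P}\big[U(W_T^S(w_0,\hat\phi))\big]<+\infty.$$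
   Context: Fix $d,T\in\mathbb N$ and a filtered probability space $(\Omega,\mathcal F,\mathbb F=(\mathcal F_t)_{t=0}^T,\mathbb P)$ whose $\sigma$-algebras all contain the $\mathbb P$-null sets; random variables equal a.s. are identified. For $\mathcal G\subseteq\mathcal F$, $L^0(\mathcal G;\mathbb R^n)$ is the space of $\mathcal G$-measurable $\mathbb R^n$-valued random variables with the topology of convergence in probability. Let $\mathscr S$ be a nonempty family of $\mathbb F$-adapted $\mathbb R^d$-valued processes $S=(S_t)_{t=0}^T$, and write $\Delta S_t=S_t-S_{t-1}$. Let $\mathscr L=\prod_{t=1}^T L^0(\mathcal F_{t-1};\mathbb R^d)$. For $w\in\mathbb R$, $\phi\in\mathscr L$, $S\in\mathscr S$, set $W_t^S(w,\phi)=w+\sum_{s=1}^t\langle\phi_s,\Delta S_s\rangle$. For $S\in\mathscr S$ and $t\ge1$, $D_t^S(\omega)$ is the smallest affine subspace of $\mathbb R^d$ containing the support of the regular conditional distribution of $\Delta S_t$ given $\mathcal F_{t-1}$ at $\omega$. NA($S$) means: for every $\phi\in\mathscr L$, $W_T^S(0,\phi)\ge0$ a.s. implies $W_T^S(0,\phi)=0$ a.s. $\mathscr S^{*}$ denotes the set of $S^*\in\mathscr S$ such that NA($S^*$) holds and, for every $S\in\mathscr S$ and $t$, $D_t^S\subseteq D_t^{S^*}$ a.s. $\mathscr W=\{X\in L^0(\mathcal F_T;\mathbb R):\mathbb E_{\mathbb P}[|X|^p]<\infty\text{ for all }p>0\}$. Utility assumption: $U:\mathbb R\to\mathbb R\cup\{-\infty\}$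 is non-decreasing, concave and upper semicontinuous. Whole-line setting: $U(x)>-\infty$ for all $x\in\mathbb R$, and every $\phi\in\mathscr L$ is admissible. Value $u(w_0)=\sup_{\varphi\in\mathscr L}\inf_{S\in\mathscr S}\mathbb E_{\mathbb P}[U(W_T^S(w_0,\varphi))]$, with the convention that the expectation of a random variable whose positive and negative parts both have infinite expectation is $-\infty$. *)

(* Defs.v *)
From HB Require Import structures.
From mathcomp Require Import all_boot all_order all_algebra.
From mathcomp Require Import all_classical all_reals all_analysis.
From mathcomp Require Import measurable_realfun.
Import numFieldNormedType.Exports.
Unset Strict Implicit.
Unset Printing Implicit Defensive.
Import Order.TTheory GRing.Theory Num.Theory.
Local Open Scope classical_set_scope.
Local Open Scope ring_scope.

(* d.-tuple R carries the product (= Borel) sigma-algebra of the library.    *)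

Definition dotv {R : realType} {d : nat} (u v : d.-tuple R) : R :=
  \sum_(i < d) tnth u i * tnth v i.

Definition enorm {R : realType} {d : nat} (u : d.-tuple R) : R :=
  Num.sqrt (dotv u u).

Definition subv {R : realType} {d : nat} (u v : d.-tuple R) : d.-tuple R :=
  [tuple tnth u i - tnth v i | i < d].

Definition zerov {R : realType} {d : nat} : d.-tuple R := [tuple (0 : R) | i < d].

Definition combv {R : realType} {d : nat} (l : R) (x y : d.-tuple R) : d.-tuple R :=
  [tuple l * tnth x i + (1 - l) * tnth y i | i < d].

Definition is_affine {R : realType} {d : nat} (V : set (d.-tuple R)) : Prop :=
  forall x y (l : R), V x -> V y -> V (combv l x y).

Definition affhull {R : realType} {d : nat} (A : set (d.-tuple R)) : set (d.-tuple R) :=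
  \bigcap_(V in [set V : set (d.-tuple R) | is_affine V /\ A `<=` V]) V.

Definition eball {R : realType} {d : nat} (x : d.-tuple R) (e : R) : set (d.-tuple R) :=
  [set y | enorm (subv y x) < e].

(* support of a (probability) measure on R^d : smallest closed set of full measure,
   i.e. the points all of whose open neighbourhoods have positive measure *)
Definition msupport {R : realType} {d : nat} (nu : set (d.-tuple R) -> \bar R)
  : set (d.-tuple R) :=
  [set x | forall e : R, 0 < e -> (0 < nu (eball x e))%E].

Definition Gmeas {Omega : Type} {dV : measure_display} {V : measurableType dV}
  (G : set (set Omega)) (f : Omega -> V) : Prop :=
  forall B : set V, measurable B -> G (f @^-1` B).

Definition is_condprob {dO : measure_display} {Omega : measurableType dO}
  {R : realType} (P : probability Omega R) (G : set (set Omega))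
  (A : set Omega) (Y : Omega -> R) : Prop :=
  Gmeas G Y /\
  forall B, G B -> (\int[P]_(w in B) (Y w)%:E = P (A `&` B))%E.

Definition is_rcd {dO : measure_display} {Omega : measurableType dO}
  {R : realType} (P : probability Omega R) (G : set (set Omega)) {d : nat}
  (X : Omega -> d.-tuple R) (nu : Omega -> probability (d.-tuple R) R) : Prop :=
  forall B : set (d.-tuple R), measurable B ->
    Gmeas (V := \bar R) G (fun w => nu w B) /\
    forall A, G A -> (\int[P]_(w in A) nu w B = P (A `&` X @^-1` B))%E.

Definition is_Dset {dO : measure_display} {Omega : measurableType dO}
  {R : realType} (P : probability Omega R) (G : set (set Omega)) {d : nat}
  (X : Omega -> d.-tuple R) (D : Omega -> set (d.-tuple R)) : Prop :=
  exists nu, is_rcd P G X nu /\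
    (\forall w \ae P, D w = affhull (msupport (nu w))).

Definition is_essinf {dO : measure_display} {Omega : measurableType dO}
  {R : realType} (P : probability Omega R) (fam : set (Omega -> R))
  (Z : Omega -> R) : Prop :=
  measurable_fun setT Z /\
  (forall Y, fam Y -> \forall w \ae P, Z w <= Y w) /\
  (forall Z' : Omega -> R, measurable_fun setT Z' ->
      (forall Y, fam Y -> \forall w \ae P, Z' w <= Y w) ->
      \forall w \ae P, Z' w <= Z w).

Definition is_filtration {dO : measure_display} {Omega : measurableType dO}
  {R : realType} (P : probability Omega R) (Tn : nat) (F : nat -> set (set Omega))
  : Prop :=
  (forall t, (t <= Tn)%N -> sigma_algebra setT (F t)) /\
  (forall t, (t <= Tn)%N -> F t `<=` measurable) /\
  (forall s t, (s <= t)%N -> (t <= Tn)%N -> F s `<=` F t) /\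
  (forall t N, (t <= Tn)%N -> measurable N -> P N = 0%E -> F t N).

Definition Process (Omega : Type) (R : realType) (d : nat) :=
  nat -> Omega -> d.-tuple R.

Definition adapted {Omega : Type} {R : realType} {d : nat} (Tn : nat)
  (F : nat -> set (set Omega)) (S : Process Omega R d) : Prop :=
  forall t, (t <= Tn)%N -> Gmeas (F t) (S t).

Definition incr {Omega : Type} {R : realType} {d : nat} (S : Process Omega R d)
  (t : nat) (w : Omega) : d.-tuple R :=
  subv (S t w) (S t.-1 w).

Definition strategies {Omega : Type} {R : realType} (d Tn : nat)
  (F : nat -> set (set Omega)) : set (Process Omega R d) :=
  [set phi | forall s, (1 <= s <= Tn)%N -> Gmeas (F s.-1) (phi s)].

Definition wealth {Omega : Type} {R : realType} {d : nat} (S : Process Omega R d)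
  (w0 : R) (phi : Process Omega R d) (t : nat) (w : Omega) : R :=
  w0 + \sum_(1 <= s < t.+1) dotv (phi s w) (incr S s w).

Definition NA {dO : measure_display} {Omega : measurableType dO}
  {R : realType} (P : probability Omega R) {d : nat} (Tn : nat)
  (F : nat -> set (set Omega)) (S : Process Omega R d) : Prop :=
  forall phi, strategies d Tn F phi ->
    (\forall w \ae P, 0 <= wealth S 0 phi Tn w) ->
    (\forall w \ae P, wealth S 0 phi Tn w = 0).

Definition Sstar {dO : measure_display} {Omega : measurableType dO}
  {R : realType} (P : probability Omega R) {d : nat} (Tn : nat)
  (F : nat -> set (set Omega)) (Sfam : set (Process Omega R d))
  : set (Process Omega R d) :=
  [set Ss | Sfam Ss /\ NA P Tn F Ss /\
    forall S t, Sfam S -> (1 <= t <= Tn)%N ->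
      forall D Ds, is_Dset P (F t.-1) (incr S t) D ->
                   is_Dset P (F t.-1) (incr Ss t) Ds ->
        \forall w \ae P, D w `<=` Ds w].

Definition Wmom {dO : measure_display} {Omega : measurableType dO}
  {R : realType} (P : probability Omega R) (X : Omega -> R) : Prop :=
  measurable_fun setT X /\
  forall p : R, 0 < p -> (\int[P]_w ((`|X w| `^ p)%:E) < +oo)%E.

Definition Econv {dO : measure_display} {Omega : measurableType dO}
  {R : realType} (P : probability Omega R) (X : Omega -> R) : \bar R :=
  if ((\int[P]_w (Num.max (X w) 0)%:E == +oo)%E &&
      (\int[P]_w (Num.max (- X w) 0)%:E == +oo)%E)
  then (-oo)%E
  else (\int[P]_w (X w)%:E)%E.

Definition worst_case {dO : measure_display} {Omega : measurableType dO}
  {R : realType} (P : probability Omega R) {d : nat} (Tn : nat)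
  (Sfam : set (Process Omega R d)) (U : R -> R) (w0 : R) (phi : Process Omega R d)
  : \bar R :=
  ereal_inf [set Econv P (fun w => U (wealth S w0 phi Tn w)) | S in Sfam].

Definition value {dO : measure_display} {Omega : measurableType dO}
  {R : realType} (P : probability Omega R) {d : nat} (Tn : nat)
  (F : nat -> set (set Omega)) (Sfam : set (Process Omega R d)) (U : R -> R)
  (w0 : R) : \bar R :=
  ereal_sup [set worst_case P Tn Sfam U w0 phi | phi in strategies d Tn F].

(* utility assumption (whole-line setting: U is real valued) *)
Definition utility_assumption {R : realType} (U : R -> R) : Prop :=
  {homo U : x y / x <= y} /\
  (forall x y (l : R), 0 <= l <= 1 -> l * U x + (1 - l) * U y <= U (l * x + (1 - l) * y)) /\
  (forall (x e : R), 0 < e -> \forall y \near x, U y < U x + e).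

(* Main.v *)
(* By (i) all models share the affine hulls [D_t] of their conditional supports, and these contain
   [0] by no arbitrage. Projecting a strategy onto the [D_t] therefore changes none of its wealth
   processes, so only strategies with values in the [D_t] matter. For these, (iii) says that each
   period loses at least [beta_t |phi_t|] with conditional probability at least [kappa_t]; chaining
   the periods gives weights [theta_t] with moments of all orders such that [E (|phi_t| / theta_t)]
   is bounded by the expected loss [E W_T^-]. Young's inequality then gives
   [E (W_T^+)^g <= eps E W_T^- + C] for [g < 1], whereas a nonconstant concave [U] is at most
   [c_2 (1 + (x^+)^g) - c_1 x^-]. Hence strategies with utility bounded below have bounded loss,
   the value is finite, and a maximising sequence is bounded in weighted [L^1]. A Komlos argument
   makes it converge almost surely, and Fatou's lemma in every model shows that the limit is
   optimal. *)

Require Import Defs.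
From HB Require Import structures.
From mathcomp Require Import all_boot all_order all_algebra.
From mathcomp Require Import all_classical all_reals all_analysis.
From mathcomp Require Import measurable_realfun.
From mathcomp Require Import ring lra.
Import numFieldNormedType.Exports.
Import Order.TTheory GRing.Theory Num.Theory.
Local Open Scope classical_set_scope.
Local Open Scope ring_scope.

Set Implicit Arguments.
Unset Strict Implicit.
Unset Printing Implicit Defensive.

(** * Conditional expectation *)

(** Hypothesis (iii) speaks of every version of the hull process and of every essential infimum, so
    it yields nothing until regular conditional distributions and essential infima are shown to
    exist; hence the long measure-theoretic preparation. Conditional expectations are used mostly in
    integrated form, as relations between [EE P] of products with an arbitrary nonnegative weight
    measurable for the smaller sigma-algebra. Such relations chain from period to period without
    integrability. The hulls are random sets, but no measurable selection is made: projections onto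
    them are rational expressions in the entries of a Gram matrix. The weights [theta] depend on the
    model, and there may be uncountably many models. Compactness therefore uses the weights of one
    fixed model only; almost sure convergence then serves all models, each with its own weights in
    the Fatou step. Powers of the gain below 1 are forced: the controlled quantity is a first moment
    of [|phi_t| / theta_t], and removing the weight by Young's inequality costs a little of the
    exponent. *)

Lemma sub_sigma_measurableE (T : pointedType) (G : set (set T)) :
  sigma_algebra setT G -> forall A : set T,
  @measurable _ (g_sigma_algebraType G) A = G A.
Proof. by move=> sG A; rewrite measurable_g_measurableTypeE. Qed.

Section sub_sigma_algebra.
Context {dO : measure_display} {Omega : measurableType dO}.
Variables (G : set (set Omega)).
Hypothesis sG : sigma_algebra setT G.

Lemma GmeasP {dV : measure_display} {V : measurableType dV} (f : Omega -> V) :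
  Gmeas G f <-> measurable_fun [set: g_sigma_algebraType G] f.
Proof.
split=> [Gf _ B mB|mf B mB].
  by rewrite setTI sub_sigma_measurableE//; exact: Gf.
by have := mf measurableT _ mB; rewrite setTI sub_sigma_measurableE.
Qed.

Lemma Gmeas_cst {dV : measure_display} {V : measurableType dV} (c : V) :
  Gmeas G (fun=> c).
Proof. by apply/GmeasP; exact: measurable_cst. Qed.

Hypothesis GM : G `<=` measurable.

Lemma Gmeas_measurable {dV : measure_display} {V : measurableType dV}
  (f : Omega -> V) : Gmeas G f -> measurable_fun setT f.
Proof. by move=> Gf _ B mB; rewrite setTI; exact/GM/Gf. Qed.

Lemma measurable_id_sub :
  measurable_fun [set: Omega] (idfun : Omega -> g_sigma_algebraType G).
Proof.
by move=> _ A; rewrite sub_sigma_measurableE// setTI => /GM.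
Qed.

End sub_sigma_algebra.

Lemma Gmeas_sub {dO : measure_display} {Omega : measurableType dO}
  (G H : set (set Omega)) {dV : measure_display} {V : measurableType dV}
  (f : Omega -> V) : G `<=` H -> Gmeas G f -> Gmeas H f.
Proof. by move=> GH Gf B mB; exact/GH/Gf. Qed.

Definition EE {dO : measure_display} {Omega : measurableType dO} {R : realType}
  (P : {measure set Omega -> \bar R}) (f : Omega -> R) : \bar R :=
  (\int[P]_w (f w)%:E)%E.

Section expectation.
Context {dO : measure_display} {Omega : measurableType dO} {R : realType}.
Variable P : {measure set Omega -> \bar R}.
Implicit Types f g : Omega -> R.
Local Notation mf f := (measurable_fun setT f).

Lemma EE_ge0 f : (forall w, 0 <= f w) -> (0 <= EE P f)%E.
Proof. by move=> f0; apply: integral_ge0 => w _; rewrite lee_fin. Qed.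

Lemma EE_le_ae f g : mf f -> mf g -> (forall w, 0 <= f w) ->
  (forall w, 0 <= g w) -> (\forall w \ae P, f w <= g w) -> (EE P f <= EE P g)%E.
Proof.
move=> mff mg f0 g0 fg; apply: ae_ge0_le_integral => //.
- by move=> w _; rewrite lee_fin.
- exact/measurable_EFinP.
- by move=> w _; rewrite lee_fin.
- exact/measurable_EFinP.
- by apply: filterS fg => w fgw _; rewrite lee_fin.
Qed.

Lemma EE_le f g : mf f -> mf g -> (forall w, 0 <= f w) ->
  (forall w, f w <= g w) -> (EE P f <= EE P g)%E.
Proof.
move=> mff mg f0 fg; apply: EE_le_ae => //; first by move=> w; exact: le_trans (fg w).
exact/aeW.
Qed.

Lemma EE_eq_ae f g : mf f -> mf g -> (\forall w \ae P, f w = g w) ->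
  EE P f = EE P g.
Proof.
move=> mff mg fg; apply: ae_eq_integral => //.
- exact/measurable_EFinP.
- exact/measurable_EFinP.
- by apply: filterS fg => w -> .
Qed.

Lemma EE_eq f g : (forall w, f w = g w) -> EE P f = EE P g.
Proof. by move=> fg; apply: eq_integral => w _; rewrite fg. Qed.

Lemma EE_add f g : mf f -> mf g -> (forall w, 0 <= f w) ->
  (forall w, 0 <= g w) -> EE P (fun w => f w + g w) = (EE P f + EE P g)%E.
Proof.
move=> mff mg f0 g0; rewrite /EE -ge0_integralD//.
- by move=> w _; rewrite lee_fin.
- exact/measurable_EFinP.
- by move=> w _; rewrite lee_fin.
- exact/measurable_EFinP.
Qed.

Lemma EE_scale (k : R) f : mf f -> (forall w, 0 <= f w) -> 0 <= k ->
  EE P (fun w => k * f w) = (k%:E * EE P f)%E.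
Proof.
move=> mff f0 k0; rewrite /EE -ge0_integralZl_EFin//.
- by move=> w _; rewrite lee_fin.
- exact/measurable_EFinP.
Qed.

Lemma EE_eq0_ae f : mf f -> (forall w, 0 <= f w) -> EE P f = 0%E ->
  \forall w \ae P, f w = 0.
Proof.
move=> mff f0 Ef0.
have : ae_eq P setT (EFin \o f) (cst 0%E).
  apply/ae_eq_integral_abs => //; first exact/measurable_EFinP.
  by rewrite -Ef0; apply: eq_integral => w _ /=; rewrite ger0_norm.
by apply: filterS => w /(_ I) [].
Qed.

(** Monotone convergence. It lets an estimate be proved for truncated functions, where expectations
    are finite and a common term can be cancelled. *)
Lemma EE_trunc_le f (c : \bar R) : mf f -> (forall w, 0 <= f w) ->
  (forall n : nat, (EE P (fun w => Num.min (f w) n%:R) <= c)%E) ->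
  (EE P f <= c)%E.
Proof.
move=> mff f0 fc.
pose g (n : nat) (w : Omega) : \bar R := (Num.min (f w) n%:R)%:E.
have gf w : g n w @[n --> \oo] --> (f w)%:E.
  apply: cvg_near_cst; near=> n; rewrite /g; congr EFin; apply: min_l.
  by near: n; exact: nbhs_infty_ger.
have : (\int[P]_w g n w @[n --> \oo] --> EE P f)%E.
  rewrite /EE (_ : (fun w => _) = fun w => limn (g ^~ w)); last first.
    by apply/funext => w; apply/esym/cvg_lim => //; exact: gf.
  apply: cvg_monotone_convergence => //.
  - move=> n; apply/measurable_EFinP; apply: measurable_minr => //.
  - by move=> n w _; rewrite lee_fin le_min f0 ler0n.
  - move=> w _ m n mn; rewrite lee_fin le_min ge_min lexx/= ge_min.
    by rewrite ler_nat mn orbT.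
move=> h; rewrite -(cvg_lim _ h)//; apply: lime_le.
  by apply/cvg_ex; eexists; exact: h.
by near=> n; exact: fc.
Unshelve. all: by end_near. Qed.

End expectation.

Lemma EE_cst {dO : measure_display} {Omega : measurableType dO} {R : realType}
  (P : probability Omega R) (c : R) : EE P (fun=> c) = c%:E.
Proof.
rewrite /EE (integral_cst P measurableT c%:E) [X in (_ * X)%E](_ : _ = 1%E) ?mule1//.
exact: probability_setT.
Qed.

Section conditional_expectation.
Context {dO : measure_display} {Omega : measurableType dO} {R : realType}.
Variables (P : probability Omega R) (G : set (set Omega)).
Hypothesis sG : sigma_algebra setT G.
Hypothesis GM : G `<=` measurable.

Import HBNNSimple.

(** [z] is the increasing limit of simple functions whose level sets lie in [G], so both sides are
    limits of the same combinations of integrals over sets of [G]. *)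
Lemma EE_weight_eq (f g : Omega -> R) :
  measurable_fun setT f -> measurable_fun setT g ->
  (forall w, 0 <= f w) -> (forall w, 0 <= g w) ->
  (forall A, G A -> (\int[P]_(w in A) (f w)%:E = \int[P]_(w in A) (g w)%:E)%E) ->
  forall z : Omega -> R, Gmeas G z -> (forall w, 0 <= z w) ->
  EE P (fun w => z w * f w) = EE P (fun w => z w * g w).
Proof.
move=> mf mg f0 g0 fg z Gz z0.
have mz : measurable_fun [set: g_sigma_algebraType G] (EFin \o z).
  by apply/measurable_EFinP; exact/GmeasP.
pose h := nnsfun_approx measurableT mz.
have mh n : measurable_fun setT (h n : Omega -> R).
  apply: (Gmeas_measurable GM); apply/(GmeasP sG).
  exact: measurable_funP.
suff H (k : Omega -> R) : measurable_fun setT k -> (forall w, 0 <= k w) ->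
    EE P (fun w => z w * k w) = lim
     ((\sum_(r \in range (h n)) r%:E * \int[P]_(w in h n @^-1` [set r]) (k w)%:E) @[n --> \oo])%E.
  rewrite !H//; congr (limn _); apply/funext => n.
  apply: eq_fsbigr => r _; rewrite fg//.
  rewrite -sub_sigma_measurableE//.
move=> mk k0.
have -> : EE P (fun w => z w * k w) =
    lim (\int[P]_w (h n w * k w)%:E @[n --> \oo])%E.
  rewrite -monotone_convergence//.
  - apply: eq_integral => w _; apply/esym/cvg_lim => //.
    under eq_fun do rewrite EFinM.
    rewrite EFinM; apply: cvgeZr => //.
    by apply: cvg_nnsfun_approx => // x _; rewrite lee_fin.
  - move=> n; apply/measurable_EFinP; exact: measurable_funM.
  - by move=> n w _; rewrite lee_fin mulr_ge0.
  - move=> w _ a b ab; rewrite lee_fin ler_wpM2r//.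
    by have /lefP := @nd_nnsfun_approx _ _ _ _ measurableT _ mz a b ab; apply.
congr (limn _); apply/funext => n.
have mA r : measurable (h n @^-1` [set r] : set Omega).
  by apply: GM; rewrite -sub_sigma_measurableE.
transitivity (\int[P]_w (\sum_(r \in range (h n))
    (r * \1_(h n @^-1` [set r]) w)%:E * (k w)%:E))%E.
  apply: eq_integral => w _.
  rewrite -ge0_mule_fsuml => [|y]; last exact: nnfun_muleindic_ge0.
  rewrite fsumEFin // EFinM; congr (_%:E * _)%E; exact: (fimfunE (h n) w).
rewrite ge0_integral_fsum//; last 2 first.
  - move=> r; apply/measurable_EFinP; apply: measurable_funM => //.
    by apply: measurable_funM => //.
  - by move=> r w _; apply: mule_ge0; [exact: nnfun_muleindic_ge0|rewrite lee_fin].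
apply: eq_fsbigr => r rhn.
have r0 : 0 <= r by move: rhn; rewrite inE => -[t _ <-].
under eq_integral do rewrite EFinM -muleA.
rewrite ge0_integralZl//.
- under eq_integral do rewrite muleC.
  by rewrite [in RHS]integral_mkcond; congr (_ * _)%E;
    apply: eq_integral => x _; rewrite epatch_indic.
- by apply/measurable_EFinP; apply: measurable_funM.
- by move=> w _; rewrite mule_ge0 ?lee_fin.
Qed.

(** The Radon-Nikodym derivative of the charge with density [eta] with respect to [P], both
    restricted to [G]. Restriction is the image under the identity map from [Omega] to
    [g_sigma_algebraType G]. *)
Lemma condexp_exists (eta : Omega -> R) :
  measurable_fun setT eta -> (forall w, 0 <= eta w) -> (EE P eta < +oo)%E ->
  exists b : Omega -> R, [/\ Gmeas G b, forall w, 0 <= b w,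
   (forall A, G A -> \int[P]_(w in A) (b w)%:E = \int[P]_(w in A) (eta w)%:E)%E &
   forall z : Omega -> R, Gmeas G z -> (forall w, 0 <= z w) ->
     EE P (fun w => z w * b w) = EE P (fun w => z w * eta w)].
Proof.
move=> meta eta0 Eeta.
have ieta : P.-integrable setT (EFin \o eta).
  apply/integrableP; split; first exact/measurable_EFinP.
  by under eq_integral => w _ do rewrite /= ger0_norm//.
pose idG : Omega -> g_sigma_algebraType G := idfun.
have mid : measurable_fun setT idG := measurable_id_sub sG GM.
pose X : {mfun Omega >-> g_sigma_algebraType G} :=
  HB.pack idG (isMeasurableFun.Build _ _ _ _ _ mid).
pose mu : {finite_measure set (g_sigma_algebraType G) -> \bar R} := distribution P X.
pose nu0 : {charge set Omega -> \bar R} := induced_charge ieta.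
pose nu_ : {charge set (g_sigma_algebraType G) -> \bar R} := pushforward nu0 X.
pose nu := nu_ mid.
have numu : nu `<< mu.
  apply: dominates_pushforward => //.
  apply/null_content_dominatesP => A mA PA; apply: null_set_integral => //.
  by apply: measurable_funTS; exact/measurable_EFinP.
pose b0 := Radon_Nikodym nu mu.
have fb0 x : b0 x \is a fin_num by exact: Radon_Nikodym_fin_num.
have ib0 : mu.-integrable setT b0 by exact: Radon_Nikodym_integrable.
have mb0 : measurable_fun setT b0 by apply: measurable_int ib0.
pose b (w : Omega) : R := Num.max (fine (b0 w)) 0.
have mb : measurable_fun [set: g_sigma_algebraType G] b.
  apply: measurable_maxr => //; exact: measurableT_comp.
have b_ge0 w : 0 <= b w by rewrite le_max lexx orbT.
have nuE A : measurable A -> nu A = (\int[P]_(w in A) (eta w)%:E)%E by [].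
(* The derivative of a charge may be negative at some points. Over the set of these points its
   integral is at most 0 by sign and at least 0 because [eta] is nonnegative, so the set is null. *)
have bb0 : (\forall x \ae mu, b0 x = (b x)%:E).
  pose A := [set x | (b0 x < 0)%E].
  have mA : measurable A.
    rewrite -[A]setTI; exact: emeasurable_fun_infty_o.
  have muA : mu A = 0.
    have nuA : (\int[mu]_(x in A) b0 x = 0)%E.
      apply/eqP; rewrite eq_le; apply/andP; split.
        rewrite -oppe_ge0 -integralN; last first.
          apply: integrable_add_def => //.
          exact: integrableS ib0.
        by apply: integral_ge0 => x /= xA; rewrite oppe_ge0 ltW.
      rewrite -Radon_Nikodym_integral// nuE//.
      by apply: integral_ge0 => w _; rewrite lee_fin.
    apply/eqP; rewrite eq_le measure_ge0 andbT.
    have : (\int[mu]_(x in A) `|b0 x| = 0)%E.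
      rewrite -[RHS]oppe0 -nuA -integralN; last first.
        by apply: integrable_add_def => //; exact: integrableS ib0.
      by apply: eq_integral => x; rewrite inE => /ltW /lee0_abs.
    move/(ae_eq_integral_abs mu mA (measurable_funTS mb0)).
    move=> [N [mN N0 AN]]; rewrite -N0; apply: le_measure; rewrite ?inE//.
    by move=> x Ax; apply: AN => /= /(_ Ax) /= b00; move: Ax; rewrite /A/= b00 ltxx.
  exists A; split => // x /= bx; apply/negP; move: bx; apply/contra_not.
  rewrite /A/= => /negP; rewrite -leNgt => b0x.
  by rewrite /b max_l ?fineK// fine_ge0.
have int_b A : G A -> (\int[P]_(w in A) (b w)%:E = \int[P]_(w in A) (eta w)%:E)%E.
  move=> GA; have mA : measurable (A : set (g_sigma_algebraType G)).
    by rewrite sub_sigma_measurableE.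
  rewrite -nuE// (Radon_Nikodym_integral numu)//.
  transitivity (\int[mu]_(x in A) (b x)%:E)%E.
    rewrite ge0_integral_pushforward//.
    - by apply: measurable_funTS; exact/measurable_EFinP.
    - by move=> y _; rewrite lee_fin.
  apply: ae_eq_integral => //.
  - by apply: measurable_funTS; exact/measurable_EFinP.
  - exact: measurable_funTS.
  - by apply: filterS bb0 => x + _; rewrite -/b0 => ->.
exists b; split => //; first exact/GmeasP.
apply: EE_weight_eq => //.
by apply: (Gmeas_measurable GM); exact/GmeasP.
Qed.

Lemma condprob_exists (A : set Omega) : measurable A ->
  exists Y, [/\ is_condprob P G A Y, forall w, 0 <= Y w &
    forall z : Omega -> R, Gmeas G z -> (forall w, 0 <= z w) ->
     EE P (fun w => z w * Y w) = EE P (fun w => z w * \1_A w)].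
Proof.
move=> mA; have [||| b [Gb b0 bA bz]] := @condexp_exists (\1_A).
- exact: measurable_indic.
- by move=> w; rewrite indicE.
- by rewrite /EE integral_indic// setIT (le_lt_trans (probability_le1 _ _))// ltry.
exists b; split => //; split => // B GB; rewrite bA// integral_indic//.
exact: GM.
Qed.

End conditional_expectation.

(** * Regular conditional distributions *)

Section rational_cdf.
Context {R : realType}.
Variable g : rat -> R.
Hypothesis g_nd : forall p q, p <= q -> g p <= g q.
Hypothesis g0 : forall q, q < 0 -> g q = 0.
Hypothesis g1 : forall q, 1 <= q -> g q = 1.

(** The infimum runs over rationals strictly above [x], which gives right continuity without any
    such property of [g]. *)
Definition rcdf (x : R) : R := inf [set g q | q in [set q | x < ratr q]].

Let g_ge0 q : 0 <= g q.
Proof.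
have [/g0->//|q0] := ltP q 0.
by rewrite -(g0 (q := -1))// g_nd// (le_trans _ q0).
Qed.

Let rcdf_lb (x : R) : has_lbound [set g q | q in [set q | x < ratr q]].
Proof. by exists 0 => _ [q _ <-]. Qed.

Let rcdf_neq0 (x : R) : [set g q | q in [set q | x < ratr q]] !=set0.
Proof.
have [q] := @rat_in_itvoo R x (x + 1) ltac:(by rewrite ltrDl).
by rewrite in_itv/= => /andP[xq _]; exists (g q), q.
Qed.

Lemma rcdf_le x q : x < ratr q -> rcdf x <= g q.
Proof. by move=> xq; apply: inf_lbound => //; exists q. Qed.

Lemma rcdf_lt x (e : R) : 0 < e -> exists2 q, x < ratr q & g q < rcdf x + e.
Proof.
move=> e0; have [_ [q xq <-] ge] := @inf_adherent _ _ e e0 (conj (rcdf_neq0 x) (rcdf_lb x)).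
by exists q.
Qed.

Lemma le_rcdf x c : (forall q, x < ratr q -> c <= g q) -> c <= rcdf x.
Proof. by move=> H; apply: lb_le_inf => // _ [q xq <-]; exact: H. Qed.

Let rcdf_nd : {homo rcdf : x y / x <= y}.
Proof. by move=> x y xy; apply: le_rcdf => q yq; apply: rcdf_le; exact: le_lt_trans yq. Qed.

Let rcdf_rc : right_continuous rcdf.
Proof.
move=> x; apply/cvgrPdist_lt => e e0.
have [q xq gq] := rcdf_lt x e0; near=> y.
have xy : x < y by near: y; exact: nbhs_right_gt.
have yq : y < ratr q by near: y; exact: nbhs_right_lt.
rewrite ler0_norm ?subr_le0 ?rcdf_nd 1?ltW// opprB ltrBlDl.
by apply: le_lt_trans gq; exact: rcdf_le.
Unshelve. all: by end_near. Qed.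

Let rcdf_N x : x < 0 -> rcdf x = 0.
Proof.
move=> x0; apply/eqP; rewrite eq_le le_rcdf ?andbT//.
have [q] := rat_in_itvoo x0; rewrite in_itv/= => /andP[xq q0].
rewrite -(g0 (q := q)) ?rcdf_le//.
by rewrite -(@ltr_rat R) rmorph0.
Qed.

Let rcdf_1 x : 1 <= x -> rcdf x = 1.
Proof.
move=> x1; apply/eqP; rewrite eq_le; apply/andP; split.
  have [q] := @rat_in_itvoo R x (x + 1) ltac:(by rewrite ltrDl).
  rewrite in_itv/= => /andP[xq _]; rewrite -(g1 (q := q)) ?rcdf_le//.
  by rewrite -(@ler_rat R) rmorph1 (le_trans x1)// ltW.
apply: le_rcdf => q xq; rewrite g1//.
by rewrite -(@ler_rat R) rmorph1 (le_trans x1)// ltW.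
Qed.

Let rcdf_Ny : rcdf @ -oo --> (0 : R).
Proof.
apply: cvg_near_cst; near=> x; apply: rcdf_N; near: x.
exact: nbhs_ninfty_lt.
Unshelve. all: by end_near. Qed.

Let rcdf_y : rcdf @ +oo --> (1 : R).
Proof.
apply: cvg_near_cst; near=> x; apply: rcdf_1; near: x.
exact: nbhs_pinfty_ge.
Unshelve. all: by end_near. Qed.

Lemma rcdf_measure : exists mu : probability R R,
  forall a b, a <= b -> mu `]a, b]%classic = (rcdf b - rcdf a)%:E.
Proof.
pose f : cumulativeBounded (0 : R) (1 : R) := HB.pack rcdf
  (isCumulative.Build R _ R rcdf rcdf_nd rcdf_rc)
  (isCumulativeBounded.Build R 0 1 rcdf rcdf_Ny rcdf_y).
(* The Lebesgue-Stieltjes measure lives on [measurableTypeR R]; its image under the identity is a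
   measure on [R]. *)
have mid : measurable_fun [set: measurableTypeR R] (idfun : measurableTypeR R -> R).
  by move=> _ A mA; rewrite setTI.
pose idTR : {mfun measurableTypeR R >-> R} :=
  HB.pack (idfun : measurableTypeR R -> R) (isMeasurableFun.Build _ _ _ _ _ mid).
exists (distribution (lebesgue_stieltjes_measure f) idTR) => a b ab.
suff : lebesgue_stieltjes_measure f `]a, b]%classic = (f b - f a)%:E by [].
rewrite /lebesgue_stieltjes_measure /measure_extension measurable_mu_extE/=; last exact: is_ocitv.
by rewrite wlength_itv_bnd.
Qed.

End rational_cdf.

Section condprob_le.
Context {dO : measure_display} {Omega : measurableType dO} {R : realType}.
Variables (P : probability Omega R) (G : set (set Omega)).
Hypothesis sG : sigma_algebra setT G.
Hypothesis GM : G `<=` measurable.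

(** Tested on the set [g < f], which belongs to [G], the hypothesis makes the integral of the
    positive part of [f - g] vanish; finiteness of [EE P g] allows the subtraction. *)
Lemma le_integral_ae (f g : Omega -> R) : Gmeas G f -> Gmeas G g ->
  (forall w, 0 <= f w) -> (forall w, 0 <= g w) -> (EE P g < +oo)%E ->
  (forall A, G A -> (\int[P]_(w in A) (f w)%:E <= \int[P]_(w in A) (g w)%:E)%E) ->
  \forall w \ae P, f w <= g w.
Proof.
move=> Gf Gg f0 g0 gfin H.
have mf := Gmeas_measurable GM Gf; have mg := Gmeas_measurable GM Gg.
pose h w := Num.max (f w - g w) 0.
have mh : measurable_fun setT h by apply: measurable_maxr => //; exact: measurable_funB.
pose A : set Omega := [set w | g w < f w].
have GA : G A.
  rewrite -sub_sigma_measurableE// -[X in measurable X]setTI.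
  rewrite (_ : A = (fun w => g w < f w) @^-1` [set true]); last by apply/seteqP; split.
  by apply: (measurable_fun_ltr _ _ measurableT) => //; exact/GmeasP.
have mA := GM GA.
have gA : (\int[P]_(w in A) (g w)%:E < +oo)%E.
  apply: le_lt_trans gfin; apply: ge0_subset_integral => //.
    exact/measurable_EFinP.
  by move=> w _; rewrite lee_fin.
have h0 w : 0 <= h w by rewrite le_max lexx orbT.
have Eh : EE P h = 0%E.
  have -> : EE P h = (\int[P]_(w in A) (h w)%:E)%E.
    rewrite [RHS]integral_mkcond; apply: eq_integral => w _; rewrite patchE.
    case: ifPn => //; rewrite notin_setE /A/= => /negP; rewrite -leNgt => fg.
    by rewrite /h max_r// subr_le0.
  apply/eqP; rewrite eq_le; apply/andP; split; last first.
    by apply: integral_ge0 => w _; rewrite lee_fin.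
  have := H A GA.
  rewrite [X in (X <= _)%E](_ : _ = \int[P]_(w in A) (h w)%:E + \int[P]_(w in A) (g w)%:E)%E.
    rewrite -[X in (_ <= X)%E -> _]add0e leeD2rE// ge0_fin_numE//.
    by apply: integral_ge0 => w _; rewrite lee_fin.
  rewrite -ge0_integralD//.
  - apply: eq_integral => w; rewrite inE /A/= => /ltW fg; rewrite -EFinD /h max_l ?subr_ge0//.
    by rewrite subrK.
  - by move=> w _; rewrite lee_fin.
  - by apply: measurable_funTS; exact/measurable_EFinP.
  - by move=> w _; rewrite lee_fin.
  - by apply: measurable_funTS; exact/measurable_EFinP.
apply: filterS (EE_eq0_ae mh h0 Eh) => w hw.
by rewrite -subr_le0 -hw /h le_max lexx.
Qed.

End condprob_le.

Section rcd_real.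
Context {dO : measure_display} {Omega : measurableType dO} {R : realType}.
Variables (P : probability Omega R) (G : set (set Omega)).
Hypothesis sG : sigma_algebra setT G.
Hypothesis GM : G `<=` measurable.
Variable Y : Omega -> R.
Hypothesis mY : measurable_fun setT Y.
Hypothesis Y01 : forall w, 0 <= Y w <= 1.

Let mYle (x : R) : measurable [set w | Y w <= x].
Proof.
rewrite (_ : [set _ | _] = Y @^-1` `]-oo, x]%classic).
  by rewrite -[X in measurable X]setTI; exact: mY.
by apply/seteqP; split => w; rewrite /= in_itv.
Qed.

(** Versions of the conditional probabilities chosen separately for each rational are monotone only
    almost surely. Countably many pairs of rationals are involved, so the exceptional set is null;
    it also lies in [G], so the versions can be changed there without losing measurability. *)
Lemma rational_condcdf : exists g : Omega -> rat -> R,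
  [/\ forall w p q, p <= q -> g w p <= g w q,
      forall w q, q < 0 -> g w q = 0,
      forall w q, 1 <= q -> g w q = 1,
      forall q, Gmeas G (g ^~ q) &
      forall q A, G A -> (\int[P]_(w in A) (g w q)%:E =
        P ([set w | (Y w <= ratr q)%R] `&` A))%E].
Proof.
have /choice[f0 Hf0] : forall q : rat, exists f : Omega -> R,
    is_condprob P G [set w | Y w <= ratr q] f /\ (forall w, 0 <= f w).
  move=> q; have [f [cf f0 _]] := condprob_exists P sG GM (mYle (ratr q)).
  by exists f.
(* As [Y] takes values in [0, 1], the values below 0 and from 1 on can be prescribed, and no limits
   at infinity have to be repaired. *)
pose f (q : rat) w : R := if q < 0 then 0 else if 1 <= q then 1 else f0 q w.
have f_ge0 q w : 0 <= f q w.
  by rewrite /f; case: ifP => // _; case: ifP => // _; exact: (Hf0 q).2.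
have Gf q : Gmeas G (f q).
  rewrite /f; case: (q < 0); first exact: Gmeas_cst.
  by case: (1 <= q); [exact: Gmeas_cst|exact: (Hf0 q).1.1].
have fP q A : G A -> (\int[P]_(w in A) (f q w)%:E =
        P ([set w | (Y w <= ratr q)%R] `&` A))%E.
  move=> GA; rewrite /f; have [q0|q0] := boolP (q < 0).
    rewrite integral0 (_ : _ `&` _ = set0) ?measure0//.
    apply/seteqP; split => // w [/= Yq _].
    have := le_trans (andP (Y01 w)).1 Yq; rewrite leNgt => /negP; apply.
    by rewrite ltrq0.
  have [q1|q1] := boolP (1 <= q); last exact: (Hf0 q).1.2.
  rewrite integral_cst; last exact: GM.
  rewrite mul1e; congr (P _); apply/seteqP; split => [w Aw|w []//]; split => //=.
  apply: le_trans (andP (Y01 w)).2 _.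
  by rewrite -(ler_rat R) rmorph1 in q1.
have fmono p q : p <= q -> \forall w \ae P, f p w <= f q w.
  move=> pq; apply: (le_integral_ae sG GM) => //.
    rewrite /EE (fP q setT); last by rewrite -sub_sigma_measurableE.
    by rewrite (le_lt_trans (probability_le1 _ _)) ?ltry// setIT.
  move=> A GA; rewrite !fP//; apply: le_measure; rewrite ?inE.
  - by apply: measurableI => //; exact: GM.
  - by apply: measurableI => //; exact: GM.
  - by move=> w [/= Yp Aw]; split => //=; rewrite (le_trans Yp)// ler_rat.
pose good : set Omega := [set w | forall p q, p <= q -> f p w <= f q w].
have Ggood : G good.
  rewrite -sub_sigma_measurableE//.
  rewrite (_ : good = \bigcap_n (if @unpickle (rat * rat)%type n is Some (p, q) then
      [set w | (p <= q) ==> (f p w <= f q w)] else setT)); last first.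
    apply/seteqP; split => [w gw n _|w gw p q pq].
      by case: (@unpickle (rat * rat)%type n) => // -[p q] /=; apply/implyP; exact: gw.
    by have := gw (pickle (p : rat, q : rat)) I; rewrite pickleK/= pq.
  apply: bigcapT_measurable => n; case: (@unpickle (rat * rat)%type n) => [[p q]|//].
  have [pq|pq] := boolP (p <= q).
    rewrite -[X in measurable X]setTI.
    by apply: (measurable_fun_ler _ _ measurableT (Y := [set true])) => //; exact/GmeasP.
  by rewrite (_ : [set _ | _] = setT)//; apply/seteqP; split.
have aegood : \forall w \ae P, good w.
  have : \forall w \ae P, forall n : nat,
    if @unpickle (rat * rat)%type n is Some (p, q) then p <= q -> f p w <= f q w else True.
    apply: ae_foralln => n; case: (@unpickle (rat * rat)%type n) => [[p q]|]; last exact/aeW.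
    have [pq|pq] := boolP (p <= q); last by apply/aeW.
    by apply: filterS (fmono p q pq) => w.
  apply: filterS => w H p q; have := H (pickle (p : rat, q : rat)).
  by rewrite pickleK.
(* Off [good], this is the distribution function of the unit mass at 0. *)
pose g w (q : rat) : R := if w \in good then f q w else if 0 <= q then 1 else 0.
have Gg q : Gmeas G (g ^~ q).
  apply/GmeasP => //; apply: measurable_fun_ifT => //.
    apply: (measurable_fun_bool true).
    rewrite setTI (_ : _ @^-1` _ = good) ?sub_sigma_measurableE//.
    by apply/seteqP; split => w /=; [move/set_mem|move/mem_set].
  exact/GmeasP.
exists g; split.
- move=> w p q pq; rewrite /g; case: ifPn => [|_]; first by rewrite inE; exact.
  by case: (leP 0 p) => [p0|_]; [rewrite (le_trans p0 pq)|case: ifP].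
- by move=> w q q0; rewrite /g /f q0 leNgt q0/=; case: ifP.
- move=> w q q1; rewrite /g /f (le_trans ler01 q1).
  by rewrite ltNge (le_trans ler01 q1)/= q1; case: ifP.
- exact: Gg.
move=> q A GA; rewrite -fP//; apply: ae_eq_integral => //; first exact: GM.
- by apply: measurable_funTS; exact/measurable_EFinP/(Gmeas_measurable GM).
- by apply: measurable_funTS; exact/measurable_EFinP/(Gmeas_measurable GM).
- by apply: filterS aegood => w gw _; rewrite /g mem_set.
Qed.

End rcd_real.

Lemma bounded_cvg_integral {dO : measure_display} {Omega : measurableType dO}
    {R : realType} (P : probability Omega R) (A : set Omega)
    (f_ : nat -> Omega -> R) (f : Omega -> R) (M : R) :
  measurable A -> (forall n, measurable_fun setT (f_ n)) -> measurable_fun setT f ->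
  (forall n w, `|f_ n w| <= M) -> (forall w, f_ n w @[n --> \oo] --> f w) ->
  (\int[P]_(w in A) (f_ n w)%:E @[n --> \oo] --> \int[P]_(w in A) (f w)%:E)%E.
Proof.
move=> mA mf_ mf fM fcvg.
have [] // := @dominated_convergence _ _ _ P A mA (fun n w => (f_ n w)%:E)
    (fun w => (f w)%:E) (cst M%:E).
- by move=> n; apply: measurable_funTS; exact/measurable_EFinP.
- by apply: measurable_funTS; exact/measurable_EFinP.
- by apply/aeW => w _; apply/cvg_EFin; [exact: nearW|exact: fcvg].
- exact: finite_measure_integrable_cst.
- by apply/aeW => w n _; rewrite lee_fin.
Qed.

Section rcd_real.
Context {dO : measure_display} {Omega : measurableType dO} {R : realType}.
Variables (P : probability Omega R) (G : set (set Omega)).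
Hypothesis sG : sigma_algebra setT G.
Hypothesis GM : G `<=` measurable.

(** The sets with both properties form a Dynkin system, so a generating class closed under
    intersections suffices. The target space is general because a product space occurs in
    [rcd_joint]. *)
Lemma rcd_dynkin dV (V : measurableType dV) (C : set (set V)) (Y : Omega -> V)
    (nu : Omega -> probability V R) :
  measurable_fun setT Y ->
  @measurable _ V = <<s C >> -> setI_closed C ->
  (forall B, C B -> Gmeas (V := \bar R) G (fun w => nu w B) /\
    forall A, G A -> (\int[P]_(w in A) nu w B = P (A `&` Y @^-1` B))%E) ->
  forall B, measurable B -> Gmeas (V := \bar R) G (fun w => nu w B) /\
    forall A, G A -> (\int[P]_(w in A) nu w B = P (A `&` Y @^-1` B))%E.
Proof.
move=> mY CE CI HC B mB.
have mYB S : measurable S -> measurable (Y @^-1` S).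
  by move=> mS; rewrite -[X in measurable X]setTI; exact: mY.
have mnu S A : Gmeas G (fun w => nu w S) -> measurable_fun A (fun w => nu w S).
  by move=> /(Gmeas_measurable GM); exact: measurable_funTS.
pose Q := [set B : set V | Gmeas (V := \bar R) G (fun w => nu w B) /\
    forall A, G A -> (\int[P]_(w in A) nu w B = P (A `&` Y @^-1` B))%E].
suff : Q B by [].
apply: (@dynkin_induction _ V C Q CE CI) => //; last by rewrite -CE.
- split.
    rewrite (_ : (fun w => _) = cst 1%E); first exact: Gmeas_cst.
    by apply/funext => w; exact: probability_setT.
  move=> A GA; rewrite preimage_setT setIT.
  rewrite (eq_integral (cst 1%E)); last by move=> w _; exact: probability_setT.
  by rewrite integral_cst ?mul1e//; exact: GM.
- move=> S mS [GS IS]; split.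
    rewrite (_ : (fun w => _) = (fun w => 1 - nu w S)%E); last first.
      by apply/funext => w; exact: probability_setC.
    apply/GmeasP => //; apply: emeasurable_funB => //; exact/GmeasP.
  move=> A GA; have mA := GM GA.
  have PAS : (P (A `&` Y @^-1` S) + P (A `&` Y @^-1` (~` S)) = P A)%E.
    rewrite -measureU//; last by rewrite setIACA setIid preimage_setC setICr setI0.
    - by rewrite -setIUr preimage_setC setUCr setIT.
    - by apply: measurableI => //; exact: mYB.
    - by apply: measurableI => //; apply: mYB; exact: measurableC.
  have fP B' : measurable B' -> P B' \is a fin_num.
    by move=> mB'; exact: fin_num_measure.
  have IPAS : (\int[P]_(w in A) nu w S + \int[P]_(w in A) nu w (~` S) = P A)%E.
    rewrite -ge0_integralD//; last 2 first.
    - exact: mnu.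
    - apply: mnu; rewrite (_ : (fun w => _) = (fun w => 1 - nu w S)%E); last first.
        by apply/funext => w; exact: probability_setC.
      by apply/GmeasP => //; apply: emeasurable_funB => //; exact/GmeasP.
    rewrite (eq_integral (cst 1%E)) ?integral_cst ?mul1e//.
    move=> w _ /=; rewrite probability_setC// addeC subeK//.
    exact: fin_num_measure.
  move: IPAS; rewrite IS// -PAS => /(congr1 (fun t => t - P (A `&` Y @^-1` S))%E).
  rewrite ![(P (A `&` Y @^-1` S) + _)%E]addeC !addeK//; apply: fP.
  - by apply: measurableI => //; exact: mYB.
  - by apply: measurableI => //; exact: mYB.
- move=> F mF tF HF; split.
    rewrite (_ : (fun w => _) = (fun w => \sum_(0 <= k <oo) nu w (F k)))%E; last first.
      by apply/funext => w; rewrite measure_semi_bigcup//; exact: bigcup_measurable.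
    apply/GmeasP => //; apply: ge0_emeasurable_sum => // k _; apply/GmeasP => //.
    by have [] := HF k.
  move=> A GA; have mA := GM GA.
  rewrite (eq_integral (fun w => \sum_(0 <= k <oo) nu w (F k))%E); last first.
    by move=> w _; rewrite measure_semi_bigcup//; exact: bigcup_measurable.
  rewrite integral_nneseries//; last by move=> n; apply: mnu; have [] := HF n.
  rewrite preimage_bigcup setI_bigcupr measure_semi_bigcup//.
  + by apply: eq_eseriesr => n _; apply: (HF n).2.
  + by move=> n; apply: measurableI => //; exact: mYB.
  + apply/trivIsetP => i j _ _ ij; apply/seteqP; split => // w [[_ Fi] [_ Fj]].
    have FF : F i `&` F j = set0 by move/trivIsetP : tF => /(_ i j I I ij).
    by have : (F i `&` F j) (Y w) by []; rewrite FF.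
  + by apply: bigcup_measurable => n _; apply: measurableI => //; exact: mYB.
Qed.

(** Rationals tending to [x] from above carry the identity from rational to real levels by bounded
    convergence; differences give half-open intervals, which generate the Borel sets. *)
Lemma rcd_real_exists (Y : Omega -> R) : measurable_fun setT Y ->
  (forall w, 0 <= Y w <= 1) ->
  exists nu : Omega -> probability R R,
  forall B, measurable B -> Gmeas (V := \bar R) G (fun w => nu w B) /\
    forall A, G A -> (\int[P]_(w in A) nu w B = P (A `&` Y @^-1` B))%E.
Proof.
move=> mY Y01.
have [g [g_nd g0 g1 Gg gP]] := rational_condcdf P sG GM mY Y01.
have /choice[nu Hnu] : forall w, exists mu : probability R R,
    forall a b, a <= b -> mu `]a, b]%classic = (rcdf (g w) b - rcdf (g w) a)%:E.
  by move=> w; exact: (rcdf_measure (g_nd w) (g0 w) (g1 w)).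
pose H x w := rcdf (g w) x.
have g01 w q : 0 <= g w q <= 1.
  apply/andP; split.
    have [/g0->//|q0] := ltP q 0.
    by rewrite -(g0 w (-1))// g_nd// (le_trans _ q0).
  have [/g1->//|q0] := leP 1 q.
  by rewrite -(g1 w 1)// g_nd// ltW.
have mYle (x : R) : measurable [set w | Y w <= x].
  rewrite (_ : [set _ | _] = Y @^-1` `]-oo, x]%classic).
    by rewrite -[X in measurable X]setTI; exact: mY.
  by apply/seteqP; split => w; rewrite /= in_itv.
have Hq (x : R) : exists q : nat -> rat, forall n, x < ratr (q n) < x + n.+1%:R^-1.
  suff /choice : forall n : nat, exists q : rat, x < ratr q < x + n.+1%:R^-1.
    by move=> [q xq]; exists q.
  move=> n; have [q] := @rat_in_itvoo R x (x + n.+1%:R^-1) ltac:(by rewrite ltrDl invr_gt0).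
  by rewrite in_itv/= => ?; exists q.
have qcvg (x : R) (q : nat -> rat) : (forall n, x < ratr (q n) < x + n.+1%:R^-1) ->
    forall y, x < y -> \forall n \near \oo, ratr (q n) < y.
  move=> xq y xy.
  have : \forall n \near \oo, n.+1%:R^-1 < y - x :> R.
    near=> n; rewrite invf_plt ?posrE ?subr_gt0//.
    by rewrite (lt_le_trans (y := n%:R)) ?ler_nat//; near: n; exact: nbhs_infty_gtr.
  apply: filterS => n; rewrite ltrBrDl => /(lt_trans _); apply.
  by have /andP[] := xq n.
have gcvg (x : R) w (q : nat -> rat) : (forall n, x < ratr (q n) < x + n.+1%:R^-1) ->
    g w (q n) @[n --> \oo] --> H x w.
  move=> xq; apply/cvgrPdist_le => e e0.
  have [r xr gr] := rcdf_lt (g_nd w) (g0 w) x e0.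
  apply: filterS (qcvg x q xq _ xr) => n qr.
  have /andP[xqn _] := xq n.
  rewrite ler0_norm ?subr_le0 ?(rcdf_le (g_nd w) (g0 w))// opprB lerBlDl.
  by apply: le_trans (ltW gr); apply: g_nd; rewrite -(ler_rat R) ltW.
have GH x : Gmeas G (H x).
  have [q xq] := Hq x.
  apply/GmeasP => //; apply: (@measurable_fun_cvg _ (g_sigma_algebraType G) R setT (fun n w => g w (q n))).
    by move=> n; exact/GmeasP.
  by move=> w _; exact: gcvg.
have HP x A : G A -> (\int[P]_(w in A) (H x w)%:E =
    P (A `&` [set w | (Y w <= x)%R]))%E.
  move=> GA; have mA := GM GA.
  have [q xq] := Hq x.
  have icvg w : \1_[set w | Y w <= ratr (q n)] w @[n --> \oo] --> (\1_[set w | Y w <= x] w : R).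
    apply: cvg_near_cst; have [Yx|xY] := leP (Y w) x.
      apply: nearW => n; rewrite !indicE !mem_set//=.
      by have /andP[/ltW + _] := xq n; exact: le_trans.
    apply: filterS (qcvg x q xq _ xY) => n qY; rewrite !indicE !memNset//=.
      by apply/negP; rewrite -ltNge.
    by apply/negP; rewrite -ltNge.
  have c1 : (\int[P]_(w in A) (g w (q n))%:E @[n --> \oo] --> \int[P]_(w in A) (H x w)%:E)%E.
    apply: (bounded_cvg_integral (M := 1)) => //.
    - by move=> n; exact: Gmeas_measurable (Gg _).
    - exact: Gmeas_measurable (GH x).
    - by move=> n w; have /andP[? ?] := g01 w (q n); rewrite ger0_norm.
    - by move=> w; exact: gcvg.
  have c2 : (\int[P]_(w in A) (\1_[set w | (Y w <= ratr (q n))%R] w)%:E @[n --> \oo] -->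
      \int[P]_(w in A) (\1_[set w | (Y w <= x)%R] w)%:E)%E.
    apply: (bounded_cvg_integral (M := 1)) => //.
    - by move=> n; exact: measurable_indic.
    - by move=> n w; rewrite indicE; case: (_ \in _); rewrite ?normr1 ?normr0.
  move: c1 c2; rewrite integral_indic// setIC => c1 c2.
  apply: cvg_unique c2 => //.
  rewrite (_ : (fun n => _) = (fun n => \int[P]_(w in A) (g w (q n))%:E)%E)//.
  by apply/funext => n; rewrite /= gP// integral_indic.
exists nu; apply: (rcd_dynkin mY (C := @ocitv R)) => //.
- exact: ocitvI.
- move=> _ [[a b] _ <-] /=.
  have [ab|ba] := leP a b; last first.
    rewrite set_itv_ge; last by rewrite bnd_simp -leNgt ltW.
    split.
      rewrite (_ : (fun w => _) = cst 0%E); first exact: Gmeas_cst.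
      by apply/funext => w; rewrite measure0.
    by move=> A GA; rewrite preimage_set0 setI0 measure0 integral0_eq// => w _; rewrite measure0.
  have nuE w : nu w `]a, b]%classic = (H b w - H a w)%:E by rewrite Hnu.
  have GHH : Gmeas G (fun w => (H b w - H a w)).
    by apply/GmeasP => //; apply: measurable_funB; exact/GmeasP.
  split.
    rewrite (_ : (fun w => _) = (fun w => (H b w - H a w)%:E)); last exact/funext.
    by apply/GmeasP => //; apply/measurable_EFinP; exact/GmeasP.
  move=> A GA; have mA := GM GA.
  under eq_integral do rewrite nuE.
  have H0 x w : 0 <= H x w.
    apply: le_rcdf => q _; by have /andP[] := g01 w q.
  have Hab w : H a w <= H b w.
    apply: le_rcdf => q bq; apply: (rcdf_le (g_nd w) (g0 w)).
    exact: le_lt_trans bq.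
  have mH x : measurable_fun A (fun w => (H x w)%:E).
    by apply: measurable_funTS; apply/measurable_EFinP; exact: Gmeas_measurable (GH x).
  have E1 : (\int[P]_(w in A) (H a w)%:E + \int[P]_(w in A) (H b w - H a w)%:E
      = \int[P]_(w in A) (H b w)%:E)%E.
    rewrite -ge0_integralD//.
    - by apply: eq_integral => w _; rewrite -EFinD addrC subrK.
    - by move=> w _; rewrite lee_fin.
    - by move=> w _; rewrite lee_fin subr_ge0.
    - apply: measurable_funTS; apply/measurable_EFinP; exact: Gmeas_measurable GHH.
  have E2 : (P (A `&` [set w | (Y w <= a)%R]) + P (A `&` Y @^-1` `]a, b]) =
      P (A `&` [set w | (Y w <= b)%R]))%E.
    rewrite -measureU//.
    - congr (P _); rewrite -setIUr; congr (_ `&` _); apply/seteqP; split => w /=.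
        by rewrite in_itv/= => -[Ya|/andP[]//]; exact: le_trans ab.
      by rewrite in_itv/= => ->; case: leP => ?; [left|right].
    - exact: measurableI.
    - by apply: measurableI => //; rewrite -[X in measurable X]setTI; exact: mY.
    - apply/seteqP; split => // w [[_ /= Ya] [_ /=]]; rewrite in_itv/= => /andP[aY _].
      by move: Ya; rewrite leNgt aY.
  move: E1; rewrite !HP// -E2 => /(congr1 (fun t => t - P (A `&` [set w | (Y w <= a)%R]))%E).
  rewrite ![(P (A `&` [set w | (Y w <= a)%R]) + _)%E]addeC !addeK//.
  - exact/fin_num_measure/measurableI.
  - exact/fin_num_measure/measurableI.
Unshelve. all: by end_near. Qed.

End rcd_real.

(* Reals are coded by points of the Cantor set, which reduces the existence of conditional
   distributions on [R^d] to that on [0, 1]. *)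
Section cantor_code.
Context {R : realType}.
Implicit Types b : nat -> bool.

Definition cpartial b (n : nat) : R := \sum_(0 <= k < n) (if b k then 2 / 3 ^+ k.+1 else 0).

Let cpartialS b n : cpartial b n.+1 =
  (if b 0%N then 2 / 3 else 0) + cpartial (fun k => b k.+1) n / 3.
Proof.
rewrite /cpartial big_nat_recl// expr1 mulr_suml; congr (_ + _).
apply: eq_bigr => k _; case: (b k.+1); last by rewrite mul0r.
by rewrite [in LHS]exprS; field; rewrite expf_neq0.
Qed.

Let cpartial_ge0 b n : 0 <= cpartial b n.
Proof. by apply: sumr_ge0 => k _; case: (b k) => //; rewrite divr_ge0// exprn_ge0. Qed.

Let cpartial_le1 b n : cpartial b n <= 1.
Proof.
elim: n b => [|n IH] b; first by rewrite /cpartial big_nil.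
rewrite cpartialS; have := IH (fun k => b k.+1); case: (b 0%N); lra.
Qed.

Lemma cpartial_cvg b : cvg (cpartial b n @[n --> \oo]).
Proof.
apply: nondecreasing_is_cvgn.
  apply/nondecreasing_seqP => n; rewrite /cpartial big_nat_recr//= lerDl.
  by case: (b n) => //; rewrite divr_ge0// exprn_ge0.
by exists 1 => _ [n _ <-].
Qed.

Definition ccode b : R := limn (cpartial b).

Lemma ccode_bound b : 0 <= ccode b <= 1.
Proof.
apply/andP; split.
  by apply: limr_ge; [exact: cpartial_cvg|exact: nearW].
by apply: limr_le; [exact: cpartial_cvg|exact: nearW].
Qed.

Lemma ccodeS b : ccode b = (if b 0%N then 2 / 3 else 0) + ccode (fun k => b k.+1) / 3.
Proof.
have c1 : cpartial b n.+1 @[n --> \oo] --> ccode b.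
  by rewrite (cvg_shiftS (cpartial b)); exact: cpartial_cvg.
apply/esym/(cvg_unique _ _ c1) => //.
rewrite (_ : (fun n => _) = (fun n => (if b 0%N then 2 / 3 else 0) +
   cpartial (fun k => b k.+1) n / 3)); last by apply/funext => n; exact: cpartialS.
apply: cvgD; first exact: cvg_cst.
by apply: cvgMl; exact: cpartial_cvg.
Qed.

(** Iterates of the ternary shift. Codes use the digits 0 and 2 only, hence lie in [0, 1/3] or in
    [2/3, 1], and the test against 1/2 reads the first digit without ambiguity; binary expansions
    would not be unique. *)
Fixpoint cshift (n : nat) (y : R) : R :=
  if n is m.+1 then let z := cshift m y in 3 * z - (if 1 / 2 <= z then 2 else 0) else y.

Definition cbit n y : bool := 1 / 2 <= cshift n y.

Let ccode_bit b : (1 / 2 <= ccode b) = b 0%N.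
Proof.
have := ccode_bound (fun k => b k.+1); rewrite (ccodeS b).
case: (b 0%N) => /andP[h1 h2]; first by apply/idP; lra.
by apply/negbTE; rewrite -ltNge; lra.
Qed.

Let cshift_code b n : cshift n (ccode b) = ccode (fun k => b (n + k)%N).
Proof.
elim: n => [//|n IH] /=; rewrite IH ccode_bit addn0 [in LHS]ccodeS addn0.
under [in RHS]eq_fun do rewrite addSnnS.
by case: (b n); lra.
Qed.

Lemma cbit_code b n : cbit n (ccode b) = b n.
Proof. by rewrite /cbit cshift_code ccode_bit addn0. Qed.

Lemma measurable_cshift n : measurable_fun setT (cshift n).
Proof.
elim: n => [|n IH] /=; first exact: measurable_id.
apply: measurable_funB; first exact: measurable_funM.
apply: measurable_fun_ifT => //.
exact: measurable_fun_ler.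
Qed.

Lemma measurable_cbit n : measurable_fun setT (cbit n).
Proof. apply: measurable_fun_ler => //; exact: measurable_cshift. Qed.

Lemma measurable_ccode dT (T : measurableType dT) (b : nat -> T -> bool) :
  (forall n, measurable_fun setT (b n)) ->
  measurable_fun setT (fun x => ccode (b ^~ x)).
Proof.
move=> mb; apply: (@measurable_fun_cvg _ _ _ setT (fun n x => cpartial (b ^~ x) n)).
  move=> n; rewrite /cpartial; apply: measurable_sum => k.
  exact: measurable_fun_ifT.
by move=> x _; exact: cpartial_cvg.
Qed.

End cantor_code.

Section tuple_code.
Context {R : realType} {d : nat}.

(** The Dedekind cuts of all coordinates, laid out as one sequence of bits by enumerating the pairs
    of a rational and an index. *)
Definition tbit (n : nat) (x : d.-tuple R) : bool :=
  if @unpickle (rat * 'I_d)%type n is Some (q, i) then ratr q < tnth x i else false.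

Definition tcode (x : d.-tuple R) : R := ccode (tbit ^~ x).

(** The supremum of the cut; rationals outside it and indices that code nothing contribute -oo. The
    formula is measurable on all of [R], not only on codes. *)
Definition tdecode_coord (i : 'I_d) (y : R) : R :=
  fine (esups (fun n => if @unpickle (rat * 'I_d)%type n is Some (q, j) then
     if (j == i) && cbit n y then (ratr q)%:E else -oo%E else -oo%E) 0%N).

Definition tdecode (y : R) : d.-tuple R := [tuple tdecode_coord i y | i < d].

Lemma measurable_tcode : measurable_fun setT tcode.
Proof.
apply: measurable_ccode => n; rewrite /tbit.
case: unpickle => [[q i]|]; last exact: measurable_cst.
apply: measurable_fun_ltr => //; exact: measurable_tnth.
Qed.

Lemma measurable_tdecode : measurable_fun setT tdecode.
Proof.
apply/measurable_fun_tnthP => i.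
rewrite (_ : _ \o _ = tdecode_coord i); last by apply/funext => y; rewrite /= tnth_mktuple.
rewrite /tdecode_coord; apply: measurableT_comp => //.
apply: measurable_fun_esups => n.
case: unpickle => [[q j]|]; last exact: measurable_cst.
apply: measurable_fun_ifT => //; apply: measurable_and => //; exact: measurable_cbit.
Qed.

Lemma tcodeK x : tdecode (tcode x) = x.
Proof.
apply: eq_from_tnth => i; rewrite tnth_mktuple /tdecode_coord.
set f := (X in esups X); suff -> : esups f 0%N = (tnth x i)%:E by [].
apply/eqP; rewrite eq_le; apply/andP; split.
  apply: ub_ereal_sup => _ [n _ <-]; rewrite /f.
  case En : unpickle => [[q j]|]; last exact: leNye.
  case: ifPn; last by rewrite leNye.
  by rewrite /tcode cbit_code /tbit En => /andP[/eqP <-] /ltW; rewrite lee_fin.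
apply/lee_addgt0Pr => e e0.
have [q] := @rat_in_itvoo R (tnth x i - e) (tnth x i) ltac:(by rewrite gtrDl oppr_lt0).
rewrite in_itv/= => /andP[eq qx].
apply: (@le_trans _ _ ((ratr q)%:E + e%:E)%E).
  by rewrite -EFinD lee_fin -lerBlDr ltW.
rewrite leeD2r//; apply: ereal_sup_ubound; exists (pickle (q, i)) => //.
by rewrite /f pickleK /tcode cbit_code /tbit pickleK eqxx qx.
Qed.

End tuple_code.

Section rcd_tuple.
Context {dO : measure_display} {Omega : measurableType dO} {R : realType}.
Variables (P : probability Omega R) (G : set (set Omega)).
Hypothesis sG : sigma_algebra setT G.
Hypothesis GM : G `<=` measurable.

(** The conditional law of the code, a random variable in [0, 1], is mapped back by [tdecode]. *)
Lemma rcd_exists (d : nat) (X : Omega -> d.-tuple R) : measurable_fun setT X ->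
  exists nu, is_rcd P G X nu.
Proof.
move=> mX; have mY : measurable_fun setT (tcode \o X).
  apply: measurableT_comp => //; exact: measurable_tcode.
have [nu Hnu] := rcd_real_exists P sG GM mY (fun w => ccode_bound _).
pose g : {mfun R >-> d.-tuple R} := HB.pack (@tdecode R d)
  (isMeasurableFun.Build _ _ _ _ _ (@measurable_tdecode R d)).
exists (fun w => distribution (nu w) g) => B mB.
have mgB : measurable (g @^-1` B) by rewrite -[X in measurable X]setTI; exact: measurable_tdecode.
have [G1 I1] := Hnu _ mgB; split => //.
move=> A GA; rewrite /= I1//; congr (P (_ `&` _)).
by apply/seteqP; split => w /=; rewrite tcodeK.
Qed.

End rcd_tuple.

(** * Vectors and supports *)

Section vectors.
Context {R : realType} {d : nat}.
Implicit Types u v x y : d.-tuple R.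

Lemma cauchy_schwarz_sum (I : finType) (a b : I -> R) :
  (\sum_i a i * b i) ^+ 2 <= (\sum_i a i ^+ 2) * (\sum_i b i ^+ 2).
Proof.
set A := \sum_i a i ^+ 2; set B := \sum_i b i ^+ 2; set C := \sum_i a i * b i.
have B0 : 0 <= B by apply: sumr_ge0 => i _; exact: sqr_ge0.
have [B_eq0|B_neq0] := eqVneq B 0.
  have b0 i : b i = 0.
    apply/eqP; rewrite -sqrf_eq0; apply/eqP.
    by have /psumr_eq0P : B = 0 by []; apply => // j _; exact: sqr_ge0.
  rewrite /C big1 ?expr0n/= ?B_eq0 ?mulr0// => i _; by rewrite b0 mulr0.
(* This sum of squares expands to [B * (A * B - C ^+ 2)], and [B] is positive here. *)
have : 0 <= \sum_i (B * a i - C * b i) ^+ 2 by apply: sumr_ge0 => i _; exact: sqr_ge0.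
rewrite (_ : \sum_i _ = B * (A * B - C ^+ 2)).
  by rewrite pmulr_rge0 ?lt0r ?B_neq0// subr_ge0.
transitivity (\sum_i (B ^+ 2 * a i ^+ 2 + C ^+ 2 * b i ^+ 2 - 2 * B * C * (a i * b i))).
  by apply: eq_bigr => i _; ring.
rewrite big_split/= big_split/= -!mulr_sumr sumrN -mulr_sumr -/A -/B -/C; ring.
Qed.

Lemma dotv_sqr u : dotv u u = \sum_i (tnth u i) ^+ 2.
Proof. by apply: eq_bigr => i _; rewrite expr2. Qed.

Lemma dotv_ge0 u : 0 <= dotv u u.
Proof. by rewrite dotv_sqr; apply: sumr_ge0 => i _; exact: sqr_ge0. Qed.

Lemma enorm_ge0 u : 0 <= enorm u. Proof. exact: sqrtr_ge0. Qed.

Lemma sqr_enorm u : enorm u ^+ 2 = dotv u u.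
Proof. by rewrite sqr_sqrtr// dotv_ge0. Qed.

Lemma dotvC u v : dotv u v = dotv v u.
Proof. by apply: eq_bigr => i _; rewrite mulrC. Qed.

Lemma normr_dotv u v : `|dotv u v| <= enorm u * enorm v.
Proof.
rewrite -(@ler_pXn2r _ 2) ?nnegrE ?mulr_ge0 ?enorm_ge0//.
rewrite exprMn !sqr_enorm real_normK ?num_real// !dotv_sqr.
exact: cauchy_schwarz_sum.
Qed.

Lemma dotv_le u v : dotv u v <= enorm u * enorm v.
Proof. exact: le_trans (ler_norm _) (normr_dotv u v). Qed.

Lemma enorm_eq0 u : enorm u = 0 -> u = zerov.
Proof.
move=> u0; have : dotv u u = 0 by rewrite -sqr_enorm u0 expr0n.
rewrite dotv_sqr => /psumr_eq0P u0'; apply: eq_from_tnth => i.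
rewrite tnth_mktuple; apply/eqP; rewrite -sqrf_eq0; apply/eqP.
by apply: u0' => // j _; exact: sqr_ge0.
Qed.

Lemma coord_le_enorm u i : `|tnth u i| <= enorm u.
Proof.
rewrite -(@ler_pXn2r _ 2) ?nnegrE ?enorm_ge0// real_normK ?num_real//.
rewrite sqr_enorm dotv_sqr (bigD1 i)//= lerDl.
by apply: sumr_ge0 => j _; exact: sqr_ge0.
Qed.

Lemma enorm_le_sum u : enorm u <= \sum_i `|tnth u i|.
Proof.
rewrite -(@ler_pXn2r _ 2) ?nnegrE ?enorm_ge0 ?sumr_ge0// sqr_enorm dotv_sqr.
rewrite [X in _ <= X]expr2 mulr_suml; apply: ler_sum => i _.
rewrite -[X in X <= _]real_normK ?num_real// expr2 ler_wpM2l//.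
by rewrite (bigD1 i)//= lerDl sumr_ge0.
Qed.

Lemma dotv_subr u x y : dotv u (subv x y) = dotv u x - dotv u y.
Proof. by rewrite /dotv -sumrB; apply: eq_bigr => i _; rewrite tnth_mktuple mulrBr. Qed.

Lemma dotv_subl u x y : dotv (subv x y) u = dotv x u - dotv y u.
Proof. by rewrite !(dotvC _ u) dotv_subr. Qed.

Lemma dotv0l u : dotv zerov u = 0.
Proof. by rewrite /dotv big1// => i _; rewrite tnth_mktuple mul0r. Qed.

Lemma enorm0 : enorm (zerov : d.-tuple R) = 0.
Proof. by rewrite /enorm dotv0l sqrtr0. Qed.

Lemma enorm_sub_tri x y z : enorm (subv x z) <= enorm (subv x y) + enorm (subv y z).
Proof.
rewrite -(@ler_pXn2r _ 2) ?nnegrE ?enorm_ge0 ?addr_ge0 ?enorm_ge0//.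
rewrite sqrrD !sqr_enorm.
rewrite (_ : dotv (subv x z) (subv x z) = dotv (subv x y) (subv x y) +
    dotv (subv x y) (subv y z) *+ 2 + dotv (subv y z) (subv y z)).
  by rewrite lerD2r lerD2l lerMn2r dotv_le.
rewrite !dotv_subr !dotv_subl (dotvC z x) (dotvC z y) (dotvC y x); ring.
Qed.

Lemma dotv_combvr u (l : R) x y :
  dotv u (combv l x y) = l * dotv u x + (1 - l) * dotv u y.
Proof.
rewrite /dotv !mulr_sumr -big_split; apply: eq_bigr => i _ /=.
by rewrite tnth_mktuple; ring.
Qed.

Lemma dotv_combvl u (l : R) x y :
  dotv (combv l x y) u = l * dotv x u + (1 - l) * dotv y u.
Proof. by rewrite !(dotvC _ u) dotv_combvr. Qed.

End vectors.

Section measurable_vectors.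
Context {dT : measure_display} {T : measurableType dT} {R : realType} {d : nat}.
Implicit Types f g : T -> d.-tuple R.
Local Notation mf f := (measurable_fun setT f).

Lemma measurable_coord f i : mf f -> mf (fun x => tnth (f x) i).
Proof. by move=> /measurable_fun_tnthP; exact. Qed.

Lemma measurable_mktuple (h : 'I_d -> T -> R) : (forall i, mf (h i)) ->
  mf (fun x => [tuple h i x | i < d]).
Proof.
move=> mh; apply/measurable_fun_tnthP => i.
rewrite (_ : _ \o _ = h i)//; by apply/funext => x /=; rewrite tnth_mktuple.
Qed.

Lemma measurable_dotv f g : mf f -> mf g -> mf (fun x => dotv (f x) (g x)).
Proof.
move=> mff mg; apply: measurable_sum => i.
by apply: measurable_funM; exact: measurable_coord.
Qed.

Lemma measurable_sqrt : measurable_fun setT (@Num.sqrt R).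
Proof. by apply: continuous_measurable_fun; exact: sqrt_continuous. Qed.

Lemma measurable_enorm f : mf f -> mf (fun x => enorm (f x)).
Proof.
by move=> mff; exact: (measurableT_comp measurable_sqrt (measurable_dotv mff mff)).
Qed.

Lemma measurable_subv f g : mf f -> mf g -> mf (fun x => subv (f x) (g x)).
Proof.
move=> mff mg; apply: measurable_mktuple => i.
by apply: measurable_funB; exact: measurable_coord.
Qed.

End measurable_vectors.

Lemma measurable_eball {R : realType} {d : nat} (x : d.-tuple R) e :
  measurable (eball x e).
Proof.
rewrite (_ : eball x e = (fun y => enorm (subv y x)) @^-1` `]-oo, e[%classic).
  rewrite -[X in measurable X]setTI; apply: measurable_enorm => //.
  exact: measurable_subv.
by apply/seteqP; split => y; rewrite /= in_itv.
Qed.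

Section support.
Context {R : realType} {d : nat}.
Variable nu : probability (d.-tuple R) R.
Implicit Types (u x y : d.-tuple R) (a : R).

(** Every point off the support has a null ball around it, and this ball contains a ball around the
    point with rational centre and radius [1 / (k + 1)]; there are countably many of the latter. *)
Lemma ae_msupport : \forall x \ae nu, msupport nu x.
Proof.
pose B (ck : d.-tuple rat * nat) : set (d.-tuple R) :=
  eball [tuple ratr (tnth ck.1 i) | i < d] (ck.2.+1%:R^-1).
pose F n : set (d.-tuple R) :=
  if @unpickle (d.-tuple rat * nat)%type n is Some ck then
    if nu (B ck) == 0%E then B ck else set0 else set0.
have F0 n : nu.-negligible (F n).
  rewrite /F; case: unpickle => [ck|]; last exact: negligible_set0.
  case: ifP => [/eqP B0|_]; last exact: negligible_set0.
  by apply/negligibleP => //; exact: measurable_eball.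
apply: negligibleS (negligible_bigcup F0) => x /= /existsNP[e /not_implyP[e0 /negP]].
rewrite -leNgt => nu0.
have {}nu0 : nu (eball x e) = 0%E by apply/eqP; rewrite eq_le nu0/= measure_ge0.
have [k ke] : exists k : nat, k.+1%:R^-1 < e / 2.
  exists (Num.trunc (e / 2)^-1); rewrite invf_plt ?posrE ?divr_gt0//.
  exact: truncnS_gt.
(* Dividing by [d.+1] instead of [d] covers [d = 0] and keeps the sum of the coordinate errors
   strictly below the radius. *)
have /choice[c Hc] : forall i : 'I_d, exists q : rat,
    `|ratr q - tnth x i| < k.+1%:R^-1 / d.+1%:R.
  move=> i; have [q] := @rat_in_itvoo R (tnth x i) (tnth x i + k.+1%:R^-1 / d.+1%:R)
    ltac:(by rewrite ltrDl divr_gt0).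
  rewrite in_itv/= => /andP[h1 h2]; exists q.
  by rewrite gtr0_norm ?subr_gt0// ltrBlDl.
pose ck : d.-tuple rat * nat := ([tuple c i | i < d], k).
pose cc : d.-tuple R := [tuple ratr (tnth ck.1 i) | i < d].
have xc : enorm (subv x cc) < k.+1%:R^-1.
  apply: le_lt_trans (enorm_le_sum _) _.
  apply: (@le_lt_trans _ _ (\sum_(i < d) k.+1%:R^-1 / d.+1%:R)).
    apply: ler_sum => i _; rewrite !tnth_mktuple distrC; exact: ltW.
  rewrite sumr_const card_ord -[_ *+ d]mulr_natr -mulrA gtr_pMr ?invr_gt0//.
  by rewrite mulrC ltr_pdivrMr// mul1r ltr_nat.
exists (pickle ck) => //; rewrite /F pickleK.
suff -> : nu (B ck) == 0%E by [].
rewrite -measure_le0 -nu0; apply: le_measure; rewrite ?inE; [exact: measurable_eball..|].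
move=> y yB; have yc : enorm (subv y cc) < k.+1%:R^-1 := yB.
rewrite /eball; apply: le_lt_trans (enorm_sub_tri _ cc _) _.
have : enorm (subv cc x) < k.+1%:R^-1.
  rewrite (_ : enorm (subv cc x) = enorm (subv x cc))//.
  by rewrite /enorm !dotv_subr !dotv_subl; congr Num.sqrt; ring.
move=> cx; rewrite [ltRHS]splitr ltrD//; [exact: lt_trans ke|exact: lt_trans ke].
Qed.

Lemma msupport_ae a u : (forall x, msupport nu x -> a + dotv u x = 0) ->
  \forall x \ae nu, a + dotv u x = 0.
Proof. by move=> H; apply: filterS ae_msupport. Qed.

(** A hyperplane is closed: around a point off it, the ball of radius [e] misses it by
    Cauchy-Schwarz and is therefore null. The 1 in the denominator of [e] covers [u = 0]. *)
Lemma ae_msupport_affine a u : (\forall x \ae nu, a + dotv u x = 0) ->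
  forall x, msupport nu x -> a + dotv u x = 0.
Proof.
move=> [N [mN N0 HN]] x sx; apply: contrapT => /eqP ax.
pose e := `|a + dotv u x| / (1 + enorm u).
have u1 : 0 < 1 + enorm u by rewrite ltr_pwDl// enorm_ge0.
have e0 : 0 < e by rewrite divr_gt0// normr_gt0.
have : (nu (eball x e) <= nu N)%E.
  apply: le_measure; rewrite ?inE//; first exact: measurable_eball.
  move=> y; rewrite /eball/= => yx; apply: HN => /= ay.
  have : `|a + dotv u x| <= enorm u * enorm (subv y x).
    have -> : a + dotv u x = - dotv u (subv y x) by rewrite dotv_subr; lra.
    by rewrite normrN normr_dotv.
  apply/negP; rewrite -ltNge.
  have : enorm u * enorm (subv y x) <= enorm u * e by rewrite ler_wpM2l ?enorm_ge0 ?ltW.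
  move/le_lt_trans; apply.
  rewrite /e mulrCA gtr_pMr ?normr_gt0// ltr_pdivrMr// mul1r ltrDr//.
by apply/negP; rewrite N0 -ltNge; exact: sx.
Qed.

End support.

(** * Joint law of the past and the increment *)

Section joint.
Context {dO : measure_display} {Omega : measurableType dO} {R : realType}.
Variables (P : probability Omega R) (G : set (set Omega)).
Hypothesis sG : sigma_algebra setT G.
Hypothesis GM : G `<=` measurable.
Variables (d : nat) (X : Omega -> d.-tuple R).
Hypothesis mX : measurable_fun setT X.
Variable nu : Omega -> probability (d.-tuple R) R.
Hypothesis Hnu : is_rcd P G X nu.
Local Notation OG := (g_sigma_algebraType G).

(** Disintegration: given [G], the pair [(w, X w)] has as conditional law the product of the unit
    mass at [w] and [nu w]. On rectangles this follows from the definition of [nu], and rectangles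
    generate. *)
Lemma rcd_joint (C : set (OG * d.-tuple R)) : measurable C ->
  Gmeas (V := \bar R) G (fun w => nu w [set x | C (w, x)]) /\
  (\int[P]_w nu w [set x | C (w, x)] = P [set w | C (w, X w)])%E.
Proof.
move=> mC.
have mpair w : measurable_fun setT (fun x : d.-tuple R => ((w : OG), x)).
  exact: measurable_fun_pair.
pose pr w : {mfun d.-tuple R >-> (OG * d.-tuple R)%type} :=
  HB.pack (fun x : d.-tuple R => ((w : OG), x)) (isMeasurableFun.Build _ _ _ _ _ (mpair w)).
pose nu' (w : Omega) : probability (OG * d.-tuple R)%type R := distribution (nu w) (pr w).
pose X' (w : Omega) : (OG * d.-tuple R)%type := (w : OG, X w).
have mX' : measurable_fun setT X'.
  by apply: measurable_fun_pair => //; exact: measurable_id_sub.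
have := @rcd_dynkin _ _ _ P G sG GM _ (OG * d.-tuple R)%type
  [set A `*` B | A in @measurable _ OG & B in measurable] X' nu' mX' (measurable_prod_measurableType _ _).
move=> /(_ _ _ C mC)[].
- move=> _ _ [A mA [B mB <-]] [A' mA' [B' mB' <-]].
  exists (A `&` A'); first exact: measurableI.
  by exists (B `&` B'); [exact: measurableI|rewrite setXI].
- move=> _ [A mA [B mB <-]].
  have GA : G A by rewrite -sub_sigma_measurableE.
  have [GB IB] := Hnu mB.
  have nuE w : nu' w (A `*` B) = ((\1_A w)%:E * nu w B)%E.
    rewrite /nu' /distribution /pushforward/= indicE.
    have [Aw|Aw] := boolP (w \in A).
      by rewrite mul1e; congr (nu w _); apply/seteqP; split => x /=; [by case|move=> Bx; split => //; exact: set_mem].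
    rewrite mul0e -(measure0 (nu w)); congr (nu w _).
    by apply/seteqP; split => // x [/= + _]; move/mem_set; rewrite (negbTE Aw).
  split.
    rewrite (_ : (fun w => _) = (fun w => (\1_A w)%:E * nu w B)%E); last exact/funext.
    apply/GmeasP => //; apply: emeasurable_funM; last exact/GmeasP.
    by apply/measurable_EFinP; exact: measurable_indic.
  move=> A1 GA1.
  transitivity (\int[P]_(w in A1) ((fun w : Omega => nu w B) \_ (A : set Omega)) w)%E.
    by apply: eq_integral => w _; rewrite nuE muleC epatch_indic.
  rewrite -integral_mkcondr IB; last first.
    rewrite -sub_sigma_measurableE//; apply: measurableI => //.
    by rewrite sub_sigma_measurableE.
  by congr (P _); rewrite -setIA.
- by move=> G1 I1; split => //; rewrite I1 ?setTI// -sub_sigma_measurableE.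
Qed.

Lemma rcd_ae (C : set (OG * d.-tuple R)) : measurable C ->
  (\forall w \ae P, \forall x \ae nu w, C (w, x)) ->
  \forall w \ae P, C (w, X w).
Proof.
move=> mC H; have [G1 I1] := rcd_joint (measurableC mC).
have mX' : measurable_fun setT (fun w : Omega => ((w : OG), X w)).
  by apply: measurable_fun_pair => //; exact: measurable_id_sub.
have := mX' measurableT _ (measurableC mC); rewrite setTI => mC'.
exists [set w | (~` C) (w, X w)]; split => //.
rewrite -I1.
rewrite (ae_eq_integral (cst 0%E)) ?integral0//; first exact: Gmeas_measurable G1.
apply: filterS H => w [N [mN N0 HN]] _ /=.
apply/eqP; rewrite eq_le measure_ge0 andbT -N0.
apply: le_measure; rewrite ?inE//.
have mp : measurable_fun setT (fun x : d.-tuple R => ((w : OG), x)).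
  exact: measurable_fun_pair.
by have := mp measurableT _ (measurableC mC); rewrite setTI.
Qed.

End joint.

(** * Measurable projection onto the affine hull of the support *)

Lemma measurable_invr {R : realType} : measurable_fun setT (@GRing.inv R).
Proof.
(* The real power is measurable but gives the inverse only on nonnegative numbers, hence the square;
   both sides are 0 at [x = 0]. *)
rewrite (_ : @GRing.inv R = (fun x => x * (x ^+ 2) `^ (-1))).
  apply: measurable_funM => //.
  apply: (measurableT_comp (f := fun y : R => y `^ (-1))) .
    exact: (@measurable_powR R (-1)).
  exact: exprn_measurable.
apply/funext => x; rewrite powR_inv1 ?sqr_ge0//.
have [->|x0] := eqVneq x 0; first by rewrite invr0 mul0r.
by field.
Qed.

Section affine_hull.
Context {R : realType} {d : nat}.
Implicit Types (A V : set (d.-tuple R)) (u x y : d.-tuple R).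

Lemma affhull_sub A : A `<=` affhull A.
Proof. by move=> x Ax V [_ AV]; exact: AV. Qed.

Lemma affhull_is_affine A : is_affine (affhull A).
Proof. by move=> x y l Ax Ay V HV; apply: HV.1; [exact: Ax|exact: Ay]. Qed.

Lemma affhull_affine A (a : R) u : (forall x, A x -> a + dotv u x = 0) ->
  forall y, affhull A y -> a + dotv u y = 0.
Proof.
move=> H y /(_ [set x | a + dotv u x = 0]); apply; split => // x1 x2 l /= h1 h2.
rewrite dotv_combvr.
have -> : dotv u x1 = - a by lra.
have -> : dotv u x2 = - a by lra.
ring.
Qed.

(** Among the matrices with row space inside [L], one of maximal rank works: a vector of [L] outside
    its row space would raise the rank. *)
Lemma subspace_max (L : set 'rV[R]_d) : L 0 -> (forall z (c : R), L z -> L (c *: z)) ->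
  (forall z z', L z -> L z' -> L (z + z')) ->
  exists M : 'M[R]_d, forall z, L z <-> (z <= M)%MS.
Proof.
move=> L0 LZ LD.
pose Q k := `[< exists M : 'M[R]_d, (forall z : 'rV_d, (z <= M)%MS -> L z) /\ \rank M = k >].
have Q0 : exists k, Q k.
  exists 0%N; apply/asboolP; exists 0; split; last by rewrite mxrank0.
  by move=> z; rewrite submx0 => /eqP ->.
have Qd k : Q k -> (k <= d)%N by move=> /asboolP[M [_ <-]]; exact: rank_leq_row.
case: (ex_maxnP Q0 Qd) => k /asboolP[M [ML Mk]] kmax.
exists M => z; split; last exact: ML.
move=> Lz; apply: contrapT => /negP zM.
have : Q (\rank (M + z)%MS).
  apply/asboolP; exists (M + z)%MS; split => // z' /sub_addsmxP[[u1 u2] /= ->].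
  apply: LD; first by apply: ML; exact: submxMl.
  by rewrite [u2]mx11_scalar mul_scalar_mx; exact: LZ.
move/kmax; rewrite -Mk => rk.
have MMz : (M <= M + z)%MS by exact: addsmxSl.
have := mxrank_leqif_sup MMz; move=> [_]; rewrite eqn_leq (mxrankS MMz) rk/= => /esym MzM.
by move/negP: zM; apply; exact: submx_trans (addsmxSr M z) MzM.
Qed.

(** An affine set is an intersection of hyperplanes. Translated to the origin it is the row space of
    a matrix, and a column of the cokernel matrix gives an affine function that vanishes on it but
    not at [y]. In this dual form, membership in a hull becomes a family of linear equations. *)
Lemma affhull_dual A y :
  (forall (a : R) u, (forall x, A x -> a + dotv u x = 0) -> a + dotv u y = 0) ->
  affhull A y.
Proof.
move=> H V [affV AV]; apply: contrapT => Vy.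
(* If [V] were empty, so would be [A], and the constant function 1 would vanish on [A]. *)
have [v0 Vv0] : exists v, V v.
  apply: contrapT => /forallNP V0; have : 1 + dotv zerov y = 0.
    by apply: H => x /AV /V0.
  by rewrite dotv0l addr0 => /eqP; rewrite oner_eq0.
pose tr (z : 'rV[R]_d) : d.-tuple R := [tuple tnth v0 i + z 0 i | i < d].
pose L := [set z | V (tr z)].
have trE x : tr (\row_i (tnth x i - tnth v0 i)) = x.
  by apply: eq_from_tnth => i; rewrite tnth_mktuple mxE addrC subrK.
have tr0 : tr 0 = v0 by apply: eq_from_tnth => i; rewrite tnth_mktuple mxE addr0.
have LZ z (c : R) : L z -> L (c *: z).
  move=> Lz; have := affV _ _ c Lz Vv0; rewrite /L/=.
  congr (V _); apply: eq_from_tnth => i; by rewrite !tnth_mktuple !mxE; ring.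
(* A sum is the midpoint of the doubled vectors, and doubling is an affine combination with [v0]. *)
have LD z z' : L z -> L z' -> L (z + z').
  move=> Lz Lz'; have := affV _ _ (1 / 2) (LZ _ 2 Lz) (LZ _ 2 Lz'); rewrite /L/=.
  congr (V _); apply: eq_from_tnth => i; by rewrite !tnth_mktuple !mxE; lra.
have L0 : L 0 by rewrite /L/= tr0.
have [M HM] := subspace_max L0 LZ LD.
pose zy : 'rV[R]_d := \row_i (tnth y i - tnth v0 i).
have : ~~ (zy <= M)%MS by apply/negP => /HM; rewrite /L/= trE.
rewrite submxE => /eqP/matrixP/existsNP[i0 /existsNP[j]]; apply.
pose u : d.-tuple R := [tuple cokermx M i j | i < d].
have uE (x : d.-tuple R) : ((\row_i (tnth x i - tnth v0 i)) *m cokermx M) i0 j =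
    dotv u x - dotv u v0.
  rewrite mxE /dotv -sumrB; apply: eq_bigr => i _.
  by rewrite mxE tnth_mktuple; ring.
rewrite [RHS]mxE /zy uE addrC; apply: H => x /AV Vx; rewrite addrC -uE.
have : (\row_i (tnth x i - tnth v0 i) <= M)%MS by apply/HM; rewrite /L/= trE.
by rewrite submxE => /eqP ->; rewrite mxE.
Qed.

End affine_hull.

(** * Gram-Schmidt projection as a measurable formula *)

Section gram_schmidt.
Context {R : realType} {m : nat} {I : eqType}.
Implicit Types (u phi : 'I_m -> R) (v : I -> 'I_m -> R).

Definition fdot u phi : R := \sum_i u i * phi i.

(** The orthogonal projection of [phi] onto the span of the [v k]. Here [r] is the part of [v k]
    orthogonal to the rest of the list; if it vanishes, the added term is 0, so dependent vectors
    need no case distinction and the formula stays measurable in [v] and [phi]. *)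
Fixpoint gs v (s : seq I) phi : 'I_m -> R :=
  if s is k :: s' then
    let r := fun i => v k i - gs v s' (v k) i in
    fun i => gs v s' phi i + fdot phi r / fdot r r * r i
  else fun=> 0.

Let fdotDr u f g : fdot u (fun i => f i + g i) = fdot u f + fdot u g.
Proof. by rewrite /fdot -big_split; apply: eq_bigr => i _; rewrite mulrDr. Qed.

Let fdotBr u f g : fdot u (fun i => f i - g i) = fdot u f - fdot u g.
Proof. by rewrite /fdot -sumrB; apply: eq_bigr => i _; rewrite mulrBr. Qed.

Let fdotZr u c f : fdot u (fun i => c * f i) = c * fdot u f.
Proof. by rewrite /fdot mulr_sumr; apply: eq_bigr => i _; rewrite mulrCA. Qed.

Let fdotC u f : fdot u f = fdot f u.
Proof. by apply: eq_bigr => i _; rewrite mulrC. Qed.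

Lemma fdot_eq0 u : fdot u u = 0 -> forall i, u i = 0.
Proof.
have -> : fdot u u = \sum_i u i ^+ 2 by apply: eq_bigr => i _; rewrite expr2.
move/psumr_eq0P => u0 i; apply/eqP; rewrite -sqrf_eq0; apply/eqP.
by apply: u0 => // j _; exact: sqr_ge0.
Qed.

(** Membership in the span, stated dually as orthogonality to whatever is orthogonal to all [v k];
    this is the form that [affhull_dual] consumes. *)
Lemma gs_span v s phi u : (forall k, k \in s -> fdot u (v k) = 0) ->
  fdot u (gs v s phi) = 0.
Proof.
elim: s phi => [|k s IH] phi H /=; first by rewrite /fdot big1// => i _; rewrite mulr0.
have Hs k' : k' \in s -> fdot u (v k') = 0 by move=> ks; apply: H; rewrite inE ks orbT.
by rewrite fdotDr fdotZr (fdotBr u) !IH// H ?mem_head// subrr mulr0 addr0.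
Qed.

Lemma gs_orth v s phi k : k \in s -> fdot (fun i => phi i - gs v s phi i) (v k) = 0.
Proof.
elim: s phi k => [//|k0 s IH] phi k /=.
set p := gs v s; set r := fun i => v k0 i - p (v k0) i.
set c := fdot phi r / fdot r r.
have rs k' : k' \in s -> fdot r (v k') = 0 by exact: IH.
have res_s k' : k' \in s -> fdot (fun i => phi i - (p phi i + c * r i)) (v k') = 0.
  move=> ks; rewrite fdotC fdotBr fdotDr fdotZr.
  have := IH phi k' ks; rewrite fdotC (fdotBr _ phi) => /eqP; rewrite subr_eq0 => /eqP ->.
  by rewrite -/p [fdot _ r]fdotC rs// mulr0 addr0 subrr.
rewrite inE => /predU1P[->|]; last exact: res_s.
pose res i := phi i - (p phi i + c * r i).
have -> : fdot (fun i => phi i - (p phi i + c * (v k0 i - p (v k0) i))) (v k0) =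
    fdot res r + fdot res (p (v k0)).
  rewrite -fdotDr; congr fdot; apply/funext => i; by rewrite /r subrK.
rewrite (gs_span (v k0) res_s) addr0.
rewrite fdotC /res (fdotBr r) fdotDr fdotZr (gs_span phi rs) add0r.
(* If [r] vanishes, [v k0] already lies in the span of the others. *)
have [r0|r0] := eqVneq (fdot r r) 0.
  by rewrite /fdot !big1 ?mulr0 ?subrr// => i _; rewrite (fdot_eq0 r0) mul0r.
by rewrite /c divfK// fdotC subrr.
Qed.

Lemma measurable_gs dT (T : measurableType dT) (v : T -> I -> 'I_m -> R) s
    (phi : T -> 'I_m -> R) :
  (forall k i, measurable_fun setT (fun x => v x k i)) ->
  (forall i, measurable_fun setT (fun x => phi x i)) ->
  forall i, measurable_fun setT (fun x => gs (v x) s (phi x) i).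
Proof.
move=> mv; elim: s phi => [|k s IH] phi mphi i /=; first exact: measurable_cst.
have mr j : measurable_fun setT (fun x => v x k j - gs (v x) s (v x k) j).
  by apply: measurable_funB => //; exact: IH.
apply: measurable_funD; first exact: IH.
apply: measurable_funM => //; apply: measurable_funM.
  by apply: measurable_sum => j; exact: measurable_funM.
apply: (measurableT_comp measurable_invr).
by apply: measurable_sum => j; exact: measurable_funM.
Qed.

End gram_schmidt.

Section normalized_gram.
Context {dV : measure_display} {V : measurableType dV} {R : realType} {m : nat}.
Variable T : 'I_m -> V -> R.
Hypothesis mT : forall i, measurable_fun setT (T i).
Variable nu : probability V R.

(* The normalisation makes the Gram matrix of [T] exist without any moment of [nu]. *)
Definition gden (x : V) : R := 1 + \sum_k T k x ^+ 2.
Definition gfun i j (x : V) : R := T i x * T j x / gden x.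
Definition gram i j : R := (\int[nu]_x gfun i j x)%R.

Let gden_gt0 x : 0 < gden x.
Proof. by rewrite /gden ltr_pwDl// sumr_ge0// => i _; exact: sqr_ge0. Qed.

Lemma measurable_gfun i j : measurable_fun setT (gfun i j).
Proof.
apply: measurable_funM; first exact: measurable_funM.
apply: (measurableT_comp measurable_invr); apply: measurable_funD => //.
by apply: measurable_sum => k; exact: measurable_funX.
Qed.

Let T_le i x : T i x ^+ 2 <= gden x.
Proof.
rewrite /gden (bigD1 i)//= addrCA lerDl addr_ge0// sumr_ge0// => k _.
exact: sqr_ge0.
Qed.

Lemma gfun_le1 i j x : `|gfun i j x| <= 1.
Proof.
rewrite /gfun normrM normfV (gtr0_norm (gden_gt0 x)) ler_pdivrMr// mul1r.
rewrite ler_norml; have := T_le i x; have := T_le j x.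
have := sqr_ge0 (T i x - T j x); have := sqr_ge0 (T i x + T j x).
by move=> h1 h2 h3 h4; apply/andP; split; nra.
Qed.

Lemma bounded_integrable (f : V -> R) (M : R) : measurable_fun setT f ->
  (forall x, `|f x| <= M) -> nu.-integrable setT (EFin \o f).
Proof.
move=> mf fM; apply: (@le_integrable _ _ _ _ _ measurableT _ (cst M%:E)).
- exact/measurable_EFinP.
- by move=> x _ /=; rewrite lee_fin (le_trans (fM x))// ler_norm.
- exact: finite_measure_integrable_cst.
Qed.

Let igfun i j : nu.-integrable setT (EFin \o gfun i j).
Proof. by apply: (bounded_integrable (M := 1)); [exact: measurable_gfun|exact: gfun_le1]. Qed.

Lemma Rintegral_lin (I : Type) (s : seq I) (c : I -> R) (f : I -> V -> R) :
  (forall i, nu.-integrable setT (EFin \o f i)) ->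
  nu.-integrable setT (EFin \o (fun x => \sum_(i <- s) c i * f i x)) /\
  \sum_(i <- s) c i * (\int[nu]_x f i x)%R = (\int[nu]_x (\sum_(i <- s) c i * f i x))%R.
Proof.
move=> intf; elim: s => [|i s [IH1 IH2]].
  split.
    rewrite (_ : _ \o _ = cst 0%E); first exact: integrable0.
    by apply/funext => x; rewrite /= big_nil.
  by rewrite big_nil; under eq_Rintegral do rewrite big_nil; rewrite /Rintegral integral0.
have ici : nu.-integrable setT (EFin \o (fun x => c i * f i x)).
  exact: (integrableZl measurableT (c i) (intf i)).
split.
  have := integrableD measurableT ici IH1; apply: eq_integrable => // x _.
  by rewrite /= big_cons.
rewrite big_cons IH2 -RintegralZl// -RintegralD//.
by apply: eq_Rintegral => x _; rewrite big_cons.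
Qed.

Lemma gram_span u : (\forall x \ae nu, \sum_j u j * T j x = 0) ->
  forall i, fdot u (gram i) = 0.
Proof.
move=> H i; have [_ E] := Rintegral_lin (index_enum 'I_m) u (igfun i).
rewrite /fdot E /Rintegral (ae_eq_integral (cst 0%E)) ?integral0//.
- apply/measurable_EFinP; apply: measurable_sum => j; apply: measurable_funM => //.
  exact: measurable_gfun.
- apply: filterS H => x Hx _ /=; congr EFin.
  transitivity ((\sum_j u j * T j x) * (T i x / gden x)); last by rewrite Hx mul0r.
  by rewrite mulr_suml; apply: eq_bigr => j _; rewrite /gfun; ring.
Qed.

(** The quadratic form of the Gram matrix at [r] is the integral of
    [(\sum_j r j * T j x) ^+ 2 / gden x]. Together with [gram_span], the kernel of the Gram matrix
    consists exactly of the linear relations between the [T j] that hold almost everywhere. *)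
Lemma gram_orth r : (forall i, fdot r (gram i) = 0) ->
  \forall x \ae nu, \sum_j r j * T j x = 0.
Proof.
move=> H; pose f x := (\sum_j r j * T j x) ^+ 2 / gden x.
have mL : measurable_fun setT (fun x => \sum_j r j * T j x).
  by apply: measurable_sum => j; exact: measurable_funM.
have mf : measurable_fun setT f.
  apply: measurable_funM; first exact: measurable_funX.
  apply: (measurableT_comp measurable_invr); apply: measurable_funD => //.
  by apply: measurable_sum => k; exact: measurable_funX.
have f0 x : 0 <= f x by rewrite divr_ge0 ?sqr_ge0 ?ltW.
have fE x : f x = \sum_i r i * (\sum_j r j * gfun i j x).
  rewrite /f expr2 mulr_suml mulr_suml; apply: eq_bigr => i _.
  rewrite mulr_sumr mulr_suml mulr_sumr; apply: eq_bigr => j _.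
  by rewrite /gfun; ring.
have ig i := Rintegral_lin (index_enum 'I_m) r (igfun i).
have [if_ Ef] := Rintegral_lin (index_enum 'I_m) r (fun i => (ig i).1).
have Ef0 : EE nu f = 0%E.
  have fin : (EE nu f) \is a fin_num.
    apply: integrable_fin_num => //.
    by apply: eq_integrable if_ => // x _; rewrite /= fE.
  rewrite -(fineK fin); congr EFin.
  transitivity (\int[nu]_x (\sum_i r i * (\sum_j r j * gfun i j x)))%R.
    by apply: eq_Rintegral => x _; rewrite fE.
  rewrite -Ef big1// => i _; rewrite -(ig i).2.
  by have := H i; rewrite /fdot /gram => ->; rewrite mulr0.
apply: filterS (EE_eq0_ae mf f0 Ef0) => x /eqP.
by rewrite mulf_eq0 invr_eq0 (gt_eqF (gden_gt0 x)) orbF sqrf_eq0 => /eqP.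
Qed.

End normalized_gram.

Section projection.
Context {dO : measure_display} {Omega : measurableType dO} {R : realType}.
Variables (P : probability Omega R) (G : set (set Omega)).
Hypothesis sG : sigma_algebra setT G.
Hypothesis GM : G `<=` measurable.
Variables (d : nat) (X : Omega -> d.-tuple R).
Variable nu : Omega -> probability (d.-tuple R) R.
Hypothesis Hnu : is_rcd P G X nu.
Variables (m : nat) (T : 'I_m -> d.-tuple R -> R).
Hypothesis mT : forall i, measurable_fun setT (T i).

Lemma measurable_gram i j :
  measurable_fun [set: g_sigma_algebraType G] (fun w => gram T (nu w) i j).
Proof.
have mg := measurable_gfun mT i j.
have ml U : measurable U -> measurable_fun [set: g_sigma_algebraType G] (fun w => nu w U).
  by move=> mU; apply/GmeasP => //; have [] := Hnu mU.
apply: (measurableT_comp (f := fine)) => //.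
pose f := EFin \o gfun T i j.
have mf : measurable_fun setT f by exact/measurable_EFinP.
rewrite (_ : (fun w => _) = (fun w => \int[nu w]_x f^\+ x - \int[nu w]_x f^\- x)%E).
  apply: emeasurable_funB.
    apply: (measurable_fun_integral_kernel (l := nu : g_sigma_algebraType G -> {measure set _ -> \bar R})) => //.
    exact: measurable_funepos.
  apply: (measurable_fun_integral_kernel (l := nu : g_sigma_algebraType G -> {measure set _ -> \bar R})) => //.
  exact: measurable_funeneg.
by apply/funext => w; rewrite integralE.
Qed.

(** The rows of the Gram matrix span the orthogonal complement of these relations, so projecting
    onto the rows gives [p]. Two choices of [T] occur: the coordinates, and the coordinates together
    with the constant 1. *)
Lemma measurable_projection (phi : Omega -> 'I_m -> R) :
  (forall i, Gmeas G (fun w => phi w i)) ->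
  exists p : Omega -> 'I_m -> R, [/\ forall i, Gmeas G (fun w => p w i),
    (forall w u, (\forall x \ae nu w, \sum_j u j * T j x = 0) ->
       \sum_j u j * p w j = 0) &
    (forall w, \forall x \ae nu w, \sum_j (phi w j - p w j) * T j x = 0)].
Proof.
move=> Gphi.
exists (fun w => gs (gram T (nu w)) (enum 'I_m) (phi w)); split.
- move=> i; apply/GmeasP => //.
  apply: (@measurable_gs R m _ _ (g_sigma_algebraType G)).
    by move=> k j; exact: measurable_gram.
  by move=> j; exact/GmeasP.
- by move=> w u H; apply: gs_span => k _; exact: gram_span.
- move=> w; apply: gram_orth => // i; apply: gs_orth.
  by rewrite mem_enum.
Qed.

End projection.

(** * The one-step bound *)

Section essential_infimum.
Context {dO : measure_display} {Omega : measurableType dO} {R : realType}.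
Variable P : probability Omega R.

Let clamp (y : R) : R := Num.max 0 (Num.min y 1).
Let clamp_ge0 y : 0 <= clamp y. Proof. by rewrite le_max lexx. Qed.
Let clamp_le1 y : clamp y <= 1. Proof. by rewrite ge_max ler01 ge_min lexx orbT. Qed.
Let clamp_id y : 0 <= y <= 1 -> clamp y = y.
Proof. by move=> /andP[y0 y1]; rewrite /clamp min_l// max_r. Qed.

Let infc (s : nat -> Omega -> R) (w : Omega) : R := inf (range (fun n => clamp (s n w))).

Let infc_lb (s : nat -> Omega -> R) w : has_lbound (range (fun n => clamp (s n w))).
Proof. by exists 0 => _ [n _ <-]. Qed.

Let infc_le s w n : infc s w <= clamp (s n w).
Proof. by apply: inf_lbound => //; exists n. Qed.

Let le_infc s w c : (forall n, c <= clamp (s n w)) -> c <= infc s w.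
Proof. by move=> H; apply: lb_le_inf; [exists (clamp (s 0%N w)), 0%N|move=> _ [n _ <-]]. Qed.

Let infc_ge0 s w : 0 <= infc s w. Proof. exact: le_infc. Qed.
Let infc_le1 s w : infc s w <= 1. Proof. exact: le_trans (infc_le s w 0) (clamp_le1 _). Qed.

Let measurable_infc s : (forall n, measurable_fun setT (s n)) ->
  measurable_fun setT (infc s).
Proof.
move=> ms; rewrite (_ : infc s = fun w => infs (fun n => clamp (s n w)) 0).
  apply: (@measurable_fun_infs _ _ _ setT (fun n w => clamp (s n w))).
    by move=> w _; exact: infc_lb.
  by move=> n; rewrite /clamp; apply: measurable_maxr => //; exact: measurable_minr.
apply/funext => w; rewrite /infc /infs /sdrop; congr inf.
by apply/seteqP; split => y [n _ <-]; exists n.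
Qed.

(** The infimum over a countable subfamily is measurable. One whose infimum has least expectation is
    a lower bound of the whole family: a further member cannot lower the expectation, hence changes
    the infimum on a null set only. Clamping turns the almost sure bounds 0 and 1 into sure ones and
    keeps all expectations finite. *)
Lemma essinf_exists (fam : set (Omega -> R)) : fam !=set0 ->
  (forall Y, fam Y -> measurable_fun setT Y /\ \forall w \ae P, 0 <= Y w <= 1) ->
  exists Z, is_essinf P fam Z.
Proof.
move=> [Y0 famY0] Hfam.
pose seqs := [set s : nat -> Omega -> R | forall n, fam (s n)].
have ms s : seqs s -> measurable_fun setT (infc s).
  by move=> fs; apply: measurable_infc => n; have [] := Hfam _ (fs n).
pose J s : R := fine (EE P (infc s)).
have JE s : seqs s -> EE P (infc s) = (J s)%:E.
  move=> fs; rewrite fineK// ge0_fin_numE; last exact: EE_ge0.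
  rewrite (@le_lt_trans _ _ (EE P (cst 1)))//.
    by apply: EE_le => //; exact: ms.
  by rewrite EE_cst ltry.
have J0 s : 0 <= J s by rewrite fine_ge0// EE_ge0.
pose j := inf (J @` seqs).
have lbJ : has_lbound (J @` seqs) by exists 0 => _ [s _ <-].
have jJ s : seqs s -> j <= J s by move=> fs; apply: inf_lbound => //; exists s.
have /choice[sk Hsk] : forall k : nat, exists s, seqs s /\ J s < j + k.+1%:R^-1.
  move=> k; have hi : has_inf (J @` seqs).
    by split => //; exists (J (fun=> Y0)), (fun=> Y0).
  have k0 : 0 < k.+1%:R^-1 :> R by rewrite invr_gt0.
  have [_ [s fs <-] Js] := inf_adherent k0 hi.
  by exists s.
(* All nearly minimising sequences merged into one, whose infimum then has expectation at most
   [j]. *)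
pose s n : Omega -> R := if @unpickle (nat * nat)%type n is Some (k, l) then sk k l else Y0.
have fs : seqs s.
  by move=> n; rewrite /s; case: unpickle => [[k l]|//]; exact: (Hsk k).1.
have sle k w : infc s w <= infc (sk k) w.
  apply: le_infc => l; have := infc_le s w (pickle (k, l)).
  by rewrite /s pickleK.
have Js : J s <= j.
  apply/ler_addgt0Pr => e e0.
  have [k ke] : exists k : nat, k.+1%:R^-1 < e.
    exists (Num.trunc e^-1); rewrite invf_plt ?posrE//.
    exact: truncnS_gt.
  apply: (@le_trans _ _ (J (sk k))).
    rewrite -lee_fin -!JE//; last exact: (Hsk k).1.
    by apply: EE_le => //; [exact: ms|exact: ms (Hsk k).1].
  by rewrite (le_trans (ltW (Hsk k).2))// lerD2l ltW.
exists (infc s); split; first exact: ms.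
split.
  move=> Y fY; have [mY Y01] := Hfam _ fY.
  pose s' n := if n is n'.+1 then s n' else Y.
  have fs' : seqs s' by case.
  have s's w : infc s' w <= infc s w.
    by apply: le_infc => n; exact: (infc_le s' w n.+1).
  pose h w := infc s w - infc s' w.
  have h0 w : 0 <= h w by rewrite subr_ge0.
  have mh : measurable_fun setT h by apply: measurable_funB; exact: ms.
  have Eh : EE P h = 0%E.
    have : (EE P h + EE P (infc s') = EE P (infc s))%E.
      rewrite -EE_add//; last exact: ms.
      by apply: EE_eq => w; rewrite subrK.
    rewrite !JE// => E; apply/eqP; rewrite eq_le EE_ge0// andbT.
    rewrite -(leeD2rE (x := (J s')%:E))// E add0e lee_fin.
    exact: le_trans Js (jJ _ fs').
  have h_ae := EE_eq0_ae mh h0 Eh.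
  near=> w.
  have hw : h w = 0 by near: w.
  have Yw : 0 <= Y w <= 1 by near: w.
  have : infc s w = infc s' w by apply/eqP; rewrite -subr_eq0; apply/eqP.
  by move=> ->; rewrite -[leRHS]clamp_id//; exact: (infc_le s' w 0).
move=> Z' mZ' HZ'.
have : \forall w \ae P, forall n, Z' w <= s n w /\ 0 <= s n w <= 1.
  apply: ae_foralln => n; have h1 := HZ' _ (fs n); have [_ h2] := Hfam _ (fs n).
  by apply: filterS2 h1 h2 => w.
by apply: filterS => w H; apply: le_infc => n; have [h1 h2] := H n; rewrite clamp_id.
Unshelve. all: by end_near. Qed.

End essential_infimum.

Section one_step.
Context {dO : measure_display} {Omega : measurableType dO} {R : realType}.
Variables (P : probability Omega R) (G : set (set Omega)).
Hypothesis sG : sigma_algebra setT G.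
Hypothesis GM : G `<=` measurable.
Variable d : nat.

(** The definition prescribes only integrals over sets of [G]. Testing on the set [Y < 0], and then
    comparing the positive part with 1, bounds every version. *)
Lemma condprob_bounds (A : set Omega) Y : measurable A -> is_condprob P G A Y ->
  \forall w \ae P, 0 <= Y w <= 1.
Proof.
move=> mA [GY YA].
have mY := Gmeas_measurable GM GY.
pose N w := Num.max (- Y w) 0.
have N0 w : 0 <= N w by rewrite le_max lexx orbT.
have mN : measurable_fun setT N by apply: measurable_maxr => //; exact: measurable_funN.
pose B := [set w | Y w < 0].
have GB : G B.
  have -> : B = Y @^-1` `]-oo, 0[%classic by apply/seteqP; split => w; rewrite /= in_itv.
  exact: GY.
have mB := GM GB.
have EN : EE P N = 0%E.
  have E1 : (\int[P]_(w in B) (Y w)%:E = - EE P N)%E.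
    have -> : EE P N = (\int[P]_(w in B) (N w)%:E)%E.
      rewrite [RHS]integral_mkcond; apply: eq_integral => w _; rewrite patchE.
      case: ifPn => //; rewrite notin_setE /B/= => /negP; rewrite -leNgt => Yw.
      by rewrite /N max_r// oppr_le0.
    rewrite -integral_ge0N; last by move=> w _; rewrite lee_fin.
    by apply: eq_integral => w; rewrite inE /B/= => Yw; rewrite /N max_l ?EFinN ?oppeK ?oppr_ge0 ?ltW.
  apply/eqP; rewrite eq_le EE_ge0// andbT -oppe_ge0 -E1 YA//.
pose Y' w := Num.max (Y w) 0.
have Y'0 w : 0 <= Y' w by rewrite le_max lexx orbT.
have GY' : Gmeas G Y'.
  by apply/GmeasP => //; apply: measurable_maxr => //; exact/GmeasP.
have Y0 : \forall w \ae P, 0 <= Y w.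
  apply: filterS (EE_eq0_ae mN N0 EN) => w.
  rewrite /N => Nw; have : - Y w <= 0 by rewrite -Nw le_max lexx.
  by rewrite oppr_le0.
have Y1 : \forall w \ae P, Y' w <= 1.
  apply: (@le_integral_ae _ _ _ P G sG GM Y' (cst 1)) => //.
  - exact: Gmeas_cst.
  - by rewrite EE_cst ltry.
  - move=> A1 GA1; have mA1 := GM GA1.
    rewrite (integral_cst P mA1 1%E) mul1e (ae_eq_integral (fun w => (Y w)%:E))//.
    + by rewrite YA// le_measure ?inE//; exact: measurableI.
    + by apply: measurable_funTS; apply/measurable_EFinP; exact: Gmeas_measurable GY'.
    + by apply: measurable_funTS; exact/measurable_EFinP.
    + by apply: filterS Y0 => w Yw _; rewrite /Y' max_l.
by apply: filterS2 Y0 Y1 => w h; rewrite /Y' max_l// => h'; rewrite h h'.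
Qed.

Section fixed_increment.
Variable X : Omega -> d.-tuple R.
Hypothesis mX : measurable_fun setT X.
Variable nu : Omega -> probability (d.-tuple R) R.
Hypothesis Hnu : is_rcd P G X nu.
Let D w := affhull (msupport (nu w)).

Lemma orth_support_ae (a : Omega -> R) (r : Omega -> d.-tuple R) :
  Gmeas G a -> Gmeas G r ->
  (\forall w \ae P, forall x, msupport (nu w) x -> a w + dotv (r w) x = 0) ->
  \forall w \ae P, a w + dotv (r w) (X w) = 0.
Proof.
move=> Ga Gr H.
pose C : set (g_sigma_algebraType G * d.-tuple R) :=
  [set wx | a wx.1 + dotv (r wx.1) wx.2 = 0].
have mC : measurable C.
  have -> : C = (fun wx : g_sigma_algebraType G * d.-tuple R =>
      a wx.1 + dotv (r wx.1) wx.2) @^-1` [set 0] by [].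
  rewrite -[X in measurable X]setTI.
  have mar : measurable_fun setT (fun wx : g_sigma_algebraType G * d.-tuple R =>
      a wx.1 + dotv (r wx.1) wx.2).
    apply: measurable_funD.
      by apply: (measurableT_comp (f := a : g_sigma_algebraType G -> R)) => //; exact/GmeasP.
    apply: measurable_dotv => //.
    by apply: (measurableT_comp (f := r : g_sigma_algebraType G -> d.-tuple R)) => //; exact/GmeasP.
  exact: mar.
apply: (rcd_ae sG GM mX Hnu mC).
by apply: filterS H => w Hw; apply: filterS (msupport_ae Hw) => x.
Qed.

(* Project [e_0] onto the span of the points [(1, x)], [x] in the support: if [0] is not in the
   hull, the residual [(r_0, r)] has [r_0 > 0] and [r_0 + <r, X> = 0], so [- r] is an arbitrage. *)
Lemma zero_in_hull :
  (forall xi : Omega -> d.-tuple R, Gmeas G xi ->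
     (\forall w \ae P, 0 <= dotv (xi w) (X w)) ->
     (\forall w \ae P, dotv (xi w) (X w) = 0)) ->
  \forall w \ae P, D w zerov.
Proof.
move=> NA1.
pose T (j : 'I_d.+1) (x : d.-tuple R) : R :=
  if unlift ord0 j is Some i then tnth x i else 1.
have mT j : measurable_fun setT (T j).
  rewrite /T; case: (unlift ord0 j) => [i|]; last exact: measurable_cst.
  exact: measurable_tnth.
have T0 x : T ord0 x = 1 by rewrite /T unlift_none.
have TS i x : T (lift ord0 i) x = tnth x i by rewrite /T liftK.
pose phi (w : Omega) (j : 'I_d.+1) : R := if j == ord0 then 1 else 0.
have [|p [Gp p1 p2]] := measurable_projection sG Hnu mT (phi := phi).
  by move=> j; exact: Gmeas_cst.
pose res w j := phi w j - p w j.
have Gres j : Gmeas G (fun w => res w j).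
  by apply/GmeasP => //; apply: measurable_funB => //; exact/GmeasP.
pose r w : d.-tuple R := [tuple res w (lift ord0 i) | i < d].
have Gr : Gmeas G r.
  by apply/GmeasP => //; apply: measurable_mktuple => i; exact/GmeasP.
have resE w x : \sum_j res w j * T j x = res w ord0 + dotv (r w) x.
  rewrite big_ord_recl T0 mulr1; congr (_ + _); apply: eq_bigr => i _.
  by rewrite TS tnth_mktuple.
(* The residual is orthogonal to the projection, so its product with [e_0] is its squared length. *)
have res0 w : res w ord0 = \sum_j res w j ^+ 2.
  have := p1 w (res w) (p2 w) => E.
  transitivity (\sum_j res w j * phi w j).
    rewrite big_ord_recl /phi eqxx mulr1 big1 ?addr0// => i _.
    by rewrite (_ : lift ord0 i == ord0 = false) ?mulr0.
  transitivity (\sum_j res w j * phi w j - \sum_j res w j * p w j); first by rewrite E subr0.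
  by rewrite -sumrB; apply: eq_bigr => j _; rewrite /res; ring.
have res_X : \forall w \ae P, res w ord0 + dotv (r w) (X w) = 0.
  apply: orth_support_ae => //; apply: aeW => w; apply: ae_msupport_affine.
  by apply: filterS (p2 w) => x; rewrite -resE.
pose xi w : d.-tuple R := subv zerov (r w).
have Gxi : Gmeas G xi.
  by apply/GmeasP => //; apply: measurable_subv => //; exact/GmeasP.
have xiE w : dotv (xi w) (X w) = - dotv (r w) (X w).
  by rewrite /xi dotv_subl dotv0l sub0r.
have res_ge0 w : 0 <= res w ord0.
  by rewrite res0; apply: sumr_ge0 => j _; exact: sqr_ge0.
have : \forall w \ae P, dotv (xi w) (X w) = 0.
  apply: NA1 => //; apply: filterS res_X => w.
  by rewrite xiE => /eqP; rewrite addrC addr_eq0 => /eqP ->; rewrite opprK.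
move=> xi0; apply: filterS2 res_X xi0 => w h1 h2.
have {h1 h2} res00 : res w ord0 = 0 by move: h2; rewrite xiE; lra.
have resj j : res w j = 0.
  move: res00; rewrite res0 => /psumr_eq0P H; apply/eqP; rewrite -sqrf_eq0; apply/eqP.
  by apply: H => // k _; exact: sqr_ge0.
(* Now [e_0] equals its projection [p], and a relation [a + <u, x> = 0] on the support annihilates
   [p], whence [a = 0]. *)
apply: affhull_dual => a u Hau; rewrite dotvC dotv0l addr0.
pose U (j : 'I_d.+1) : R := if unlift ord0 j is Some i then tnth u i else a.
have : \sum_j U j * p w j = 0.
  apply: p1; apply: filterS (msupport_ae Hau) => x Hx; transitivity (a + dotv u x) => //.
  rewrite big_ord_recl T0 mulr1 /U unlift_none; congr (_ + _).
  by apply: eq_bigr => i _; rewrite liftK TS.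
rewrite big_ord_recl big1 ?addr0.
  by rewrite /U unlift_none; have := resj ord0; rewrite /res /phi eqxx => /eqP; rewrite subr_eq0 => /eqP <-; rewrite mulr1.
move=> i _; have := resj (lift ord0 i); rewrite /res /phi.
rewrite (_ : lift ord0 i == ord0 = false)// sub0r => /eqP.
by rewrite oppr_eq0 => /eqP ->; rewrite mulr0.
Qed.

(** As the hull contains 0, every affine relation on the support has constant term 0. The hull is
    thus the linear span of the support, and the projection onto this span lies in it. *)
Lemma hull_projection (phi : Omega -> d.-tuple R) : Gmeas G phi ->
  (\forall w \ae P, D w zerov) ->
  exists psi : Omega -> d.-tuple R, [/\ Gmeas G psi,
    (\forall w \ae P, D w (psi w)) &
    forall w x, msupport (nu w) x -> dotv (subv (phi w) (psi w)) x = 0].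
Proof.
move=> Gphi D0.
have mT (i : 'I_d) : measurable_fun setT (fun x : d.-tuple R => tnth x i).
  exact: measurable_tnth.
have [|p [Gp p1 p2]] := measurable_projection sG Hnu mT (phi := fun w i => tnth (phi w) i).
  by move=> i; apply/GmeasP => //; apply: measurable_coord; exact/GmeasP.
exists (fun w => [tuple p w i | i < d]); split.
- by apply/GmeasP => //; apply: measurable_mktuple => i; exact/GmeasP.
- apply: filterS D0 => w Dw; apply: affhull_dual => a u Hau.
  have a0 : a = 0 by have := affhull_affine Hau Dw; rewrite dotvC dotv0l addr0.
  rewrite a0 add0r /dotv; under eq_bigr do rewrite tnth_mktuple.
  apply: p1; apply: filterS (msupport_ae Hau) => x.
  by rewrite a0 add0r.
- move=> w x sx; have := @ae_msupport_affine _ _ (nu w) 0 (subv (phi w) [tuple p w i | i < d]).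
  move=> /(_ _ x sx); rewrite add0r; apply.
  apply: filterS (p2 w) => y Hy; rewrite add0r -[RHS]Hy.
  by apply: eq_bigr => i _; rewrite !tnth_mktuple.
Qed.

(** Where [xi] vanishes the shortfall event is certain, and [k1 <= 1] suffices. Where it does not,
    the hull differs from {0}, and the essential infimum bounds the conditional probability from
    below. *)
Lemma one_step_bound (beta kappa k1 : Omega -> R) :
  Gmeas G beta -> Gmeas G k1 -> (forall w, 0 <= k1 w <= 1) ->
  (\forall w \ae P, k1 w <= kappa w) -> (\forall w \ae P, D w zerov) ->
  (forall Z, is_essinf P
     [set Y | exists xi : Omega -> d.-tuple R,
        Gmeas G xi /\ (\forall w \ae P, D w (xi w)) /\
        is_condprob P G
          [set w | dotv (xi w) (X w) <= - beta w * enorm (xi w)] Y] Z ->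
     \forall w \ae P, D w <> [set zerov] -> kappa w <= Z w) ->
  forall xi : Omega -> d.-tuple R, Gmeas G xi -> (\forall w \ae P, D w (xi w)) ->
  forall z : Omega -> R, Gmeas G z -> (forall w, 0 <= z w) ->
  (EE P (fun w => (z w * k1 w)%R) <=
   EE P (fun w => (z w * \1_[set w | dotv (xi w) (X w) <= - beta w * enorm (xi w)] w)%R))%E.
Proof.
move=> Gb Gk k01 kk D0 Hess xi Gxi Dxi z Gz z0.
set fam := [set Y | _] in Hess.
pose Aset (xi : Omega -> d.-tuple R) :=
  [set w | (dotv (xi w) (X w) <= - beta w * enorm (xi w))%R].
have mb := Gmeas_measurable GM Gb.
have mA xi' : Gmeas G xi' -> measurable (Aset xi').
  move=> Gxi'; have mxi := Gmeas_measurable GM Gxi'.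
  rewrite (_ : Aset xi' = (fun w => dotv (xi' w) (X w) <= - beta w * enorm (xi' w)) @^-1` [set true]); last by apply/seteqP; split.
  rewrite -[X in measurable X]setTI; apply: measurable_fun_ler => //.
    exact: measurable_dotv.
  by apply: measurable_funM; [exact: measurable_funN|exact: measurable_enorm].
have [Y [cY Y0 YA]] := condprob_exists P sG GM (mA xi Gxi).
have [Z HZ] : exists Z, is_essinf P fam Z.
  apply: essinf_exists.
    by exists Y, xi.
  move=> Y' [xi' [Gxi' [_ cY']]]; split; first exact: Gmeas_measurable cY'.1.
  exact: condprob_bounds (mA xi' Gxi') cY'.
have ZY : \forall w \ae P, Z w <= Y w by apply: HZ.2.1; exists xi.
pose B w : R := if enorm (xi w) == 0 then 1 else 0.
have GB : Gmeas G B.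
  apply/GmeasP => //; apply: measurable_fun_ifT => //.
  by apply: measurable_fun_eqr => //; apply: measurable_enorm; exact/GmeasP.
have B01 w : 0 <= B w <= 1 by rewrite /B; case: ifP; rewrite ?lexx ?ler01.
pose zB w := z w * B w.
pose zC w := z w * (1 - B w).
have GzB : Gmeas G zB by apply/GmeasP => //; apply: measurable_funM; exact/GmeasP.
have GzC : Gmeas G zC.
  apply/GmeasP => //; apply: measurable_funM; first exact/GmeasP.
  by apply: measurable_funB => //; exact/GmeasP.
have zB0 w : 0 <= zB w by rewrite mulr_ge0// (andP (B01 w)).1.
have zC0 w : 0 <= zC w by rewrite mulr_ge0// subr_ge0 (andP (B01 w)).2.
have mzB := Gmeas_measurable GM GzB; have mzC := Gmeas_measurable GM GzC.
have mz := Gmeas_measurable GM Gz; have mk := Gmeas_measurable GM Gk.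
have mYY := Gmeas_measurable GM cY.1.
have mAi : measurable_fun setT (\1_(Aset xi) : Omega -> R) by exact/measurable_indic/mA.
have Ai0 w : 0 <= (\1_(Aset xi) w : R) by rewrite indicE.
rewrite -/(Aset xi).
have -> : EE P (fun w => z w * \1_(Aset xi) w) = EE P (fun w => zB w + zC w * Y w).
  rewrite EE_add//; [|exact: measurable_funM|by move=> w; exact: mulr_ge0].
  rewrite YA// -EE_add//; [|exact: measurable_funM|by move=> w; exact: mulr_ge0].
  apply: EE_eq => w; rewrite /zB /zC /B; case: ifPn => [/eqP xi0|_]; last by rewrite mulr0 add0r subr0 mulr1.
  rewrite subrr mulr0 mul0r addr0; congr (_ * _); rewrite indicE mem_set//.
  by rewrite /Aset/= xi0 mulr0 (enorm_eq0 xi0) dotv0l.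
apply: EE_le_ae => //.
- exact: measurable_funM.
- by apply: measurable_funD => //; exact: measurable_funM.
- by move=> w; rewrite mulr_ge0// (andP (k01 w)).1.
- by move=> w; rewrite addr_ge0// mulr_ge0.
have HZ' := Hess Z HZ; near=> w.
have h1 : D w <> [set zerov] -> kappa w <= Z w by near: w.
have h2 : Z w <= Y w by near: w.
have h3 : D w (xi w) by near: w.
have h4 : k1 w <= kappa w by near: w.
rewrite /zB /zC /B; case: ifPn => [_|xi0].
  by rewrite mulr1 subrr mulr0 mul0r addr0 ler_piMr// (andP (k01 w)).2.
rewrite mulr0 add0r subr0 mulr1 ler_wpM2l//.
apply: le_trans h4 (le_trans (h1 _) h2) => DE.
by move: h3 xi0; rewrite DE/= => ->; rewrite enorm0 eqxx.
Unshelve. all: by end_near. Qed.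

End fixed_increment.
End one_step.

(** * Random variables with all moments *)

Section power_inequalities.
Context {R : realType}.
Implicit Types a b g p x y eta eps : R.

Lemma powR_le p x y : 0 <= p -> 0 <= x -> x <= y -> x `^ p <= y `^ p.
Proof.
move=> p0 x0 xy; apply: ge0_ler_powR => //; rewrite nnegrE//; exact: le_trans xy.
Qed.

(** Young's inequality with exponents [1 / g] and [1 / (1 - g)] for the factors [(eps a)^g] and
    [(eta / eps)^g]; hence [q = g / (1 - g)], and [C] is the [q]-th power of [1 / eps]. *)
Lemma young_powR g eps : 0 < g -> g < 1 -> 0 < eps ->
  exists C q : R, [/\ 0 <= C, 0 < q & forall a eta, 0 <= a -> 0 <= eta ->
    (a * eta) `^ g <= eps * a + C * eta `^ q].
Proof.
move=> g0 g1 e0; have g1' : 0 < 1 - g by rewrite subr_gt0.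
exists ((eps^-1) `^ (g / (1 - g))), (g / (1 - g)); split.
- exact: powR_ge0.
- by rewrite divr_gt0.
move=> a eta a0 eta0.
have e0' : 0 <= eps^-1 by rewrite invr_ge0 ltW.
have -> : a * eta = (eps * a) * (eps^-1 * eta).
  by rewrite mulrACA divff ?gt_eqF// mul1r.
have ea0 : 0 <= eps * a by rewrite mulr_ge0// ltW.
have ee0 : 0 <= eps^-1 * eta by rewrite mulr_ge0.
rewrite powRM//.
have := @conjugate_powR R ((eps * a) `^ g) ((eps^-1 * eta) `^ g) g^-1 (1 - g)^-1
  (powR_ge0 _ _) (powR_ge0 _ _).
rewrite !invr_gt0 !invrK => /(_ g0 g1').
rewrite addrC subrK => /(_ erefl) /le_trans; apply.
rewrite -!powRrM divff ?gt_eqF// powRr1//; apply: lerD.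
  by rewrite ler_piMr// ltW.
rewrite -powRM//; rewrite ler_piMr ?powR_ge0//; lra.
Qed.

(** Either [eta <= x / 2] and the first term dominates, or [x < 2 eta] and the second does. The
    factor 1/2 is what allows absorption in [Wmom_condexp]. *)
Lemma powR_mul_le p x eta : 0 < p -> 0 <= x -> 0 <= eta ->
  x `^ p * eta <= 2^-1 * (x `^ p * x) + 2 `^ p * eta `^ (p + 1).
Proof.
move=> p0 x0 eta0.
have p10 : p + 1 != 0 by rewrite gt_eqF// addr_gt0.
have -> : eta `^ (p + 1) = eta `^ p * eta.
  by rewrite powRD ?(negbTE p10)// powRr1.
have xp := powR_ge0 x p; have ep := powR_ge0 eta p; have tp := powR_ge0 2 p.
have [h|h] := leP eta (x / 2).
  apply: (@le_trans _ _ (x `^ p * (x / 2))); first exact: ler_wpM2l.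
  rewrite [leLHS](_ : _ = 2^-1 * (x `^ p * x)); last by ring.
  by rewrite lerDl; do 2 apply: mulr_ge0 => //.
apply: (@le_trans _ _ ((2 * eta) `^ p * eta)).
  by rewrite ler_wpM2r//; apply: powR_le => //; [exact: ltW|lra].
rewrite powRM// mulrA lerDr; do 2 apply: mulr_ge0 => //.
Qed.

End power_inequalities.

Section moments.
Context {dO : measure_display} {Omega : measurableType dO} {R : realType}.
Variable P : probability Omega R.
Implicit Types X Y : Omega -> R.

Lemma measurable_norm_powR X p : measurable_fun setT X ->
  measurable_fun setT (fun w => `|X w| `^ p).
Proof.
move=> mX; apply: (measurableT_comp (measurable_powR p)).
exact: (measurableT_comp (@normr_measurable R setT) mX).
Qed.

Lemma Wmom_le X Y : measurable_fun setT Y -> Wmom P X ->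
  (\forall w \ae P, `|Y w| <= `|X w|) -> Wmom P Y.
Proof.
move=> mY [mX HX] YX; split => // p p0; apply: le_lt_trans (HX p p0).
apply: (EE_le_ae (f := fun w => `|Y w| `^ p) (g := fun w => `|X w| `^ p)).
- exact: measurable_norm_powR.
- exact: measurable_norm_powR.
- by move=> w; exact: powR_ge0.
- by move=> w; exact: powR_ge0.
- by apply: filterS YX => w; apply: powR_le => //; exact: ltW.
Qed.

Lemma Wmom_cst (c : R) : Wmom P (fun=> c).
Proof. by split => // p p0; have := EE_cst P (`|c| `^ p); rewrite /EE => ->; rewrite ltry. Qed.

Lemma Wmom_mul X Y : Wmom P X -> Wmom P Y -> Wmom P (fun w => X w * Y w).
Proof.
move=> [mX HX] [mY HY]; split; first exact: measurable_funM.
move=> p p0; have p20 : 0 < p * 2 by rewrite mulr_gt0.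
(* The elementary bound [x y <= x^2 + y^2] takes the place of Cauchy-Schwarz, as only finiteness
   matters. *)
apply: (@le_lt_trans _ _ (EE P (fun w => `|X w| `^ (p * 2) + `|Y w| `^ (p * 2)))).
  apply: (@EE_le _ _ _ P (fun w => `|X w * Y w| `^ p)).
  - by apply: measurable_norm_powR; exact: measurable_funM.
  - by apply: measurable_funD; exact: measurable_norm_powR.
  - by move=> w; exact: powR_ge0.
  - move=> w; rewrite normrM powRM// !powRrM !powR_mulrn ?powR_ge0//.
    have := sqr_ge0 (`|X w| `^ p - `|Y w| `^ p).
    have := powR_ge0 `|X w| p; have := powR_ge0 `|Y w| p; nra.
rewrite EE_add//; [|exact: measurable_norm_powR|exact: measurable_norm_powR].
by rewrite lte_add_pinfty ?HX ?HY.
Qed.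

Lemma Wmom_add X Y : Wmom P X -> Wmom P Y -> Wmom P (fun w => X w + Y w).
Proof.
move=> [mX HX] [mY HY]; split; first exact: measurable_funD.
move=> p p0.
apply: (@le_lt_trans _ _ (EE P (fun w => 2 `^ p * (`|X w| `^ p + `|Y w| `^ p)))).
  apply: (@EE_le _ _ _ P (fun w => `|X w + Y w| `^ p)).
  - by apply: measurable_norm_powR; exact: measurable_funD.
  - by apply: measurable_funM => //; apply: measurable_funD; exact: measurable_norm_powR.
  - by move=> w; exact: powR_ge0.
  - move=> w; wlog XY : X Y mX mY HX HY / `|X w| <= `|Y w|.
      move=> H; have [XY|YX] := leP `|X w| `|Y w|; first exact: H.
      by rewrite addrC [X in _ * X]addrC; apply: H => //; exact: ltW.
    apply: (@le_trans _ _ ((2 * `|Y w|) `^ p)).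
      by apply: powR_le => //; [exact: ltW|rewrite (le_trans (ler_normD _ _))//; lra].
    by rewrite powRM// ler_wpM2l ?powR_ge0// lerDr powR_ge0.
rewrite EE_scale ?powR_ge0//; last by apply: measurable_funD; exact: measurable_norm_powR.
rewrite EE_add//; [|exact: measurable_norm_powR|exact: measurable_norm_powR].
by rewrite lte_mul_pinfty ?lee_fin ?powR_ge0// lte_add_pinfty ?HX ?HY.
Qed.

Lemma Wmom_sum (I : eqType) (s : seq I) (X : I -> Omega -> R) :
  (forall i, i \in s -> Wmom P (X i)) -> Wmom P (fun w => \sum_(i <- s) X i w).
Proof.
elim: s => [|i s IH] H.
  by under eq_fun do rewrite big_nil; exact: Wmom_cst.
under eq_fun do rewrite big_cons.
apply: Wmom_add; first by apply: H; rewrite mem_head.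
by apply: IH => j js; apply: H; rewrite inE js orbT.
Qed.

Lemma Wmom_prod (I : eqType) (s : seq I) (X : I -> Omega -> R) :
  (forall i, i \in s -> Wmom P (X i)) -> Wmom P (fun w => \prod_(i <- s) X i w).
Proof.
elim: s => [|i s IH] H.
  by under eq_fun do rewrite big_nil; exact: Wmom_cst.
under eq_fun do rewrite big_cons.
apply: Wmom_mul; first by apply: H; rewrite mem_head.
by apply: IH => j js; apply: H; rewrite inE js orbT.
Qed.

Lemma Wmom_powR X p : Wmom P X -> (forall w, 0 <= X w) -> 0 < p ->
  (EE P (fun w => (X w `^ p)%R) < +oo)%E.
Proof.
move=> [_ HX] X0 p0; apply: le_lt_trans (HX p p0).
by rewrite le_eqVlt; apply/orP; left; apply/eqP/EE_eq => w; rewrite ger0_norm.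
Qed.

Lemma Wmom_EE X : Wmom P X -> (forall w, 0 <= X w) -> (EE P X < +oo)%E.
Proof.
move=> HX X0; have := Wmom_powR HX X0 ltr01; congr (_ < _)%E.
by apply: EE_eq => w; rewrite powRr1.
Qed.

(* [b^p eta <= b^(p+1) / 2 + 2^p eta^(p+1)], whose first term is absorbed after truncating [b]. *)
Lemma Wmom_condexp (G : set (set Omega)) (b eta : Omega -> R) :
  sigma_algebra setT G -> G `<=` measurable -> Gmeas G b -> (forall w, 0 <= b w) ->
  Wmom P eta -> (forall w, 0 <= eta w) ->
  (forall z : Omega -> R, Gmeas G z -> (forall w, 0 <= z w) ->
     EE P (fun w => z w * b w) = EE P (fun w => z w * eta w)) -> Wmom P b.
Proof.
move=> sG GM Gb b0 Weta eta0 Hb.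
have mb := Gmeas_measurable GM Gb; have meta := Weta.1.
split => // p p0; have p10 : 0 < p + 1 by rewrite addr_gt0.
have p1n0 : p + 1 != 0 by rewrite gt_eqF.
have Eeta : (EE P (fun w => (eta w `^ (p + 1))%R) < +oo)%E by exact: Wmom_powR.
have meta1 : measurable_fun setT (fun w => eta w `^ (p + 1)).
  exact: (measurableT_comp (measurable_powR _) meta).
have Eb : (EE P b < +oo)%E.
  have -> : EE P b = EE P (fun w => 1 * b w) by apply: EE_eq => w; rewrite mul1r.
  rewrite Hb//; last exact: Gmeas_cst.
  have -> : EE P (fun w => 1 * eta w) = EE P eta by apply: EE_eq => w; rewrite mul1r.
  exact: Wmom_EE.
pose c := (2%:E * ((2 `^ p)%:E * EE P (fun w => (eta w `^ (p + 1))%R)))%E.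
pose m N w := Num.min (b w) N%:R.
have m0 N w : 0 <= m N w by rewrite le_min b0/=.
have mb_ N w : m N w <= b w by rewrite ge_min lexx.
have Gm N : Gmeas G (m N) by apply/GmeasP => //; apply: measurable_minr => //; exact/GmeasP.
have bound N : (EE P (fun w => (m N w `^ p * b w)%R) <= c)%E.
  pose z w := m N w `^ p.
  have z0 w : 0 <= z w by exact: powR_ge0.
  have Gz : Gmeas G z.
    apply/GmeasP => //; apply: (measurableT_comp (measurable_powR _)); exact/GmeasP.
  have mz := Gmeas_measurable GM Gz.
  have zfin : (EE P (fun w => (z w * b w)%R)) \is a fin_num.
    rewrite ge0_fin_numE; last by apply: EE_ge0 => w; rewrite mulr_ge0.
    apply: (@le_lt_trans _ _ (EE P (fun w => (N%:R `^ p * b w)%R))).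
      apply: EE_le => //; [exact: measurable_funM|exact: measurable_funM|by move=> w; rewrite mulr_ge0|].
      by move=> w; rewrite ler_wpM2r//; apply: powR_le => //; [exact: ltW|rewrite ge_min lexx orbT].
    by rewrite EE_scale ?powR_ge0// lte_mul_pinfty ?lee_fin ?powR_ge0.
  have : (EE P (fun w => (z w * b w)%R) <=
      2^-1%:E * EE P (fun w => (z w * b w)%R) +
      (2 `^ p)%:E * EE P (fun w => (eta w `^ (p + 1))%R))%E.
    rewrite {1}Hb//.
    rewrite -EE_scale//; [|by [exact: measurable_funM|move=> w; rewrite mulr_ge0]..].
    rewrite -EE_scale//; [|by move=> w; exact: powR_ge0..].
    rewrite -EE_add//; [|by [apply: measurable_funM => //; exact: measurable_funM|
      exact: measurable_funM|move=> w; do 2 apply: mulr_ge0 => //|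
      move=> w; rewrite mulr_ge0 ?powR_ge0]..].
    apply: EE_le.
    - exact: measurable_funM.
    - apply: measurable_funD; last exact: measurable_funM.
      by apply: measurable_funM => //; exact: measurable_funM.
    - by move=> w; rewrite mulr_ge0.
    - move=> w; apply: le_trans (powR_mul_le p0 (m0 N w) (eta0 w)) _.
      by rewrite lerD2r ler_pM2l ?invr_gt0// ler_wpM2l ?z0// mb_.
  rewrite -(fineK zfin); set y := fine _.
  rewrite /c; move: (EE P (fun w => (eta w `^ (p + 1))%R)) => [r| |]; last 2 first.
  - by rewrite !gt0_muley ?leey ?lte_fin ?powR_gt0.
  - by rewrite -EFinM gt0_muleNy ?lte_fin ?powR_gt0// addeNy leeNy_eq.
  by rewrite -!EFinM -EFinD !lee_fin; lra.
have cfin : (c < +oo)%E.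
  rewrite /c lte_mul_pinfty// lte_mul_pinfty ?lee_fin ?powR_ge0//.
have mbp1 : measurable_fun setT (fun w => b w `^ (p + 1)).
  exact: (measurableT_comp (measurable_powR _) mb).
have Ebp1 : (EE P (fun w => (b w `^ (p + 1))%R) <= c)%E.
  apply: EE_trunc_le => //; first by move=> w; exact: powR_ge0.
  (* Level [n.+1] rather than [n]: the truncation must be at least 1, so that its power [p] is at
     least 1 where [b] exceeds it. *)
  move=> n; apply: le_trans (bound n.+1).
  have mm := Gmeas_measurable GM (Gm n.+1).
  apply: EE_le.
  - exact: measurable_minr.
  - apply: measurable_funM => //.
    exact: (measurableT_comp (measurable_powR _) mm).
  - by move=> w; rewrite le_min powR_ge0/=.
  - move=> w; have [bn|nb] := leP (b w) n.+1%:R.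
      have -> : m n.+1 w = b w by rewrite /m min_l.
      by rewrite powRD ?(negbTE p1n0)// powRr1// ge_min lexx.
    rewrite ge_min; apply/orP; right; have -> : m n.+1 w = n.+1%:R by rewrite /m min_r// ltW.
    apply: (@le_trans _ _ (1 * n.+1%:R)); first by rewrite mul1r ler_nat.
    apply: ler_pM => //; last exact: ltW.
    apply: (@le_trans _ _ (1 `^ p)); first by rewrite powR1.
    by apply: powR_le => //; [exact: ltW|rewrite ler1n].
apply: (@le_lt_trans _ _ (EE P (fun w => 1 + b w `^ (p + 1)))).
  apply: (@EE_le _ _ _ P (fun w => `|b w| `^ p)).
  - exact: measurable_norm_powR.
  - exact: measurable_funD.
  - by move=> w; exact: powR_ge0.
  - move=> w; rewrite ger0_norm//; have [b1|b1] := leP (b w) 1.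
      apply: (@le_trans _ _ 1); last by rewrite lerDl powR_ge0.
      apply: (@le_trans _ _ (1 `^ p)); last by rewrite powR1.
      by apply: powR_le => //; exact: ltW.
    apply: (@le_trans _ _ (b w `^ (p + 1))); last by rewrite lerDr.
    by apply: ler_powR; [exact: ltW|rewrite lerDl].
rewrite EE_add//; last by move=> w; exact: powR_ge0.
by rewrite EE_cst lte_add_pinfty ?ltry// (le_lt_trans Ebp1).
Qed.

End moments.

(** * A Komlos-type compactness principle *)

Section komlos.
Context {dO : measure_display} {Omega : measurableType dO} {R : realType}.
Variable P : probability Omega R.

(** The increments have a finite expected sum, so the telescoping series converges absolutely almost
    everywhere. *)
Lemma fast_cauchy_ae (v : nat -> Omega -> R) (c : R) : 0 <= c ->
  (forall i, measurable_fun setT (v i)) ->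
  (forall i, (EE P (fun w => `|v i.+1 w - v i w|%R) <= (c / (2 ^ i.+1)%:R)%:E)%E) ->
  \forall w \ae P, cvgn (v ^~ w).
Proof.
move=> c0 mv Hv.
pose D i w := `|v i.+1 w - v i w|.
have mD i : measurable_fun setT (EFin \o D i).
  apply/measurable_EFinP; apply: (measurableT_comp (@normr_measurable R setT)).
  exact: measurable_funB.
have D0 i w : (0 <= (D i w)%:E)%E by rewrite lee_fin normr_ge0.
have intD : P.-integrable setT (fun w => \sum_(i <oo) (D i w)%:E)%E.
  apply/integrableP; split; first by apply: ge0_emeasurable_sum => i _ //; exact: mD.
  under eq_integral => w _ do rewrite gee0_abs ?nneseries_ge0//.
  rewrite integral_nneseries//.
  apply: (@le_lt_trans _ _ c%:E); last exact: ltry.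
  apply: le_trans (epsilon_trick0 xpredT c0).
  by apply: lee_nneseries => i _; [move=> _; exact: integral_ge0|exact: Hv].
apply: filterS (integrable_ae measurableT intD) => w /(_ I) Sfin.
suff cs : cvgn (series (telescope (v ^~ w))).
  move: cs; rewrite telescopeK => cs.
  have -> : v ^~ w = (fun n => (v n w - v 0%N w) + v 0%N w).
    by apply/funext => n; rewrite subrK.
  by apply: is_cvgD => //; exact: is_cvg_cst.
apply: normed_cvg; apply: nondecreasing_is_cvgn.
  apply/nondecreasing_seqP => n; rewrite /normed_series_of /= /series/= big_nat_recr//= lerDl.
  exact: normr_ge0.
exists (fine (\sum_(i <oo) (D i w)%:E)%E) => _ [n _ <-].
rewrite -lee_fin fineK// /series/= -sumEFin.
exact: nneseries_lim_ge.
Qed.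

Lemma fatou_ae (f : nat -> Omega -> R) (M : R) :
  (forall i, measurable_fun setT (f i)) -> (forall i w, 0 <= f i w) ->
  (forall i, (EE P (f i) <= M%:E)%E) ->
  \forall w \ae P, (limn_einf (fun n => (f n w)%:E) < +oo)%E.
Proof.
move=> mf f0 fM.
have mf' i : measurable_fun setT (EFin \o f i) by exact/measurable_EFinP.
have lb w : (0 <= limn_einf (fun n => (f n w)%:E))%E.
  rewrite limn_einf_lim; apply: lime_ge; first exact: is_cvg_einfs.
  by apply: nearW => n; apply: le_ereal_inf_tmp => _ [k _ <-]; rewrite lee_fin.
have int : P.-integrable setT (fun w => limn_einf (fun n => (f n w)%:E)).
  apply/integrableP; split.
    rewrite (_ : (fun w => _) = (fun w => - limn_esup (fun n => (- f n w)%:E))%E)//.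
    apply: (measurableT_comp (@oppe_measurable R setT)).
    apply: (@measurable_fun_limn_esup _ _ _ setT (fun n w => (- f n w)%:E)) => n.
    by apply/measurable_EFinP; exact: measurable_funN.
  under eq_integral => w _ do rewrite gee0_abs//.
  apply: (@le_lt_trans _ _ M%:E); last exact: ltry.
  apply: le_trans (fatou P measurableT mf' _) _; first by move=> n w _; rewrite lee_fin.
  rewrite limn_einf_lim; apply: lime_le; first exact: is_cvg_einfs.
  apply: nearW => n; apply: (@le_trans _ _ (EE P (f n))); last exact: fM.
  by apply: ereal_inf_lbound; exists n => //=.
apply: filterS (integrable_ae measurableT int) => w /(_ I).
by rewrite ge0_fin_numE.
Qed.

Variables (J : finType) (rho : J -> Omega -> R) (M : R).
Hypothesis mrho : forall j, measurable_fun setT (rho j).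
Hypothesis rho0 : forall j w, 0 <= rho j w.
Hypothesis rho_gt0 : forall j, \forall w \ae P, 0 < rho j w.
Variable H : nat -> set (J -> Omega -> R).
Hypothesis mH : forall n h, H n h -> forall j, measurable_fun setT (h j).
Hypothesis H_ge0 : forall n h, H n h -> forall j w, 0 <= h j w.
Hypothesis H_neq0 : forall n, H n !=set0.
Hypothesis H_dec : forall n, H n.+1 `<=` H n.
Hypothesis H_mid : forall n h h', H n h -> H n h' ->
  H n (fun j w => (h j w + h' j w) / 2).
Hypothesis H_bnd : forall n h j, H n h ->
  (EE P (fun w => (rho j w * h j w)%R) <= M%:E)%E.

(* Strict convexity of [Phi] makes a minimising sequence Cauchy; the bound [H_bnd] then keeps
   its limit finite. *)
Let Phi (h : J -> Omega -> R) : R := fine (EE P (fun w => \sum_j expR (- h j w))).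

Let mexp (h : J -> Omega -> R) (a : R) j : measurable_fun setT (h j) ->
  measurable_fun setT (fun w => expR (- h j w / a)).
Proof.
move=> mh; apply: (measurableT_comp (@measurable_expR R)).
by apply: measurable_funM => //; exact: measurable_funN.
Qed.

Let mPhi n h : H n h -> measurable_fun setT (fun w => \sum_j expR (- h j w)).
Proof.
move=> Hh; apply: measurable_sum => j; under eq_fun do rewrite -[- h j _]divr1.
by apply: mexp; exact: (mH Hh).
Qed.

Let PhiE n h : H n h -> EE P (fun w => \sum_j expR (- h j w)) = (Phi h)%:E.
Proof.
move=> Hh; rewrite fineK// ge0_fin_numE; last first.
  by apply: EE_ge0 => w; apply: sumr_ge0 => j _; exact: expR_ge0.
apply: (@le_lt_trans _ _ (EE P (fun=> #|J|%:R))); last by rewrite EE_cst ltry.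
apply: EE_le => //; first exact: mPhi Hh.
  by move=> w; apply: sumr_ge0 => j _; exact: expR_ge0.
move=> w; rewrite -sum1_card natr_sum; apply: ler_sum => j _.
by rewrite -expR0 ler_expR oppr_le0 (H_ge0 Hh).
Qed.

Let Phi_ge0 h : 0 <= Phi h.
Proof. by apply/fine_ge0/EE_ge0 => w; apply: sumr_ge0 => j _; exact: expR_ge0. Qed.

Let Phi_leJ n h : H n h -> Phi h <= #|J|%:R.
Proof.
move=> Hh; rewrite -lee_fin -(PhiE Hh) -(EE_cst P #|J|%:R).
apply: EE_le => //; first exact: mPhi Hh.
  by move=> w; apply: sumr_ge0 => j _; exact: expR_ge0.
move=> w; rewrite -sum1_card natr_sum; apply: ler_sum => j _.
by rewrite -expR0 ler_expR oppr_le0 (H_ge0 Hh).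
Qed.

(* [(e^(-a) + e^(-b)) / 2 - e^(-(a+b)/2) = (e^(-a/2) - e^(-b/2))^2 / 2] *)
Let Phi_mid n h h' : H n h -> H n h' ->
  EE P (fun w => \sum_j (expR (- h j w / 2) - expR (- h' j w / 2)) ^+ 2) =
   (Phi h + Phi h' - 2 * Phi (fun j w => (h j w + h' j w) / 2))%:E.
Proof.
move=> Hh Hh'; have Hm := H_mid Hh Hh'.
set A := EE P _.
have mS : measurable_fun setT
    (fun w => \sum_j (expR (- h j w / 2) - expR (- h' j w / 2)) ^+ 2).
  apply: measurable_sum => j; apply: measurable_funX; apply: measurable_funB.
    by apply: mexp; exact: (mH Hh).
  by apply: mexp; exact: (mH Hh').
have : (A + (2 * Phi (fun j w => (h j w + h' j w) / 2))%:E = (Phi h + Phi h')%:E)%E.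
  rewrite EFinM [RHS]EFinD -(PhiE Hh) -(PhiE Hh') -(PhiE Hm) -EE_scale//; last 2 first.
  - exact: mPhi Hm.
  - by move=> w; apply: sumr_ge0 => j _; exact: expR_ge0.
  rewrite -!EE_add//; [|by [exact: mPhi Hh|exact: mPhi Hh'|
    apply: measurable_funM => //; exact: mPhi Hm|
    move=> w; apply: sumr_ge0 => j _; exact: sqr_ge0|
    move=> w; apply: sumr_ge0 => j _; exact: expR_ge0|
    move=> w; rewrite mulr_ge0//; apply: sumr_ge0 => j _; exact: expR_ge0]..].
  apply: EE_eq => w; rewrite mulr_sumr -!big_split/=; apply: eq_bigr => j _.
  have E a : expR (- a : R) = expR (- a / 2) ^+ 2.
    by rewrite expr2 -expRD; congr expR; lra.
  rewrite !E sqrrB.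
  have -> : expR (- ((h j w + h' j w) / 2) / 2) ^+ 2 = expR (- h j w / 2) * expR (- h' j w / 2).
    by rewrite expr2 -!expRD; congr expR; lra.
  ring.
move=> /(congr1 (fun t => t - (2 * Phi (fun j w => (h j w + h' j w) / 2))%:E)%E).
by rewrite addeK// -EFinB.
Qed.

Let H_le n k : (n <= k)%N -> H k `<=` H n.
Proof.
move=> /subnK <-; elim: (k - n)%N => [//|i IH]; rewrite addSn => h /H_dec.
exact: IH.
Qed.

(** Each [H n] plays the role of the convex hull of a tail; closure under midpoints is enough, since
    [g n] is chosen as an almost minimiser of [Phi] on [H n]. For [n <= k] the midpoint of [g n] and
    [g k] stays in [H n], so its value is at least [I n]; by [Phi_mid] this bounds the squared
    distance of the exponentials by a quantity that tends to 0 as [n] grows. *)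
Lemma komlos : exists (h : nat -> J -> Omega -> R) (hl : J -> Omega -> R),
  (forall n, H n (h n)) /\
  \forall w \ae P, forall j, h n j w @[n --> \oo] --> hl j w.
Proof.
pose I n := inf (Phi @` H n).
have hi n : has_inf (Phi @` H n).
  split; last by exists 0 => _ [h _ <-].
  by have [h Hh] := H_neq0 n; exists (Phi h), h.
have I_le n h : H n h -> I n <= Phi h.
  by move=> Hh; apply: inf_lbound; [exact: (hi n).2|exists h].
have /choice[g Hg] : forall n, exists h, H n h /\ Phi h < I n + n.+1%:R^-1.
  move=> n; have n0 : 0 < n.+1%:R^-1 :> R by rewrite invr_gt0.
  by have [_ [h Hh <-] ?] := inf_adherent n0 (hi n); exists h.
have Ind n k : (n <= k)%N -> I n <= I k.
  move=> nk; apply: lb_le_inf; first exact: (hi k).1.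
  by move=> _ [h Hh <-]; apply: I_le; exact: H_le nk _ Hh.
have Iub n : I n <= #|J|%:R.
  by have [h Hh] := H_neq0 n; exact: le_trans (I_le _ _ Hh) (Phi_leJ Hh).
pose L := sup (range I).
have hs : has_sup (range I).
  by split; [exists (I 0%N), 0%N|exists #|J|%:R => _ [n _ <-]].
have IL n : I n <= L by apply: sup_ubound; [exact: hs.2|exists n].
have key n k : (n <= k)%N ->
    (EE P (fun w => (\sum_j (expR (- g n j w / 2) - expR (- g k j w / 2)) ^+ 2)%R) <=
     (L - I n + 2 * n.+1%:R^-1)%:E)%E.
  move=> nk; have Hn := (Hg n).1; have Hk := H_le nk (Hg k).1.
  rewrite (Phi_mid Hn Hk) lee_fin.
  have := I_le _ _ (H_mid Hn Hk); have := (Hg n).2; have := (Hg k).2.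
  have : k.+1%:R^-1 <= n.+1%:R^-1 :> R by rewrite lef_pV2 ?posrE// ler_nat.
  have := IL k.
  move: (Phi _) (Phi _) (Phi _) (I k) (I n) (k.+1%:R^-1) (n.+1%:R^-1) => a b c d e k1 n1.
  by move=> ? ? ? ? ?; lra.
(* The rate 1/8 for squared distances outweighs the factor [2 ^+ i] introduced below and leaves
   summable distances. *)
have /choice[N HN] : forall i : nat, exists N : nat, forall n, (N <= n)%N ->
    L - I n + 2 * n.+1%:R^-1 <= (8^-1) ^+ i.+1.
  move=> i; have e0 : 0 < (8^-1) ^+ i.+1 / 2 :> R by rewrite divr_gt0// exprn_gt0.
  have [_ [N1 _ <-] HN1] := sup_adherent e0 hs.
  have [N2 HN2] : exists k : nat, k.+1%:R^-1 < (8^-1) ^+ i.+1 / 4 :> R.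
    exists (Num.trunc ((8^-1) ^+ i.+1 / 4 : R)^-1); rewrite invf_plt ?posrE ?divr_gt0 ?exprn_gt0//.
    exact: truncnS_gt.
  exists (maxn N1 N2) => n; rewrite geq_max => /andP[n1 n2].
  have := Ind _ _ n1.
  have : n.+1%:R^-1 <= N2.+1%:R^-1 :> R by rewrite lef_pV2 ?posrE// ler_nat.
  move: HN1 HN2; rewrite -/L.
  move: (I n) (I N1) (n.+1%:R^-1) (N2.+1%:R^-1) ((8^-1) ^+ i.+1) => a b c d e.
  by move=> ? ? ? ?; lra.
(* Nondecreasing in [i], and at least as large as both [N i] and [i]. *)
pose nn i := (\sum_(0 <= k < i.+1) N k + i)%N.
have nnN i : (N i <= nn i)%N by rewrite /nn big_nat_recr//= -addnA addnC -addnA leq_addr.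
have nni i : (i <= nn i)%N by rewrite leq_addl.
have nnS i : (nn i <= nn i.+1)%N.
  by rewrite /nn (big_nat_recr i.+1)//= -addnA leq_add2l addnS; rewrite (leq_trans (leqnSn _))// ltnS leq_addl.
pose h i := g (nn i).
have Hh i : H i (h i) by exact: H_le (nni i) _ (Hg _).1.
have mh i j : measurable_fun setT (h i j) by exact: mH (Hh i) j.
have h0 i j w : 0 <= h i j w by exact: H_ge0 (Hh i) j w.
pose u j i w := expR (- h i j w / 2).
have mu j i : measurable_fun setT (u j i) by apply: mexp.
have ucvg j : \forall w \ae P, cvgn (u j ^~ w).
  apply: (fast_cauchy_ae (c := 4)) => // i.
  (* From squares to absolute values by [z <= 1 / e + e z^2] with [e = 2 ^+ i]. *)
  apply: (@le_trans _ _ (EE P (fun w => ((2^-1) ^+ i + 2 ^+ i *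
       \sum_j (expR (- h i j w / 2) - expR (- h i.+1 j w / 2)) ^+ 2)%R))).
    apply: EE_le.
    - apply: (measurableT_comp (@normr_measurable R setT)); exact: measurable_funB.
    - apply: measurable_funD => //; apply: measurable_funM => //.
      by apply: measurable_sum => k; apply: measurable_funX; apply: measurable_funB; exact: mexp.
    - by move=> w.
    - move=> w; rewrite (bigD1 j)//= -/(u j i w) -/(u j i.+1 w).
      set S := \sum_(_ | _) _.
      have S0 : 0 <= S by apply: sumr_ge0 => k _; exact: sqr_ge0.
      set x := u j i w; set y := u j i.+1 w.
      set e := 2 ^+ i; have e0 : 0 < e :> R by rewrite exprn_gt0.
      rewrite exprVn -/e; apply: (@le_trans _ _ (e^-1 + e * (x - y) ^+ 2)); last first.
        by rewrite lerD2l ler_pM2l// lerDl.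
      rewrite distrC -[X in _ <= _ + _ * X]real_normK ?num_real//.
      set z := `|x - y|; have z0 : 0 <= z by exact: normr_ge0.
      have -> : e^-1 + e * z ^+ 2 = z + e^-1 * ((e * z - 1) ^+ 2 + e * z).
        by field; rewrite gt_eqF.
      rewrite lerDl mulr_ge0 ?invr_ge0 ?(ltW e0)// addr_ge0 ?sqr_ge0//.
      by rewrite mulr_ge0// ltW.
  have mS : measurable_fun setT (fun w =>
      \sum_j (expR (- h i j w / 2) - expR (- h i.+1 j w / 2)) ^+ 2).
    by apply: measurable_sum => k; apply: measurable_funX; apply: measurable_funB; exact: mexp.
  have S0 w : 0 <= \sum_j (expR (- h i j w / 2) - expR (- h i.+1 j w / 2)) ^+ 2.
    by apply: sumr_ge0 => k _; exact: sqr_ge0.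
  rewrite EE_add//; [|by [exact: measurable_funM|move=> w; rewrite exprn_ge0|
    move=> w; rewrite mulr_ge0 ?exprn_ge0]..].
  rewrite EE_cst EE_scale ?exprn_ge0//.
  have := key _ _ (nnS i); rewrite -/(h i) -/(h i.+1).
  set E := EE P _ => HE.
  apply: (@le_trans _ _ (((2^-1) ^+ i)%:E + (2 ^+ i)%:E * ((8^-1) ^+ i.+1)%:E)%E).
    rewrite leeD2l// lee_pmul2l ?lte_fin ?exprn_gt0//.
    by apply: le_trans HE _; rewrite lee_fin; exact: HN.
  rewrite -EFinM -EFinD lee_fin natrX !exprVn.
  have e0 : 1 <= 2 ^+ i :> R by rewrite exprn_ege1// ler1n.
  have -> : 8 ^+ i.+1 = 8 * (2 ^+ i) ^+ 3 :> R.
    by rewrite exprS; congr (_ * _); rewrite -exprM mulnC exprM; congr (_ ^+ _); ring.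
  rewrite [2 ^+ i.+1]exprS; move: (2 ^+ i) e0 => e e1.
  have e0 : 0 < e by rewrite (lt_le_trans ltr01).
  have -> : e^-1 + e / (8 * e ^+ 3) = e^-1 + (e^-1) ^+ 2 / 8 by field; rewrite gt_eqF.
  have -> : 4 / (2 * e) = 2 * e^-1 by field; rewrite gt_eqF.
  have ei : 0 < e^-1 <= 1 by rewrite invr_gt0 e0/= invf_le1.
  by move: (e^-1) ei => x /andP[x0 x1]; nra.
have fat j : \forall w \ae P, (limn_einf (fun n => (rho j w * h n j w)%:E) < +oo)%E.
  apply: (fatou_ae (M := M)).
  - by move=> i; exact: measurable_funM.
  - by move=> i w; rewrite mulr_ge0.
  - by move=> i; exact: H_bnd (Hh i).
have all_ae : \forall w \ae P, forall j, [/\ cvgn (u j ^~ w), 0 < rho j w &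
    (limn_einf (fun n => (rho j w * h n j w)%:E) < +oo)%E].
  have : \forall w \ae P, forall n : nat, if @unpickle J n is Some j then
      [/\ cvgn (u j ^~ w), 0 < rho j w &
    (limn_einf (fun n => (rho j w * h n j w)%:E) < +oo)%E] else True.
    apply: ae_foralln => n; case: (unpickle n) => [j|]; last exact: aeW.
    by apply: filterS3 (ucvg j) (rho_gt0 j) (fat j) => w.
  by apply: filterS => w Hw j; have := Hw (pickle j); rewrite pickleK.
exists h, (fun j w => - 2 * ln (limn (u j ^~ w))); split => //.
apply: filterS all_ae => w Hw j; have [cu rj fj] := Hw j.
set l := limn _.
have ul : u j n w @[n --> \oo] --> l by [].
have l0 : 0 <= l by apply: limr_ge => //; apply: nearW => n; exact: expR_ge0.
(* If the exponentials tended to 0, then [h] and [rho] times [h] would tend to infinity, against the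
   finite lower limit given by Fatou. *)
have lgt0 : 0 < l.
  rewrite lt_neqAle l0 andbT; apply/negP => /eqP l_eq0.
  suff : (fun n => (rho j w * h n j w)%:E) @ \oo --> +oo%E.
    move=> /cvg_limn_einf_sup[E _]; by move: fj; rewrite E ltxx.
  apply/cvgeryP/cvgryPge => A.
  have e0 : 0 < expR (- (A / rho j w) / 2) by exact: expR_gt0.
  move: ul; rewrite -l_eq0 => /cvgr0Pnorm_lt /(_ _ e0).
  apply: filterS => n; rewrite ger0_norm ?expR_ge0// ltr_expR => hA.
  rewrite mulrC -ler_pdivrMr//; apply: ltW; move: hA; lra.
have hE n : h n j w = - 2 * ln (u j n w) by rewrite /u expRK; lra.
under eq_fun do rewrite hE.
apply: cvgMr.
exact: (cvg_comp _ _ ul (continuous_ln lgt0)).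
Qed.

End komlos.

(** * Bounding strategies by the expected loss *)

Section big_measurable.
Context {dT : measure_display} {T : measurableType dT} {R : realType} {I : eqType}.
Variables (s : seq I) (f : I -> T -> R).
Hypothesis mf : forall i, i \in s -> measurable_fun setT (f i).

Lemma measurable_sum_seq : measurable_fun setT (fun x => \sum_(i <- s) f i x).
Proof.
elim: s mf => [|i r IH] m; first by (under eq_fun do rewrite big_nil); exact: measurable_cst.
under eq_fun do rewrite big_cons; apply: measurable_funD.
  by apply: m; rewrite mem_head.
by apply: IH => j jr; apply: m; rewrite inE jr orbT.
Qed.

Lemma measurable_prod_seq : measurable_fun setT (fun x => \prod_(i <- s) f i x).
Proof.
elim: s mf => [|i r IH] m; first by (under eq_fun do rewrite big_nil); exact: measurable_cst.
under eq_fun do rewrite big_cons; apply: measurable_funM.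
  by apply: m; rewrite mem_head.
by apply: IH => j jr; apply: m; rewrite inE jr orbT.
Qed.

End big_measurable.

Lemma EE_sum_le {dO : measure_display} {Omega : measurableType dO} {R : realType}
    (P : probability Omega R) (I : eqType) (s : seq I) (f : I -> Omega -> R) (c : R) :
  (forall i, i \in s -> measurable_fun setT (f i)) -> (forall i w, 0 <= f i w) ->
  (forall i, i \in s -> (EE P (f i) <= c%:E)%E) ->
  (EE P (fun w => (\sum_(i <- s) f i w)%R) <= ((size s)%:R * c)%:E)%E.
Proof.
move=> + f0; elim: s => [|i r IH] m fc.
  by rewrite mul0r (EE_eq P (g := fun=> 0)) ?EE_cst// => w; rewrite big_nil.
rewrite (EE_eq P (g := fun w => f i w + \sum_(j <- r) f j w)); last by move=> w; rewrite big_cons.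
have mr j : j \in r -> measurable_fun setT (f j) by move=> jr; apply: m; rewrite inE jr orbT.
rewrite EE_add//; [|by apply: m; rewrite mem_head|exact: measurable_sum_seq|by move=> w; exact: sumr_ge0].
have -> : (size (i :: r))%:R * c = c + (size r)%:R * c by rewrite /= -natr1; ring.
rewrite EFinD; apply: leeD.
  by apply: fc; rewrite mem_head.
by apply: IH => // j jr; apply: fc; rewrite inE jr orbT.
Qed.

Section market_bounds.
Context {dO : measure_display} {Omega : measurableType dO} {R : realType}.
Variables (P : probability Omega R) (d Tn : nat) (F : nat -> set (set Omega)).
Hypothesis HF : is_filtration P Tn F.
Variable S : Process Omega R d.
Hypothesis adS : adapted Tn F S.
Variables (beta kappa : nat -> Omega -> R) (D : nat -> Omega -> set (d.-tuple R)).
Hypothesis beta_gt0 : forall t w, 0 < beta t w.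
Hypothesis kappa_gt0 : forall t w, 0 < kappa t w.
Hypothesis Gbeta : forall t, (1 <= t <= Tn)%N -> Gmeas (F t.-1) (beta t).
Hypothesis Gkappa : forall t, (1 <= t <= Tn)%N -> Gmeas (F t.-1) (kappa t).
Hypothesis Wbeta : forall t, (1 <= t <= Tn)%N -> Wmom P (fun w => (beta t w)^-1).
Hypothesis Wkappa : forall t, (1 <= t <= Tn)%N -> Wmom P (fun w => (kappa t w)^-1).
Hypothesis Wincr : forall t, (1 <= t <= Tn)%N -> Wmom P (fun w => enorm (incr S t w)).

Definition shortfall (xi : Omega -> d.-tuple R) t : set Omega :=
  [set w | dotv (xi w) (incr S t w) <= - beta t w * enorm (xi w)].

Hypothesis one_step : forall t, (1 <= t <= Tn)%N ->
  forall xi : Omega -> d.-tuple R, Gmeas (F t.-1) xi ->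
  (\forall w \ae P, D t w (xi w)) ->
  forall z : Omega -> R, Gmeas (F t.-1) z -> (forall w, 0 <= z w) ->
  (EE P (fun w => (z w * kappa t w)%R) <= EE P (fun w => (z w * \1_(shortfall xi t) w)%R))%E.

Let sF t : (t <= Tn)%N -> sigma_algebra setT (F t). Proof. by have [+ _] := HF; apply. Qed.
Let FM t : (t <= Tn)%N -> F t `<=` measurable. Proof. by have [_ [+ _]] := HF; apply. Qed.
Let Fle s t : (s <= t)%N -> (t <= Tn)%N -> F s `<=` F t.
Proof. by have [_ [_ [+ _]]] := HF; apply. Qed.

Let OF t := g_sigma_algebraType (F t).

Let predT_le t : (1 <= t <= Tn)%N -> (t.-1 <= Tn)%N.
Proof. by case: t => // t /=; exact: ltnW. Qed.

Let GP t (f : Omega -> R) : (t <= Tn)%N -> Gmeas (F t) f <-> measurable_fun [set: OF t] f.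
Proof. by move=> tT; apply: GmeasP; exact: sF. Qed.

Let Gmono s t dV (V : measurableType dV) (f : Omega -> V) : (s <= t)%N -> (t <= Tn)%N ->
  Gmeas (F s) f -> Gmeas (F t) f.
Proof. by move=> st tT; apply: Gmeas_sub; exact: Fle. Qed.

Lemma Gmeas_incr t : (1 <= t <= Tn)%N -> Gmeas (F t) (incr S t).
Proof.
move=> tT; have tT' : (t <= Tn)%N by case/andP: tT.
apply/(GmeasP (sF tT')); apply: measurable_subv.
  by apply/(GmeasP (sF tT')); exact: adS.
apply/(GmeasP (sF tT')); apply: (@Gmono t.-1) => //; first exact: leq_pred.
by apply: adS; exact: predT_le.
Qed.

Let mincr t : (1 <= t <= Tn)%N -> measurable_fun setT (incr S t).
Proof. by move=> tT; apply: (Gmeas_measurable (FM (t := t) _)); [case/andP: tT|exact: Gmeas_incr]. Qed.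

Lemma strategies_measurable (phi : Process Omega R d) t : strategies d Tn F phi -> (1 <= t <= Tn)%N ->
  measurable_fun setT (phi t).
Proof. by move=> sphi tT; exact: (Gmeas_measurable (FM (predT_le tT)) (sphi t tT)). Qed.

Lemma measurable_wealth w0 (phi : Process Omega R d) t : strategies d Tn F phi -> (t <= Tn)%N ->
  measurable_fun setT (wealth S w0 phi t).
Proof.
move=> sphi tT; apply: measurable_funD => //; apply: measurable_sum_seq => s.
rewrite mem_index_iota => /andP[s1 st].
have sT : (1 <= s <= Tn)%N by rewrite s1 (leq_trans _ tT).
by apply: measurable_dotv; [exact: strategies_measurable|exact: mincr].
Qed.

Section fixed_strategy.
Variable phi : Process Omega R d.
Hypothesis sphi : strategies d Tn F phi.
Hypothesis Dphi : forall t, (1 <= t <= Tn)%N -> \forall w \ae P, D t w (phi t w).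

Let A t w : R := \1_(shortfall (phi t) t) w.

Let A01 t w : A t w = 0 \/ A t w = 1.
Proof. by rewrite /A indicE; case: (_ \in _); [right|left]. Qed.

Let A_ge0 t w : 0 <= A t w. Proof. by case: (A01 t w) => ->. Qed.

Let GA t : (1 <= t <= Tn)%N -> Gmeas (F t) (A t).
Proof.
move=> tT; have tT' : (t <= Tn)%N by case/andP: tT.
have Gm dV (V : measurableType dV) (f : Omega -> V) : Gmeas (F t.-1) f ->
    measurable_fun [set: OF t] f.
  by move=> Gf; apply/(GmeasP (sF tT')); apply: (@Gmono t.-1) => //; exact: leq_pred.
apply/(GP _ tT'); apply: measurable_indic.
rewrite (_ : shortfall _ _ = (fun w : OF t => dotv (phi t w) (incr S t w) <=
    - beta t w * enorm (phi t w)) @^-1` [set true]); last by apply/seteqP; split.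
have mphi : measurable_fun [set: OF t] (phi t) by apply: Gm; exact: sphi.
rewrite -[X in measurable X]setTI; apply: measurable_fun_ler => //.
  apply: measurable_dotv => //.
  by apply/(GmeasP (sF tT')); exact: Gmeas_incr.
apply: measurable_funM; last exact: measurable_enorm.
by apply: measurable_funN; apply: Gm; exact: Gbeta.
Qed.

(** Induction on the number of periods left, starting from the empty product at [t = Tn.+1]. For the
    weight [z / kappa t], [one_step] exchanges [kappa t] for the indicator of a shortfall, and the
    new weight is measurable at time [t], ready for the next period. *)
Lemma chain_bound t (z : Omega -> R) : (1 <= t <= Tn.+1)%N -> Gmeas (F t.-1) z ->
  (forall w, 0 <= z w) ->
  (EE P z <= EE P (fun w => (z w * \prod_(t <= s < Tn.+1) (A s w / kappa s w))%R))%E.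
Proof.
move=> /andP[t1 tT]; rewrite -(subKn tT); move: (leq_subr t Tn.+1).
have : (Tn.+1 - t <= Tn)%N by rewrite leq_subLR addnC -addn1 leq_add2l.
elim: (Tn.+1 - t)%N z => [|n IH] z nT _ Gz z0.
  rewrite subn0 le_eqVlt; apply/orP; left; apply/eqP; apply: EE_eq => w.
  by rewrite big_geq ?mulr1// ltnS.
move: Gz; have tn : (Tn.+1 - n.+1 < Tn.+1 - n)%N by rewrite ltn_sub2l// ltnS ltnW.
set t' := (Tn.+1 - n.+1)%N.
have tS : (Tn.+1 - n)%N = t'.+1 by rewrite /t' subSS subSn// ltnW.
have tT' : (1 <= t' <= Tn)%N.
  by rewrite /t' subSS subn_gt0 nT leq_subr.
move=> Gz; have t'T := predT_le tT'.
pose z1 w := z w / kappa t' w.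
have z10 w : 0 <= z1 w by rewrite divr_ge0// ltW.
have Gz1 : Gmeas (F t'.-1) z1.
  apply/(GP _ t'T); apply: measurable_funM; first exact/(GP _ t'T).
  by apply: (measurableT_comp measurable_invr); apply/(GP _ t'T); exact: Gkappa.
have := one_step tT' (sphi tT') (Dphi tT') Gz1 z10.
rewrite -/(A t') => H1.
have -> : EE P z = EE P (fun w => z1 w * kappa t' w).
  by apply: EE_eq => w; rewrite /z1 divfK// gt_eqF.
apply: le_trans H1 _.
pose z2 w := z1 w * A t' w.
have Gz2 : Gmeas (F (Tn.+1 - n).-1) z2.
  rewrite tS/=; have tT2 : (t' <= Tn)%N by case/andP: tT'.
  apply/(GP _ tT2); apply: measurable_funM; last by apply/(GP _ tT2); exact: GA.
  by apply/(GP _ tT2); apply: (@Gmono t'.-1) => //; exact: leq_pred.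
have := IH z2 (ltnW nT) (leqW (ltnW nT)) Gz2 (fun w => mulr_ge0 (z10 w) (A_ge0 t' w)).
move=> /le_trans; apply; rewrite le_eqVlt; apply/orP; left; apply/eqP.
apply: EE_eq => w; rewrite tS [in RHS]big_ltn//; last by case/andP: tT'.
by rewrite /z2 /z1; ring.
Qed.

Let IA t w : R := \prod_(t <= s < Tn.+1) A s w.
Let K t w : R := \prod_(t <= s < Tn.+1) (kappa s w)^-1.

(** The factors [1 / kappa s] of [chain_bound] are in general not known at time [t.-1]; they are
    replaced by [b], which is. Since [IA] is 0 or 1, [2 IA K <= b IA + K^2 / b]; the hypothesis on
    [b] bounds the expectation of [z K^2 / b] by that of [z], and one [EE P z] cancels. *)
Lemma shortfall_bound t (b : Omega -> R) : (1 <= t <= Tn)%N ->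
  Gmeas (F t.-1) b -> (forall w, 0 < b w) ->
  (forall z : Omega -> R, Gmeas (F t.-1) z -> (forall w, 0 <= z w) ->
    (EE P (fun w => (z w * K t w ^+ 2)%R) <= EE P (fun w => (z w * b w)%R))%E) ->
  forall z : Omega -> R, Gmeas (F t.-1) z -> (forall w, 0 <= z w) ->
  (EE P z <= EE P (fun w => (z w * b w * IA t w)%R))%E.
Proof.
move=> tT Gb b0 HK.
have t'T := predT_le tT.
have mA s : s \in index_iota t Tn.+1 -> measurable_fun setT (A s).
  rewrite mem_index_iota => /andP[ts sT]; have s1 : (1 <= s <= Tn)%N.
    by case/andP: tT => t1 _; rewrite (leq_trans t1 ts).
  by apply: (Gmeas_measurable (FM (t := s) _)); [case/andP: s1|exact: GA].
have mIA : measurable_fun setT (IA t) by exact: measurable_prod_seq.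
have mK : measurable_fun setT (K t).
  apply: measurable_prod_seq => s; rewrite mem_index_iota => /andP[ts sT].
  have s1 : (1 <= s <= Tn)%N by case/andP: tT => t1 _; rewrite (leq_trans t1 ts).
  by have [] := Wkappa s1.
have IA01 w : IA t w = 0 \/ IA t w = 1.
  rewrite /IA; elim: (index_iota t Tn.+1) => [|s r IH]; first by right; rewrite big_nil.
  rewrite big_cons; case: (A01 s w) => ->; first by left; rewrite mul0r.
  by rewrite mul1r.
have IA0 w : 0 <= IA t w by case: (IA01 w) => ->.
have K0 w : 0 <= K t w by apply: prodr_ge0 => s _; rewrite invr_ge0 ltW.
have mb := Gmeas_measurable (FM t'T) Gb.
(* Boundedness of [z] makes the term to be cancelled finite. *)
have bounded (z : Omega -> R) (n : R) : Gmeas (F t.-1) z -> (forall w, 0 <= z w) -> (forall w, z w <= n) ->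
    (EE P z <= EE P (fun w => (z w * b w * IA t w)%R))%E.
  move=> Gz z0 zn; have mz := Gmeas_measurable (FM t'T) Gz.
  have zfin : EE P z \is a fin_num.
    rewrite ge0_fin_numE; last exact: EE_ge0.
    by apply: (@le_lt_trans _ _ (EE P (fun=> n))); [exact: EE_le|rewrite EE_cst ltry].
  have tT1 : (1 <= t <= Tn.+1)%N by case/andP: tT => -> /leqW.
  have H1 := chain_bound tT1 Gz z0.
  have H1' : (EE P z <= EE P (fun w => (z w * (IA t w * K t w))%R))%E.
    apply: le_trans H1 _; rewrite le_eqVlt; apply/orP; left; apply/eqP.
    by apply: EE_eq => w; rewrite /IA /K -big_split.
  pose zb w := z w / b w.
  have zb0 w : 0 <= zb w by rewrite divr_ge0// ltW.
  have Gzb : Gmeas (F t.-1) zb.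
    apply/(GP _ t'T); apply: measurable_funM; first exact/(GP _ t'T).
    by apply: (measurableT_comp measurable_invr); exact/(GP _ t'T).
  have mzb := Gmeas_measurable (FM t'T) Gzb.
  have mzbI : measurable_fun setT (fun w => z w * b w * IA t w).
    by apply: measurable_funM => //; exact: measurable_funM.
  have mzIK : measurable_fun setT (fun w => z w * (IA t w * K t w)).
    by apply: measurable_funM => //; exact: measurable_funM.
  have mzbK : measurable_fun setT (fun w => zb w * K t w ^+ 2).
    by apply: measurable_funM => //; exact: measurable_funX.
  have zbI0 w : 0 <= z w * b w * IA t w by rewrite !mulr_ge0// ltW.
  have zbK0 w : 0 <= zb w * K t w ^+ 2 by rewrite mulr_ge0// sqr_ge0.
  have H2 : (EE P (fun w => (2 * (z w * (IA t w * K t w)))%R) <=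
      EE P (fun w => (z w * b w * IA t w + zb w * K t w ^+ 2)%R))%E.
    apply: EE_le.
    - exact: measurable_funM.
    - exact: measurable_funD.
    - by move=> w; rewrite !mulr_ge0.
    - move=> w; rewrite /zb; have := b0 w; have := z0 w.
      move: (z w) (b w) (K t w) (IA t w) (IA01 w) => x y k i i01 x0 y0.
      rewrite -subr_ge0.
      have -> : x * y * i + x / y * k ^+ 2 - 2 * (x * (i * k)) =
          x / y * (y ^+ 2 * i + k ^+ 2 - 2 * y * i * k) by field; rewrite gt_eqF.
      rewrite mulr_ge0 ?divr_ge0 ?(ltW y0)//.
      case: i01 => ->; first by rewrite !mulr0 mul0r subr0 add0r sqr_ge0.
      have -> : y ^+ 2 * 1 + k ^+ 2 - 2 * y * 1 * k = (y - k) ^+ 2 by ring.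
      exact: sqr_ge0.
  have H3 : (EE P (fun w => (zb w * K t w ^+ 2)%R) <= EE P z)%E.
    apply: le_trans (HK zb Gzb zb0) _; rewrite le_eqVlt; apply/orP; left; apply/eqP.
    by apply: EE_eq => w; rewrite /zb divfK// gt_eqF.
  rewrite EE_add// in H2; rewrite EE_scale// in H2; last first.
    by move=> w; rewrite !mulr_ge0.
  have := le_trans H2 (leeD2l _ H3).
  have H4 : (2%:E * EE P z <= 2%:E * EE P (fun w => (z w * (IA t w * K t w))%R))%E.
    by rewrite lee_pmul2l ?lte_fin.
  move=> /(le_trans H4).
  rewrite -(fineK zfin); move: (EE P (fun w => z w * b w * IA t w)) => [r| |].
  - by rewrite -EFinM -EFinD !lee_fin; lra.
  - by move=> _; exact: leey.
  - by rewrite addNye -EFinM leeNy_eq.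
move=> z Gz z0; have mz := Gmeas_measurable (FM t'T) Gz.
apply: EE_trunc_le => // n.
pose zn w := Num.min (z w) n%:R.
have Gzn : Gmeas (F t.-1) zn.
  by apply/(GP _ t'T); apply: measurable_minr => //; exact/(GP _ t'T).
have zn0 w : 0 <= zn w by rewrite le_min z0/=.
apply: le_trans (bounded zn n%:R Gzn zn0 _) _; first by move=> w; rewrite ge_min lexx orbT.
have mzn := Gmeas_measurable (FM t'T) Gzn.
apply: EE_le.
- by apply: measurable_funM => //; exact: measurable_funM.
- by apply: measurable_funM => //; exact: measurable_funM.
- by move=> w; rewrite !mulr_ge0// ltW.
- by move=> w; rewrite ler_wpM2r// ler_wpM2r ?(ltW (b0 w))// ge_min lexx.
Qed.

Lemma shortfall_wealth w0 t w : (1 <= t <= Tn)%N ->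
  beta t w * enorm (phi t w) * IA t w <=
  Num.max (- wealth S w0 phi Tn w) 0 + Num.max (wealth S w0 phi t.-1 w) 0.
Proof.
move=> /andP[t1 tT].
set a := Num.max _ _; set b := Num.max _ _.
have a0 : 0 <= a by rewrite le_max lexx orbT.
have b0 : 0 <= b by rewrite le_max lexx orbT.
have [IA0|IA0] := eqVneq (IA t w) 0; first by rewrite IA0 mulr0 addr_ge0.
have As s : (t <= s < Tn.+1)%N -> dotv (phi s w) (incr S s w) <= - beta s w * enorm (phi s w).
  move=> sT; have : A s w != 0.
    move: IA0; apply: contra_neq => As0.
    by rewrite /IA (bigD1_seq s) ?mem_index_iota ?iota_uniq//= As0 mul0r.
  rewrite /A indicE; have [/set_mem//|_] := boolP (w \in _).
  by rewrite eqxx.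
have IA1 : IA t w = 1.
  rewrite /IA big1_seq// => s /=; rewrite mem_index_iota => sT.
  by rewrite /A indicE mem_set//; exact: As.
rewrite IA1 mulr1.
have WE : wealth S w0 phi Tn w = wealth S w0 phi t.-1 w +
    \sum_(t <= s < Tn.+1) dotv (phi s w) (incr S s w).
  rewrite /wealth -addrA; congr (_ + _); rewrite prednK//.
  by rewrite -big_cat_nat//= ltnW.
have : \sum_(t <= s < Tn.+1) dotv (phi s w) (incr S s w) <= - beta t w * enorm (phi t w).
  rewrite big_ltn// -[leRHS]addr0; apply: lerD; first by apply: As; rewrite leqnn.
  apply: (@le_trans _ _ (\sum_(t.+1 <= s < Tn.+1) (0 : R))); last by rewrite big1.
  rewrite big_seq [leRHS]big_seq; apply: ler_sum => s.
  rewrite mem_index_iota => /andP[ts sT].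
  apply: (le_trans (As s _)); first by rewrite (ltnW ts).
  by rewrite mulNr oppr_le0 mulr_ge0 ?enorm_ge0// ltW.
have : - wealth S w0 phi Tn w <= a by rewrite le_max lexx.
have : wealth S w0 phi t.-1 w <= b by rewrite le_max lexx.
by move: WE; lra.
Qed.

End fixed_strategy.

Lemma weights_exist : exists b : nat -> Omega -> R,
  (forall t w, 0 < b t w) /\
  forall t, (1 <= t <= Tn)%N -> [/\ Gmeas (F t.-1) (b t), Wmom P (b t) &
  forall z : Omega -> R, Gmeas (F t.-1) z -> (forall w, 0 <= z w) ->
    (EE P (fun w => (z w * (\prod_(t <= s < Tn.+1) (kappa s w)^-1) ^+ 2)%R) <=
     EE P (fun w => (z w * b t w)%R))%E].
Proof.
suff /choice[b Hb] : forall t, exists b : Omega -> R, (forall w, 0 < b w) /\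
  ((1 <= t <= Tn)%N -> [/\ Gmeas (F t.-1) b, Wmom P b &
  forall z : Omega -> R, Gmeas (F t.-1) z -> (forall w, 0 <= z w) ->
    (EE P (fun w => (z w * (\prod_(t <= s < Tn.+1) (kappa s w)^-1) ^+ 2)%R) <=
     EE P (fun w => (z w * b w)%R))%E]).
  by exists b; split => [t|t]; have [] := Hb t.
move=> t; have [tT|tT] := boolP (1 <= t <= Tn)%N; last by exists (fun=> 1).
have t'T := predT_le tT.
pose K w := (\prod_(t <= s < Tn.+1) (kappa s w)^-1) ^+ 2.
have WK : Wmom P K.
  have WK1 : Wmom P (fun w => \prod_(t <= s < Tn.+1) (kappa s w)^-1).
    apply: Wmom_prod => s; rewrite mem_index_iota => /andP[ts sT].
    by apply: Wkappa; case/andP: tT => t1 _; rewrite (leq_trans t1 ts).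
  rewrite /K; under eq_fun do rewrite expr2; exact: Wmom_mul.
have K0 w : 0 <= K w by exact: sqr_ge0.
have [b [Gb b0 _ bz]] := condexp_exists (sF t'T) (FM t'T) WK.1 K0 (Wmom_EE WK K0).
have Wb := Wmom_condexp (sF t'T) (FM t'T) Gb b0 WK K0 bz.
(* A conditional expectation of the squared product; adding 1 makes it positive everywhere, so that
   division by it is allowed. *)
exists (fun w => b w + 1); split; first by move=> w; rewrite ltr_wpDl.
move=> _; split.
- by apply/(GP _ t'T); apply: measurable_funD => //; exact/(GP _ t'T).
- by apply: Wmom_add; [exact: Wb|exact: Wmom_cst].
- move=> z Gz z0; rewrite -/K -bz//; have mz := Gmeas_measurable (FM t'T) Gz.
  have mb := Wb.1.
  apply: EE_le.
  + exact: measurable_funM.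
  + by apply: measurable_funM => //; exact: measurable_funD.
  + by move=> w; rewrite mulr_ge0.
  + by move=> w; rewrite ler_wpM2l// lerDl.
Qed.

Lemma wealth_pos_le w0 phi t w :
  Num.max (wealth S w0 phi t w) 0 <=
  `|w0| + \sum_(1 <= s < t.+1) enorm (phi s w) * enorm (incr S s w).
Proof.
have H : \sum_(1 <= s < t.+1) dotv (phi s w) (incr S s w) <=
    \sum_(1 <= s < t.+1) enorm (phi s w) * enorm (incr S s w).
  by apply: ler_sum => s _; exact: dotv_le.
rewrite ge_max; apply/andP; split; first by apply: lerD => //; exact: ler_norm.
by rewrite addr_ge0// sumr_ge0// => s _; rewrite mulr_ge0 ?enorm_ge0.
Qed.

(* If every period from [t] on ends in a shortfall, then [beta_t |phi_t|] is at most the final loss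
   plus the wealth gained before [t]; the latter is controlled by induction on [t], which
   forces the recursion [theta_t = a_t (1 + sum_(s < t) |dS_s| theta_s)], solved here by [a_t Q_t]. *)
Lemma strategy_bound : exists theta : nat -> Omega -> R,
  [/\ forall t w, 0 < theta t w,
      forall t, (1 <= t <= Tn)%N -> Wmom P (theta t) &
      forall (w0 : R) phi m, strategies d Tn F phi ->
        (forall t, (1 <= t <= Tn)%N -> \forall w \ae P, D t w (phi t w)) -> 0 <= m ->
        (EE P (fun w => Num.max (- wealth S w0 phi Tn w)%R 0%R) <= m%:E)%E ->
        forall t, (1 <= t <= Tn)%N ->
        (EE P (fun w => (enorm (phi t w) / theta t w)%R) <=
           (Tn.+1%:R ^+ t * (m + `|w0|))%:E)%E].
Proof.
have [b [b0 Hb]] := weights_exist.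
pose a t w := b t w / beta t w.
pose e t w := enorm (incr S t w).
pose Q t w := \prod_(1 <= s < t) (1 + e s w * a s w).
pose theta t w := a t w * Q t w.
have a0 t w : 0 < a t w by rewrite divr_gt0.
have e0 t w : 0 <= e t w by exact: enorm_ge0.
have ea1 s w : 1 <= 1 + e s w * a s w by rewrite lerDl mulr_ge0// ltW.
have prod1 (r : seq nat) w : 1 <= \prod_(s <- r) (1 + e s w * a s w).
  elim: r => [|s r IH]; first by rewrite big_nil.
  by rewrite big_cons -[leLHS]mulr1 ler_pM.
have Q1 t w : 1 <= Q t w by exact: prod1.
have Q0 t w : 0 < Q t w by exact: lt_le_trans (Q1 t w).
(* In particular [e s w * theta s w <= Q t w] for [s < t]: division by [Q t] turns each earlier gain
   bound [|phi_s| |dS_s|] into at most [X s]. *)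
have QS s t w : (1 <= s)%N -> (s < t)%N -> Q s w * (1 + e s w * a s w) <= Q t w.
  move=> s1 st; have -> : Q t w = Q s w * \prod_(s <= k < t) (1 + e k w * a k w).
    by rewrite /Q (big_cat_nat s1 (ltnW st)).
  rewrite big_ltn// ler_pM2l// -[leLHS]mulr1 ler_pM//.
  by rewrite (le_trans ler01).
have th0 t w : 0 < theta t w by rewrite mulr_gt0.
have Wa t : (1 <= t <= Tn)%N -> Wmom P (a t).
  by move=> tT; apply: Wmom_mul; [have [] := Hb t tT|exact: Wbeta].
exists theta; split; first exact: th0.
  move=> t tT; apply: Wmom_mul; first exact: Wa.
  apply: Wmom_prod => s; rewrite mem_index_iota => /andP[s1 st].
  have sT : (1 <= s <= Tn)%N by case/andP: tT => _ tT; rewrite s1 (leq_trans (ltnW st)).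
  apply: Wmom_add; first exact: Wmom_cst.
  by apply: Wmom_mul; [exact: Wincr|exact: Wa].
move=> w0 phi m sphi Dphi m0 Em.
have mm0 : 0 <= m + `|w0| by rewrite addr_ge0.
pose X t w := enorm (phi t w) / theta t w.
have X0 t w : 0 <= X t w by rewrite divr_ge0 ?enorm_ge0// ltW.
elim/ltn_ind => t IH tT.
have [t1 tT'] := andP tT.
have t'T := predT_le tT.
have [Gb Wb HK] := Hb t tT.
have Gle s f : (s <= t.-1)%N -> Gmeas (V := R) (F s) f -> measurable_fun [set: OF t.-1] f.
  by move=> st Gf; apply/(GP _ t'T); exact: Gmono Gf.
have Ga s : (1 <= s <= t)%N -> measurable_fun [set: OF t.-1] (a s).
  move=> /andP[s1 st]; have sT : (1 <= s <= Tn)%N by rewrite s1 (leq_trans st).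
  have [Gbs _ _] := Hb s sT.
  have st' : (s.-1 <= t.-1)%N by rewrite -!subn1 leq_sub2r.
  apply: measurable_funM; first exact: Gle Gbs.
  apply: (measurableT_comp measurable_invr); apply: Gle (Gbeta sT) => //.
have GX : Gmeas (F t.-1) (X t).
  apply/(GP _ t'T); apply: measurable_funM.
    by apply: measurable_enorm; apply/(GmeasP (sF t'T)); exact: sphi.
  apply: (measurableT_comp measurable_invr); apply: measurable_funM.
    by apply: Ga; rewrite t1 leqnn.
  apply: measurable_prod_seq => s; rewrite mem_index_iota => /andP[s1 st].
  have sT : (1 <= s <= Tn)%N by rewrite s1 (leq_trans (ltnW st)).
  have st' : (s <= t.-1)%N by rewrite -ltnS prednK.
  apply: measurable_funD => //; apply: measurable_funM.
    apply: measurable_enorm; apply/(GmeasP (sF t'T)).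
    by apply: Gmono (Gmeas_incr sT).
  by apply: Ga; rewrite s1 (ltnW st).
have H1 := shortfall_bound sphi Dphi tT Gb (b0 t) HK GX (X0 t).
apply: le_trans H1 _.
have mX s : (1 <= s <= Tn)%N -> measurable_fun setT (X s).
  move=> sT; apply: measurable_funM.
    by apply: measurable_enorm; exact: strategies_measurable.
  apply: (measurableT_comp measurable_invr).

  apply: measurable_funM; first by have [] := Wa s sT.
  apply: measurable_prod_seq => k; rewrite mem_index_iota => /andP[k1 kt].
  have kT : (1 <= k <= Tn)%N by case/andP: sT => _ sT; rewrite k1 (leq_trans (ltnW kt)).
  by apply: measurable_funD => //; apply: measurable_funM; [have [] := Wincr kT|have [] := Wa k kT].
have mWm : measurable_fun setT (fun w => Num.max (- wealth S w0 phi Tn w) 0).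
  by apply: measurable_maxr => //; apply: measurable_funN; exact: measurable_wealth.
have ms s : s \in index_iota 1 t -> measurable_fun setT (X s).
  rewrite mem_index_iota => /andP[s1 st]; apply: mX.
  by rewrite s1 (leq_trans (ltnW st)).
have mIA : measurable_fun setT (fun w => \prod_(t <= s < Tn.+1) (\1_(shortfall (phi s) s) w : R)).
  apply: measurable_prod_seq => s; rewrite mem_index_iota => /andP[ts sT].
  have sT' : (1 <= s <= Tn)%N by rewrite (leq_trans t1 ts).
  rewrite (_ : (fun w => _) = \1_(shortfall (phi s) s))//; apply: measurable_indic.
  rewrite (_ : shortfall _ _ = (fun w => dotv (phi s w) (incr S s w) <=
    - beta s w * enorm (phi s w)) @^-1` [set true]); last by apply/seteqP; split.
  have mphi := strategies_measurable sphi sT'.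
  rewrite -[X in measurable X]setTI; apply: measurable_fun_ler => //.
    by apply: measurable_dotv => //; exact: mincr.
  apply: measurable_funM; last exact: measurable_enorm.
  apply: measurable_funN; exact: (Gmeas_measurable (FM (predT_le sT')) (Gbeta sT')).
apply: (@le_trans _ _ (EE P (fun w => (Num.max (- wealth S w0 phi Tn w) 0 +
    (`|w0| + \sum_(1 <= s < t) X s w))%R))).
  apply: EE_le.
  - apply: measurable_funM => //; apply: measurable_funM; first exact: mX.
    exact: Wb.1.
  - apply: measurable_funD => //; apply: measurable_funD => //.
    exact: measurable_sum_seq.
  - move=> w; apply: mulr_ge0; first by rewrite mulr_ge0// ltW.
    by apply: prodr_ge0 => s _; rewrite indicE.
  - move=> w.
    have HW := shortfall_wealth phi w0 w tT.
    set ia := \prod_(t <= s < Tn.+1) _ in HW *.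
    have -> : X t w * b t w * ia = (beta t w * enorm (phi t w) * ia) / Q t w.
      rewrite /X /theta /a; field.
      by rewrite !gt_eqF.
    rewrite ler_pdivrMr//; apply: le_trans HW _.
    set c := Num.max (- _) 0; have c0 : 0 <= c by rewrite le_max lexx orbT.
    rewrite mulrDl; apply: lerD; first by rewrite ler_peMr.
    apply: le_trans (wealth_pos_le w0 phi t.-1 w) _; rewrite prednK//.
    rewrite mulrDl; apply: lerD; first by rewrite ler_peMr.
    rewrite mulr_suml big_seq [leRHS]big_seq; apply: ler_sum => s.
    rewrite mem_index_iota => /andP[s1 st].
    rewrite /X mulrAC -mulrA ler_wpM2l ?enorm_ge0//.
    rewrite ler_pdivlMr//; apply: le_trans (QS s t w s1 st).
    rewrite mulrDr mulr1 /theta -/(e s w).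
    have -> : Q s w * (e s w * a s w) = e s w * (a s w * Q s w) by ring.
    by rewrite lerDr ltW.
rewrite EE_add//; last 3 first.
- by apply: measurable_funD => //; exact: measurable_sum_seq.
- by move=> w; rewrite le_max lexx orbT.
- by move=> w; rewrite addr_ge0// sumr_ge0.
rewrite EE_add//; last 2 first.
- exact: measurable_sum_seq.
- by move=> w; rewrite sumr_ge0.
rewrite EE_cst.
have := @EE_sum_le _ _ _ P _ (index_iota 1 t) X (Tn.+1%:R ^+ t.-1 * (m + `|w0|)) ms X0.
move=> /(_ _)/wrap[|Hs].
  move=> s; rewrite mem_index_iota => /andP[s1 st].
  have sT : (1 <= s <= Tn)%N by rewrite s1 (leq_trans (ltnW st)).
  apply: le_trans (IH s st sT) _; rewrite lee_fin ler_wpM2r//.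
  by apply: ler_weXn2l; rewrite ?ler1n// -ltnS prednK.
apply: le_trans (leeD Em (leeD2l _ Hs)) _.
rewrite -!EFinD lee_fin size_iota addrA -[X in X + _]mul1r mulrA -mulrDl ler_wpM2r//.
(* The loss and [|w0|] contribute once, and each of the at most [Tn] earlier periods contributes the
   previous power: hence the base [Tn.+1]. *)
have -> : Tn.+1%:R ^+ t = (Tn%:R + 1) * Tn.+1%:R ^+ t.-1 :> R.
  by rewrite -{1}(prednK t1) exprS natr1.
have x1 : 1 <= Tn.+1%:R ^+ t.-1 :> R by rewrite exprn_ege1// ler1n.
have yz : (t - 1)%:R <= Tn%:R :> R by rewrite ler_nat leq_subLR (leq_trans tT')// leq_addl.
rewrite mulrDl mul1r addrC; apply: lerD => //.
by rewrite ler_wpM2r// (le_trans ler01).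
Qed.

End market_bounds.

(** * Utility of terminal wealth *)

Section wealth_moment.
Context {dO : measure_display} {Omega : measurableType dO} {R : realType}.
Variables (P : probability Omega R) (d Tn : nat) (F : nat -> set (set Omega)).
Hypothesis HF : is_filtration P Tn F.
Variable S : Process Omega R d.
Hypothesis adS : adapted Tn F S.
Hypothesis Wincr : forall t, (1 <= t <= Tn)%N -> Wmom P (fun w => enorm (incr S t w)).
Variable theta : nat -> Omega -> R.
Hypothesis th0 : forall t w, 0 < theta t w.
Hypothesis Wth : forall t, (1 <= t <= Tn)%N -> Wmom P (theta t).

(** The gain is at most the product of [a], which is 1 plus the sum of the [|phi_s| / theta_s], and
    [eta], which is [|w0|] plus the sum of the [theta_s |dS_s|]. The expectation of [a] is bounded
    linearly in [m]; [eta] has all moments and does not depend on [phi]. Young's inequality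
    separates the two. *)
Lemma wealth_moment (g eps w0 : R) : 0 < g -> g < 1 -> 0 < eps ->
  exists2 C : R, 0 <= C & forall phi m, strategies d Tn F phi -> 0 <= m ->
  (forall t, (1 <= t <= Tn)%N -> (EE P (fun w => (enorm (phi t w) / theta t w)%R) <=
           (Tn.+1%:R ^+ t * (m + `|w0|))%:E)%E) ->
  (EE P (fun w => (Num.max (wealth S w0 phi Tn w) 0 `^ g)%R) <= (eps * m + C)%:E)%E.
Proof.
move=> g0 g1 e0.
(* Chosen so that [EE P a <= 1 + c (m + |w0|)]; the tolerance handed to Young's inequality is
   divided by [c + 1] to end with [eps]. *)
pose c : R := Tn%:R * Tn.+1%:R ^+ Tn.
have c0 : 0 <= c by rewrite mulr_ge0// exprn_ge0.
have e'0 : 0 < eps / (c + 1) by rewrite divr_gt0// ltr_wpDl.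
have [C [q [C0 q0 HC]]] := young_powR g0 g1 e'0.
pose e t w := enorm (incr S t w).
have e_ge0 t w : 0 <= e t w by exact: enorm_ge0.
pose eta w := `|w0| + \sum_(1 <= s < Tn.+1) theta s w * e s w.
have eta0 w : 0 <= eta w.
  by rewrite addr_ge0// sumr_ge0// => s _; rewrite mulr_ge0// ltW.
have Weta : Wmom P eta.
  apply: Wmom_add; first exact: Wmom_cst.
  apply: Wmom_sum => s; rewrite mem_index_iota ltnS => sT.
  by apply: Wmom_mul; [exact: Wth|exact: Wincr].
have Eeta := Wmom_powR Weta eta0 q0.
have etaq0 w : 0 <= eta w `^ q by exact: powR_ge0.
have etafin : EE P (fun w => (eta w `^ q)%R) \is a fin_num.
  by rewrite ge0_fin_numE// EE_ge0.
pose E := fine (EE P (fun w => (eta w `^ q)%R)).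
have E0 : 0 <= E by apply: fine_ge0; exact: EE_ge0.
exists (eps / (c + 1) * (1 + c * `|w0|) + C * E).
  by rewrite addr_ge0 ?mulr_ge0 ?addr_ge0 ?mulr_ge0 ?(ltW e0) ?invr_ge0 ?addr_ge0.
move=> phi m sphi m0 Hm.
pose X t w := enorm (phi t w) / theta t w.
have X0 t w : 0 <= X t w by rewrite divr_ge0 ?enorm_ge0// ltW.
pose a w := 1 + \sum_(1 <= s < Tn.+1) X s w.
have a0 w : 0 <= a w by rewrite addr_ge0// sumr_ge0.
have mX s : s \in index_iota 1 Tn.+1 -> measurable_fun setT (X s).
  rewrite mem_index_iota ltnS => sT; apply: measurable_funM.
    by apply: measurable_enorm; exact: (strategies_measurable HF sphi sT).
  by apply: (measurableT_comp measurable_invr); have [] := Wth sT.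
have ma : measurable_fun setT a.
  by apply: measurable_funD => //; exact: measurable_sum_seq.
have meta : measurable_fun setT (fun w => eta w `^ q).
  exact: (measurableT_comp (measurable_powR _) Weta.1).
have Ea : (EE P a <= (1 + c * (m + `|w0|))%:E)%E.
  rewrite EE_add//; last 2 first.
  - exact: measurable_sum_seq.
  - by move=> w; exact: sumr_ge0.
  rewrite EE_cst EFinD leeD2l//.
  have := @EE_sum_le _ _ _ P _ (index_iota 1 Tn.+1) X (Tn.+1%:R ^+ Tn * (m + `|w0|)) mX X0.
  rewrite size_iota subn1/= mulrA; apply => s; rewrite mem_index_iota ltnS => sT.
  apply: le_trans (Hm s sT) _; rewrite lee_fin ler_wpM2r ?addr_ge0//.
  by apply: ler_weXn2l; rewrite ?ler1n//; case/andP: sT.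
have mW : measurable_fun setT (fun w => Num.max (wealth S w0 phi Tn w) 0).
  by apply: measurable_maxr => //; exact: (measurable_wealth HF adS).
apply: (@le_trans _ _ (EE P (fun w => (eps / (c + 1) * a w + C * eta w `^ q)%R))).
  apply: EE_le.
  - exact: (measurableT_comp (measurable_powR _) mW).
  - by apply: measurable_funD; exact: measurable_funM.
  - by move=> w; exact: powR_ge0.
  - move=> w; apply: le_trans (HC _ _ (a0 w) (eta0 w)).
    apply: powR_le; [exact: ltW|by rewrite le_max lexx orbT|].
    apply: le_trans (wealth_pos_le S w0 phi Tn w) _.
    rewrite /a /eta mulrDl mul1r -addrA lerD2l mulrDr.
    have S0 : 0 <= \sum_(1 <= s < Tn.+1) X s w by exact: sumr_ge0.
    have T0 : 0 <= \sum_(1 <= s < Tn.+1) theta s w * e s w.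
      by apply: sumr_ge0 => s _; rewrite mulr_ge0// ltW.
    apply: (@le_trans _ _ ((\sum_(1 <= s < Tn.+1) X s w) *
        (\sum_(1 <= s < Tn.+1) theta s w * e s w))); last first.
      by rewrite addrA lerDr addr_ge0// mulr_ge0.
    rewrite mulr_suml; apply: ler_sum_nat => s sT.
    rewrite (bigD1_seq s) ?mem_index_iota ?iota_uniq//= mulrDr.
    have -> : X s w * (theta s w * e s w) = enorm (phi s w) * enorm (incr S s w).
      by rewrite /X mulrA divfK// gt_eqF.
    rewrite lerDl mulr_ge0// sumr_ge0// => k _.
    by rewrite mulr_ge0// ltW.
rewrite EE_add//; [|by [exact: measurable_funM|move=> w; rewrite mulr_ge0// ltW|
  move=> w; rewrite mulr_ge0]..].
rewrite EE_scale// ?(ltW e'0)// EE_scale// -(fineK etafin) -/E.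
apply: (@le_trans _ _ ((eps / (c + 1))%:E * (1 + c * (m + `|w0|))%:E + C%:E * E%:E)%E).
  by rewrite leeD2r// lee_pmul2l ?lte_fin.
rewrite -!EFinM -EFinD lee_fin addrA lerD2r.
have -> : eps / (c + 1) * (1 + c * (m + `|w0|)) =
   eps * (c / (c + 1)) * m + eps / (c + 1) * (1 + c * `|w0|) by ring.
rewrite lerD2r ler_wpM2r// ler_piMr ?(ltW e0)//.
by rewrite ler_pdivrMr ?ltr_wpDl// mul1r lerDl.
Qed.

End wealth_moment.

Section utility.
Context {R : realType}.
Variable U : R -> R.
Hypothesis HU : utility_assumption U.

Let U_nd x y : x <= y -> U x <= U y. Proof. by have [+ _] := HU; apply. Qed.

(** If [U x1 < U y1] with [x1 < y1], concavity keeps [U] left of [x1] below the line through these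
    two points of the graph; its slope is [c]. *)
Lemma utility_slope : (forall x y, U x = U y) \/
  exists c x0 : R, 0 < c /\ forall x, x <= x0 -> U x <= U x0 + c * (x - x0).
Proof.
have [?|] := pselect (forall x y, U x = U y); first by left.
move=> /existsNP[x1 /existsNP[y1 Uxy]]; right.
wlog xy : x1 y1 Uxy / x1 < y1.
  move=> H; have [xy|yx|xy] := ltgtP x1 y1; first exact: H Uxy xy.
    by apply: H _ yx => /esym.
  by case: Uxy; rewrite xy.
have U1 : U x1 < U y1.
  by rewrite lt_neqAle U_nd ?(ltW xy)// andbT; exact/eqP.
exists ((U y1 - U x1) / (y1 - x1)), x1; split; first by rewrite divr_gt0 ?subr_gt0.
move=> x; rewrite le_eqVlt => /predU1P[->|xx1]; first by rewrite subrr mulr0 addr0.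
have xy1 : 0 < y1 - x by rewrite subr_gt0 (lt_trans xx1).
pose l := (y1 - x1) / (y1 - x).
have l01 : 0 <= l <= 1.
  rewrite /l divr_ge0/= ?(ltW xy1)//; last by rewrite subr_ge0 ltW.
  by rewrite ler_pdivrMr// mul1r lerD2l lerN2 ltW.
have := HU.2.1 x y1 l l01.
have -> : l * x + (1 - l) * y1 = x1 by rewrite /l; field; rewrite gt_eqF.
have y10 : 0 < y1 - x1 by rewrite subr_gt0.
move=> Hc; rewrite -subr_ge0.
have -> : U x1 + (U y1 - U x1) / (y1 - x1) * (x - x1) - U x =
   (y1 - x) / (y1 - x1) * (U x1 - (l * U x + (1 - l) * U y1)).
  by rewrite /l; field; rewrite !gt_eqF.
by rewrite mulr_ge0 ?divr_ge0 ?(ltW xy1) ?(ltW y10) ?subr_ge0.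
Qed.

Lemma measurable_utility : measurable_fun setT U.
Proof. by apply: nondecreasing_measurable => // x y _ _; exact: U_nd. Qed.

Lemma utility_bounds (C alpha : R) : 0 < C -> 0 <= alpha < 1 ->
  (forall x, 0 <= x -> U x <= C * (x `^ alpha + 1)) -> ~ (forall x y, U x = U y) ->
  exists c1 c2 : R, [/\ 0 < c1, 0 <= c2 & forall x,
    U x <= c2 + c2 * Num.max x 0 `^ ((1 + alpha) / 2) - c1 * Num.max (- x) 0].
Proof.
move=> C0 /andP[al0 al1] HC Unc; case: utility_slope => // -[c [x0 [c0 Hc]]].
(* Halfway to 1: above [alpha], below 1, and positive even if [alpha = 0], as Young's inequality
   requires. *)
set g := (1 + alpha) / 2.
have ag : alpha <= g by rewrite /g; lra.
have g0 : 0 < g by rewrite /g; lra.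
have pw x : 0 <= x -> x `^ alpha <= 1 + x `^ g.
  move=> x_ge0; have [x1|x1] := leP x 1.
    apply: (@le_trans _ _ 1); last by rewrite lerDl powR_ge0.
    by apply: (@le_trans _ _ (1 `^ alpha)); [exact: powR_le|rewrite powR1].
  apply: (@le_trans _ _ (x `^ g)); last by rewrite lerDr.
  by apply: ler_powR => //; exact: ltW.
(* One constant for all cases: [2 * C] serves [x >= 0]; for negative [x], [c * |x0|] is combined
   with [|U x0|] left of [x0] and with [|U 0|] to the right of it. *)
pose c2 := 2 * C + `|U x0| + `|U 0| + c * `|x0|.
have c20 : 0 <= c2.
  by rewrite !addr_ge0 ?mulr_ge0// ltW.
exists c, c2; split => // x.
have gp := powR_ge0 (Num.max x 0) g.
have [x_ge0|x_lt0] : 0 <= x \/ x < 0 by case: (leP 0 x); [left|right].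
  rewrite (max_l x_ge0) max_r ?oppr_le0// mulr0 subr0.
  rewrite (max_l x_ge0) in gp.
  apply: le_trans (HC x x_ge0) _.
  have h1 : C * (x `^ alpha + 1) <= C * (2 + x `^ g).
    by rewrite ler_pM2l//; have := pw x x_ge0; lra.
  apply: le_trans h1 _.
  have : 0 <= (c2 - 2 * C) * x `^ g.
    rewrite mulr_ge0// /c2; have := normr_ge0 (U x0); have := normr_ge0 (U 0).
    by have := mulr_ge0 (ltW c0) (normr_ge0 x0); lra.
  have := mulr_ge0 (ltW C0) gp.
  have : 2 * C <= c2.
    rewrite /c2; have := normr_ge0 (U x0); have := normr_ge0 (U 0).
    by have := mulr_ge0 (ltW c0) (normr_ge0 x0); lra.
  by move: (x `^ g) (c2) => y z; lra.
rewrite max_r ?(ltW x_lt0)// powR0 ?gt_eqF// mulr0 addr0 max_l ?oppr_ge0 ?(ltW x_lt0)//.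
have nx0 : - `|x0| <= x0 <= `|x0| by rewrite -ler_norml.
have cx0 : c * - `|x0| <= c * x0 <= c * `|x0|.
  by rewrite !ler_pM2l.
have [xx0|xx0] := leP x x0.
  apply: le_trans (Hc x xx0) _; rewrite /c2.
  have := ler_norm (U x0); have := normr_ge0 (U 0); move/andP: cx0 => [h1 h2].
  by move: C0 h1 h2; rewrite mulrN; lra.
have Ux : U x <= U 0 by apply: U_nd; exact: ltW.
apply: le_trans Ux _; rewrite /c2.
have h : c * x0 <= c * x by rewrite ler_pM2l// ltW.
have := ler_norm (U 0); have := normr_ge0 (U x0); move/andP: cx0 => [h1 h2].
by move: C0 h1 h2 h; rewrite !mulrN; lra.
Qed.

End utility.

(** * Expectations under the convention for undefined ones *)

Section econv.
Context {dO : measure_display} {Omega : measurableType dO} {R : realType}.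
Variable P : probability Omega R.
Implicit Types V Z : Omega -> R.

Lemma integral_pos_neg V :
  (\int[P]_w (V w)%:E = EE P (fun w => Num.max (V w) 0%R) - EE P (fun w => Num.max (- V w)%R 0%R))%E.
Proof.
rewrite integralE; congr (_ - _)%E; apply: eq_integral => w _.
  by rewrite funeposE -EFin_max.
by rewrite funenegE -EFinN -EFin_max.
Qed.

(** With both parts infinite the convention gives -oo, so a finite lower bound forces an integrable
    negative part. *)
Lemma Econv_neg_fin V (K : R) : measurable_fun setT V -> (K%:E <= Econv P V)%E ->
  (EE P (fun w => Num.max (- V w)%R 0%R) < +oo)%E.
Proof.
move=> mV; rewrite /Econv; case: ifPn => [_|]; first by rewrite leeNy_eq.
rewrite -[X in (X == _) && _]/(EE P _) -[X in _ && (X == _)]/(EE P _).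
rewrite integral_pos_neg; set p := EE P _; set n := EE P _ => pn Kpn.
rewrite ltey; apply/eqP => n_oo; move: pn Kpn; rewrite n_oo eqxx andbT.
by case: p => //= r _; rewrite leeNy_eq.
Qed.

Lemma EconvE V : measurable_fun setT V ->
  (EE P (fun w => Num.max (- V w)%R 0%R) < +oo)%E ->
  Econv P V = (EE P (fun w => Num.max (V w) 0%R) - EE P (fun w => Num.max (- V w)%R 0%R))%E.
Proof.
move=> mV nV; rewrite /Econv ifF; first exact: integral_pos_neg.
by apply/negP => /andP[_ /eqP noo]; move: nV; rewrite /EE noo ltxx.
Qed.

Lemma Econv_ge V Z (K : R) : measurable_fun setT V -> measurable_fun setT Z ->
  (forall w, Z w <= V w) -> (K%:E <= \int[P]_w (Z w)%:E)%E ->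
  (K%:E <= Econv P V)%E.
Proof.
move=> mV mZ ZV; rewrite integral_pos_neg => KZ.
have mp (X : Omega -> R) : measurable_fun setT X ->
    measurable_fun setT (fun w => Num.max (X w) 0).
  by move=> mX; exact: measurable_maxr.
have nle : (EE P (fun w => Num.max (- V w)%R 0%R) <= EE P (fun w => Num.max (- Z w)%R 0%R))%E.
  apply: EE_le; [exact/mp/measurable_funN|exact/mp/measurable_funN|by move=> w; rewrite le_max lexx orbT|].
  by move=> w; rewrite ge_max !le_max lerN2 ZV lexx/= orbT.
have ple : (EE P (fun w => Num.max (Z w) 0%R) <= EE P (fun w => Num.max (V w) 0%R))%E.
  apply: EE_le; [exact: mp|exact: mp|by move=> w; rewrite le_max lexx orbT|].
  by move=> w; rewrite ge_max !le_max ZV lexx/= orbT.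
have nZ : (EE P (fun w => Num.max (- Z w)%R 0%R) < +oo)%E.
  rewrite ltey; apply/eqP => n_oo; move: KZ; rewrite n_oo.
  by case: (EE P _) => //= r; rewrite leeNy_eq.
rewrite EconvE//; last exact: le_lt_trans nZ.
by apply: le_trans KZ _; exact: leeB.
Qed.

End econv.

(** * Strategies of bounded expected utility *)

Section fatou_real.
Context {dO : measure_display} {Omega : measurableType dO} {R : realType}.
Variable P : probability Omega R.

(** Fatou's lemma in the form that upper semicontinuity of [U] calls for: eventual lower bounds up
    to [e] replace a limit, and the expectations meet the bound [M] only asymptotically. *)
Lemma fatou_real (f : nat -> Omega -> R) (Y : Omega -> R) (M : R) :
  (forall i, measurable_fun setT (f i)) -> (forall i w, 0 <= f i w) ->
  measurable_fun setT Y -> (forall w, 0 <= Y w) ->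
  (\forall w \ae P, forall e : R, 0 < e -> \forall n \near \oo, Y w - e <= f n w) ->
  (forall i, (EE P (f i) <= (M + i.+1%:R^-1)%:E)%E) -> (EE P Y <= M%:E)%E.
Proof.
move=> mf f0 mY Y0 HY HM.
have mf' i : measurable_fun setT (EFin \o f i) by exact/measurable_EFinP.
have H1 : (EE P Y <= \int[P]_w limn_einf (fun n => (f n w)%:E))%E.
  apply: ae_ge0_le_integral => //.
  - by move=> w _; rewrite lee_fin.
  - exact/measurable_EFinP.
  - move=> w _; rewrite limn_einf_lim; apply: lime_ge; first exact: is_cvg_einfs.
    by apply: nearW => n; apply: le_ereal_inf_tmp => _ [k _ <-]; rewrite lee_fin.
  - rewrite (_ : (fun w => _) = (fun w => - limn_esup (fun n => (- f n w)%:E))%E)//.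
    apply: (measurableT_comp (@oppe_measurable R setT)).
    apply: (@measurable_fun_limn_esup _ _ _ setT (fun n w => (- f n w)%:E)) => n.
    by apply/measurable_EFinP; exact: measurable_funN.
  - apply: filterS HY => w Hw _; apply/lee_subgt0Pr => e e0.
    rewrite -EFinB limn_einf_lim; apply: lime_ge; first exact: is_cvg_einfs.
    have [N _ HN] := Hw e e0; exists N => // n /= Nn.
    apply: le_ereal_inf_tmp => _ [k /= nk <-]; rewrite lee_fin; apply: HN => /=.
    exact: leq_trans nk.
apply: le_trans H1 _.
apply: le_trans (fatou P measurableT mf' _) _; first by move=> n w _; rewrite lee_fin.
rewrite limn_einf_lim; apply: lime_le; first exact: is_cvg_einfs.
apply: nearW => n; apply/lee_addgt0Pr => e e0.
have [k ke] : exists k : nat, k.+1%:R^-1 < e.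
  exists (Num.trunc e^-1); rewrite invf_plt ?posrE//.
  exact: truncnS_gt.
apply: (@le_trans _ _ (EE P (f (maxn n k)))).
  by apply: ereal_inf_lbound; exists (maxn n k) => //=; exact: leq_maxl.
apply: le_trans (HM _) _; rewrite -EFinD lee_fin lerD2l (le_trans _ (ltW ke))//.
by rewrite lef_pV2 ?posrE// ler_nat ltnS leq_maxr.
Qed.

End fatou_real.

Section admissible_class.
Context {dO : measure_display} {Omega : measurableType dO} {R : realType}.
Variables (P : probability Omega R) (d Tn : nat) (F : nat -> set (set Omega)).
Hypothesis HF : is_filtration P Tn F.
Variable S : Process Omega R d.
Hypothesis adS : adapted Tn F S.
Hypothesis Wincr : forall t, (1 <= t <= Tn)%N -> Wmom P (fun w => enorm (incr S t w)).
Variables (theta : nat -> Omega -> R) (D : nat -> Omega -> set (d.-tuple R)) (w0 : R).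
Hypothesis th0 : forall t w, 0 < theta t w.
Hypothesis Wth : forall t, (1 <= t <= Tn)%N -> Wmom P (theta t).

Definition in_hull (phi : Process Omega R d) : Prop :=
  forall t, (1 <= t <= Tn)%N -> \forall w \ae P, D t w (phi t w).

Hypothesis Hth : forall phi m, strategies d Tn F phi -> in_hull phi -> 0 <= m ->
  (EE P (fun w => Num.max (- wealth S w0 phi Tn w)%R 0%R) <= m%:E)%E ->
  forall t, (1 <= t <= Tn)%N ->
  (EE P (fun w => (enorm (phi t w) / theta t w)%R) <=
     (Tn.+1%:R ^+ t * (m + `|w0|))%:E)%E.
Variable U : R -> R.
Hypothesis HU : utility_assumption U.
Variables (c1 c2 g K : R).
Hypotheses (c1_gt0 : 0 < c1) (c2_ge0 : 0 <= c2) (g0 : 0 < g) (g1 : g < 1).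
Hypothesis HUb : forall x,
  U x <= c2 + c2 * Num.max x 0 `^ g - c1 * Num.max (- x) 0.

Local Notation W phi := (wealth S w0 phi Tn).
Local Notation V phi := (fun w => U (wealth S w0 phi Tn w)).

Definition admissible (phi : Process Omega R d) : Prop :=
  [/\ strategies d Tn F phi, in_hull phi & (K%:E <= Econv P (V phi))%E].

Lemma measurable_utility_wealth phi : strategies d Tn F phi -> measurable_fun setT (V phi).
Proof.
move=> sphi; apply: (measurableT_comp (measurable_utility HU)).
exact: (measurable_wealth HF adS).
Qed.

Let mpos (X : Omega -> R) : measurable_fun setT X -> measurable_fun setT (fun w => Num.max (X w) 0).
Proof. by move=> mX; exact: measurable_maxr. Qed.

Let pos0 (x : R) : 0 <= Num.max x 0. Proof. by rewrite le_max lexx orbT. Qed.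

Let pos_neg (x : R) : Num.max x 0 - Num.max (- x) 0 = x.
Proof.
have [x0|x0] := leP 0 x.
  by rewrite [Num.max (- x) 0]max_r ?oppr_le0// subr0.
by rewrite max_l ?oppr_ge0 ?(ltW x0)// sub0r opprK.
Qed.

(** The choice of [eps] gives [c2 eps <= c1 / 2]. With [m] the expected loss,
    [K <= c2 + c2 (eps m + C) - c1 m], and half of [c1 m] survives to be bounded. *)
Lemma admissible_loss : exists2 M : R, 0 <= M & forall phi, admissible phi ->
  (EE P (fun w => Num.max (- W phi w)%R 0%R) <= M%:E)%E.
Proof.
pose eps := c1 / (2 * (c2 + 1)).
have c21 : 0 < c2 + 1 by rewrite ltr_wpDl.
have eps0 : 0 < eps by rewrite divr_gt0// mulr_gt0.
have [C C0 HC] := wealth_moment HF adS Wincr th0 Wth w0 g0 g1 eps0.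
exists (Num.max ((c2 + c2 * C - K) * 2 / c1) 0) => // phi [sphi Dphi Kphi].
have mW : measurable_fun setT (W phi) by exact: (measurable_wealth HF adS).
have mV := measurable_utility_wealth sphi.
have mVn : measurable_fun setT (fun w => Num.max (- V phi w) 0) by exact/mpos/measurable_funN.
have mVp : measurable_fun setT (fun w => Num.max (V phi w) 0) by exact/mpos.
have mWn : measurable_fun setT (fun w => Num.max (- W phi w) 0) by exact/mpos/measurable_funN.
have Vn := Econv_neg_fin mV Kphi.
(* The loss must be known to be finite before [m] can be formed; [HUb] gives
   [c1 W^- <= c2 + U(W)^-], and the right side is integrable. *)
have c1Wn : (EE P (fun w => (c1 * Num.max (- W phi w) 0)%R) < +oo)%E.
  apply: (@le_lt_trans _ _ (EE P (fun w => c2 + Num.max (- V phi w) 0))).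
    apply: EE_le.
    - exact: measurable_funM.
    - exact: measurable_funD.
    - by move=> w; rewrite mulr_ge0// ltW.
    - move=> w /=; set x := W phi w; have := HUb x.
      have := pos0 (- U x); have : - U x <= Num.max (- U x) 0 by rewrite le_max lexx.
      move: (Num.max (- U x) 0) => y.
      have [x0|x0] : 0 <= x \/ x < 0 by case: (leP 0 x); [left|right].
        by rewrite (max_r (x := - x)) ?oppr_le0// mulr0 => *; rewrite addr_ge0.
      by rewrite (max_r (x := x)) ?(ltW x0)// powR0 ?gt_eqF// mulr0; lra.
  by rewrite EE_add// EE_cst lte_add_pinfty ?ltry.
have Wfin : EE P (fun w => Num.max (- W phi w) 0) \is a fin_num.
  rewrite ge0_fin_numE; last exact: EE_ge0.
  move: c1Wn; rewrite EE_scale//; last exact: ltW.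
  by case: (EE P _) => [r _|//|//]; [exact: ltry|rewrite gt0_muley ?lte_fin// ltxx].
set m := fine (EE P (fun w => Num.max (- W phi w) 0)).
have mE : EE P (fun w => Num.max (- W phi w) 0) = m%:E by rewrite fineK.
have m0 : 0 <= m by apply: fine_ge0; exact: EE_ge0.
have mle : (EE P (fun w => Num.max (- W phi w)%R 0%R) <= m%:E)%E by rewrite mE.
have HX := Hth sphi Dphi m0 mle.
have HW := HC phi m sphi m0 HX.
have mWg : measurable_fun setT (fun w => Num.max (W phi w) 0 `^ g).
  exact: (measurableT_comp (measurable_powR _) (mpos mW)).
have Wg0 w : 0 <= Num.max (W phi w) 0 `^ g by exact: powR_ge0.
(* [HUb] with the negative terms moved across: expectations of nonnegative functions add without
   integrability. *)
have main : (EE P (fun w => (c1 * Num.max (- W phi w) 0 + Num.max (V phi w) 0)%R) <=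
    EE P (fun w => (c2 + c2 * Num.max (W phi w) 0 `^ g + Num.max (- V phi w) 0)%R))%E.
  apply: EE_le.
  - by apply: measurable_funD => //; exact: measurable_funM.
  - apply: measurable_funD => //; apply: measurable_funD => //; exact: measurable_funM.
  - by move=> w; rewrite addr_ge0// mulr_ge0// ltW.
  - move=> w /=; have := HUb (W phi w); have := pos_neg (V phi w) => /=.
    by lra.
have E1 : EE P (fun w => c1 * Num.max (- W phi w) 0 + Num.max (V phi w) 0) =
    (c1%:E * m%:E + EE P (fun w => Num.max (V phi w) 0%R))%E.
  rewrite EE_add//; [|by [exact: measurable_funM|move=> w; rewrite mulr_ge0// ltW]..].
  by rewrite EE_scale ?(ltW c1_gt0)// mE.
have E2 : EE P (fun w => c2 + c2 * Num.max (W phi w) 0 `^ g + Num.max (- V phi w) 0) =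
    (c2%:E + c2%:E * EE P (fun w => Num.max (W phi w) 0 `^ g)%R +
     EE P (fun w => Num.max (- V phi w)%R 0%R))%E.
  rewrite EE_add//; [|by [apply: measurable_funD => //; exact: measurable_funM|
    move=> w; rewrite addr_ge0// mulr_ge0]..].
  rewrite EE_add//; [|by [exact: measurable_funM|move=> w; rewrite mulr_ge0]..].
  by rewrite EE_cst EE_scale.
rewrite E1 E2 in main.
move: Kphi; rewrite EconvE//.
move: main Vn.
set p := EE P (fun w => Num.max (V phi w) 0).
set n := EE P (fun w => Num.max (- V phi w) 0).
have p0 : (0 <= p)%E by exact: EE_ge0.
have n0 : (0 <= n)%E by exact: EE_ge0.
have q0 : (0 <= EE P (fun w => Num.max (W phi w) 0 `^ g)%R)%E by exact: EE_ge0.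
move: HW q0; case: (EE P (fun w => Num.max (W phi w) 0 `^ g)) => [q| |]//.
rewrite lee_fin => HW _.
case: n n0 => [n| |]// _; case: p p0 => [p| |]// _.
rewrite -!EFinM -!EFinD !lee_fin => main _ Kpn.
rewrite mE lee_fin le_max; apply/orP; left.
rewrite ler_pdivlMr//.
have c2e : c2 * eps <= c1 / 2.
  have -> : c2 * eps = c1 / 2 * (c2 / (c2 + 1)) by rewrite /eps; field; rewrite gt_eqF.
  rewrite ler_piMr ?divr_ge0 ?(ltW c1_gt0)//.
  by rewrite ler_pdivrMr// mul1r lerDl.
have h1 : c2 * q <= c2 * (eps * m + C) by exact: ler_wpM2l.
have h2 : c2 * eps * m <= c1 / 2 * m by exact: ler_wpM2r.
move: main h1 h2 Kpn; rewrite mulrDr mulrA.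
move: (c2 * q) (c2 * eps * m) (c2 * C) => x y z; lra.
Qed.

Lemma admissible_moment (h : R) : 0 < h -> h < 1 ->
  exists2 C : R, 0 <= C & forall phi, admissible phi ->
  (EE P (fun w => (Num.max (W phi w) 0 `^ h)%R) <= C%:E)%E.
Proof.
move=> h0 h1; have [M M0 HM] := admissible_loss.
have [C C0 HC] := wealth_moment HF adS Wincr th0 Wth w0 h0 h1 ltr01.
exists (1 * M + C); first by rewrite mul1r addr_ge0.
move=> phi Aphi; have [sphi Dphi Kphi] := Aphi.
by apply: HC => //; apply: Hth => //; exact: HM.
Qed.

Lemma admissible_gain : exists2 B : R, 0 <= B & forall phi, admissible phi ->
  (EE P (fun w => Num.max (V phi w) 0%R) <= B%:E)%E.
Proof.
have [C C0 HC] := admissible_moment g0 g1.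
exists (c2 + c2 * C); first by rewrite addr_ge0// mulr_ge0.
move=> phi Aphi; have [sphi Dphi Kphi] := Aphi.
have mW : measurable_fun setT (W phi) by exact: (measurable_wealth HF adS).
have mV := measurable_utility_wealth sphi.
have mWg : measurable_fun setT (fun w => Num.max (W phi w) 0 `^ g).
  exact: (measurableT_comp (measurable_powR _) (mpos mW)).
have Wg0 w : 0 <= Num.max (W phi w) 0 `^ g by exact: powR_ge0.
apply: (@le_trans _ _ (EE P (fun w => (c2 + c2 * Num.max (W phi w) 0 `^ g)%R))).
  apply: EE_le.
  - exact: mpos.
  - by apply: measurable_funD => //; exact: measurable_funM.
  - by [].
  - move=> w; rewrite ge_max; apply/andP; split; last by rewrite addr_ge0// mulr_ge0.
    apply: le_trans (HUb _) _; rewrite gerBl mulr_ge0//; exact: ltW.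
rewrite EE_add//; [|by [exact: measurable_funM|move=> w; rewrite mulr_ge0]..].
rewrite EE_cst EE_scale// EFinD leeD2l// EFinM lee_wpmul2l ?lee_fin//.
exact: HC.
Qed.

Lemma admissible_Econv phi : admissible phi ->
  P.-integrable setT (EFin \o V phi) /\ Econv P (V phi) = (\int[P]_w (V phi w)%:E)%E.
Proof.
move=> Aphi; have [sphi Dphi Kphi] := Aphi.
have mV := measurable_utility_wealth sphi.
have [B B0 HB] := admissible_gain.
have Vn := Econv_neg_fin mV Kphi.
split; last by rewrite EconvE// integral_pos_neg.
apply/integrableP; split; first exact/measurable_EFinP.
have -> : (\int[P]_w `|(EFin \o V phi) w|)%E =
    EE P (fun w => Num.max (V phi w) 0 + Num.max (- V phi w) 0).
  apply: eq_integral => w _ /=; congr EFin.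
  have [x0|x0] := leP 0 (U (W phi w)).
    by rewrite max_r ?oppr_le0// addr0 ger0_norm.
  by rewrite max_l ?oppr_ge0 ?(ltW x0)// add0r ltr0_norm.
rewrite EE_add//; [|exact: mpos|exact/mpos/measurable_funN].
by rewrite lte_add_pinfty// (le_lt_trans (HB phi Aphi)) ?ltry.
Qed.

(* Fatou for [U(W_n) <= L + eps (W_n^+)^h] with [g < h < 1], the moments of order [h] being
   bounded uniformly in [n]. *)
Lemma admissible_limit (v : R) (phi : nat -> Process Omega R d) (phil : Process Omega R d) :
  (forall n, admissible (phi n)) ->
  (forall n, ((v - n.+1%:R^-1)%:E <= Econv P (V (phi n)))%E) ->
  strategies d Tn F phil ->
  (\forall w \ae P, W (phi n) w @[n --> \oo] --> W phil w) ->
  (v%:E <= Econv P (V phil))%E.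
Proof.
move=> Aphi Hv sphil Wcvg.
have mVl := measurable_utility_wealth sphil.
pose h := (1 + g) / 2.
have h0 : 0 < h by rewrite /h; move: g0; lra.
have h1 : h < 1 by rewrite /h; move: g1; lra.
have gh : g < h by rewrite /h; move: g1; lra.
have [C C0 HC] := admissible_moment h0 h1.
apply/lee_subgt0Pr => e e0; rewrite -EFinB.
pose eps := e / (C + 1).
have C1 : 0 < C + 1 by rewrite ltr_wpDl.
have eps0 : 0 < eps by rewrite divr_gt0.
have gh0 : 0 < g / h by rewrite divr_gt0.
have gh1 : g / h < 1 by rewrite ltr_pdivrMr// mul1r.
have eps' : 0 < eps / (c2 + 1) by rewrite divr_gt0// ltr_wpDl.
have [L0 [q [L00 q0 HL0]]] := young_powR gh0 gh1 eps'.
pose L := c2 + c2 * L0.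
have UL x : U x <= L + eps * Num.max x 0 `^ h.
  apply: le_trans (HUb x) _.
  apply: (@le_trans _ _ (c2 + c2 * Num.max x 0 `^ g)).
    by rewrite gerBl mulr_ge0//; exact: ltW.
  rewrite /L -addrA lerD2l.
  (* Young's inequality with exponent [g / h] and second factor 1: a small multiple of the power [h]
     dominates the power [g] up to a constant. *)
  have := HL0 (Num.max x 0 `^ h) 1 (powR_ge0 _ _) ler01.
  rewrite mulr1 powR1 mulr1 -powRrM mulrC divfK ?gt_eqF// => H.
  apply: le_trans (ler_wpM2l c2_ge0 H) _.
  rewrite mulrDr [leLHS]addrC lerD2l mulrA ler_wpM2r ?powR_ge0//.
  rewrite mulrCA ler_piMr ?(ltW eps0)//.
  by rewrite ler_pdivrMr ?ltr_wpDl// mul1r lerDl.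
pose f n w := L + eps * Num.max (W (phi n) w) 0 `^ h - V (phi n) w.
have f0 n w : 0 <= f n w by rewrite subr_ge0.
(* The maximum provides the nonnegativity that Fatou asks for, and [L - Y] is still a lower bound of
   [V phil]. *)
pose Y w := Num.max (L - V phil w) 0.
have mWh n : measurable_fun setT (fun w => Num.max (W (phi n) w) 0 `^ h).
  apply: (measurableT_comp (measurable_powR _)); apply: mpos.
  by apply: (measurable_wealth HF adS) => //; have [] := Aphi n.
have mVn n : measurable_fun setT (V (phi n)).
  by apply: measurable_utility_wealth; have [] := Aphi n.
have mf n : measurable_fun setT (f n).
  apply: measurable_funB => //; apply: measurable_funD => //; exact: measurable_funM.
have mY : measurable_fun setT Y by apply: mpos; exact: measurable_funB.
have L_ge0 : 0 <= L by rewrite addr_ge0// mulr_ge0.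
have Ef n : (EE P (f n) <= ((L + eps * C - v) + n.+1%:R^-1)%:E)%E.
  have [iV EV] := admissible_Econv (Aphi n).
  have finV := integrable_fin_num measurableT iV.
  have := Hv n; rewrite EV -(fineK finV) lee_fin; set x := fine _ => Hx.
  have iC : P.-integrable setT (EFin \o (fun w => L + eps * Num.max (W (phi n) w) 0 `^ h)).
    apply/integrableP; split.
      by apply/measurable_EFinP; apply: measurable_funD => //; exact: measurable_funM.
    have -> : (\int[P]_w `|(EFin \o (fun w => L + eps * Num.max (W (phi n) w) 0 `^ h)%R) w|)%E =
       EE P (fun w => L + eps * Num.max (W (phi n) w) 0 `^ h).
      apply: eq_integral => w _ /=; rewrite ger0_norm//.
      by rewrite addr_ge0// mulr_ge0 ?powR_ge0 ?(ltW eps0).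
    rewrite EE_add//; [|by [exact: measurable_funM|move=> w; rewrite mulr_ge0 ?powR_ge0 ?(ltW eps0)]..].
    rewrite EE_cst EE_scale ?(ltW eps0)//; last by move=> w; exact: powR_ge0.
    by rewrite lte_add_pinfty ?ltry// lte_mul_pinfty ?lee_fin ?(ltW eps0)// (le_lt_trans (HC _ (Aphi n))) ?ltry.
  have -> : EE P (f n) = (EE P (fun w => (L + eps * Num.max (W (phi n) w) 0 `^ h)%R) - x%:E)%E.
    rewrite fineK// -integralB//; apply: eq_integral => w _.
  rewrite EE_add//; [|by [exact: measurable_funM|move=> w; rewrite mulr_ge0 ?powR_ge0 ?(ltW eps0)]..].
  rewrite EE_cst EE_scale ?(ltW eps0)//; last by move=> w; exact: powR_ge0.
  apply: (@le_trans _ _ (L%:E + eps%:E * C%:E - x%:E)%E).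
    rewrite leeB// leeD2l// lee_wpmul2l ?lee_fin ?(ltW eps0)//; exact: HC.
  rewrite -EFinM -!EFinD lee_fin -[leRHS]addrA -[leLHS]addrA; do 2 rewrite ?lerD2l.
  by move: (n.+1%:R^-1) Hx => y; lra.
have EY : (EE P Y <= (L + eps * C - v)%:E)%E.
  apply: (fatou_real mf f0 mY _ _ Ef); first by move=> w; exact: pos0.
  apply: filterS Wcvg => w cw e' e'0.
  (* Upper semicontinuity: [U] may not jump up in the limit by more than [e'], and Fatou needs only
     this one-sided bound. *)
  have Unear := HU.2.2 (W phil w) e' e'0.
  have := cw _ Unear; rewrite /= => {}cw.
  near=> n.
  have Un : U (W (phi n) w) < U (W phil w) + e' by near: n.
  rewrite /Y lerBlDr ge_max; apply/andP; split; last by rewrite addr_ge0// ltW.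
  rewrite /f; have := mulr_ge0 (ltW eps0) (powR_ge0 (Num.max (W (phi n) w) 0) h).
  by move: Un; lra.
pose Z w := L - Y w.
have iY : P.-integrable setT (EFin \o Y).
  apply/integrableP; split; first exact/measurable_EFinP.
  have -> : (\int[P]_w `|(EFin \o Y) w|)%E = EE P Y.
    by apply: eq_integral => w _ /=; rewrite ger0_norm// pos0.
  by rewrite (le_lt_trans EY) ?ltry.
apply: (@Econv_ge _ _ _ P (V phil) Z) => //.
- exact: measurable_funB.
- move=> w; rewrite /Z lerBlDr -lerBlDl le_max lexx//.
have -> : (\int[P]_w (Z w)%:E = L%:E - EE P Y)%E.
  rewrite -(EE_cst P L) -integralB//; last exact: finite_measure_integrable_cst.
apply: (@le_trans _ _ (L%:E - (L + eps * C - v)%:E)%E); last by rewrite leeB.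
rewrite -EFinB lee_fin.
have : eps * C <= e.
  rewrite /eps mulrAC -mulrA ler_piMr ?(ltW e0)//.
  by rewrite ler_pdivrMr// mul1r lerDl.
by move: (eps * C) => x; lra.
Unshelve. all: by end_near. Qed.

End admissible_class.

(** * Market data *)

Lemma Econv_eq_ae {dO : measure_display} {Omega : measurableType dO} {R : realType}
    (P : probability Omega R) (V V' : Omega -> R) :
  measurable_fun setT V -> measurable_fun setT V' ->
  (\forall w \ae P, V w = V' w) -> Econv P V = Econv P V'.
Proof.
move=> mV mV' VV'; rewrite /Econv.
have mp (X : Omega -> R) : measurable_fun setT X -> measurable_fun setT (fun w => Num.max (X w) 0).
  by move=> mX; exact: measurable_maxr.
have -> : (\int[P]_w (Num.max (V w) 0)%:E = \int[P]_w (Num.max (V' w) 0)%:E)%E.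
  apply: (EE_eq_ae (f := fun w => Num.max (V w) 0) (g := fun w => Num.max (V' w) 0));
    [exact: mp|exact: mp|by apply: filterS VV' => w ->].
have -> : (\int[P]_w (Num.max (- V w) 0)%:E = \int[P]_w (Num.max (- V' w) 0)%:E)%E.
  apply: (EE_eq_ae (f := fun w => Num.max (- V w) 0) (g := fun w => Num.max (- V' w) 0));
    [exact/mp/measurable_funN|exact/mp/measurable_funN|by apply: filterS VV' => w ->].
by have -> : (\int[P]_w (V w)%:E = \int[P]_w (V' w)%:E)%E by exact: EE_eq_ae.
Qed.

Lemma Econv_cst {dO : measure_display} {Omega : measurableType dO} {R : realType}
    (P : probability Omega R) (c : R) : Econv P (fun=> c) = c%:E.
Proof.
rewrite /Econv ifF; first exact: EE_cst.
apply/negP => /andP[/eqP + _].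
by have := EE_cst P (Num.max c 0); rewrite /EE => ->.
Qed.

Lemma range_ae {dO : measure_display} {Omega : measurableType dO} {R : realType}
    (P : probability Omega R) (Tn : nat) (Q : nat -> Omega -> Prop) :
  (forall t, (1 <= t <= Tn)%N -> \forall w \ae P, Q t w) ->
  \forall w \ae P, forall t, (1 <= t <= Tn)%N -> Q t w.
Proof.
move=> H; apply: ae_foralln => t.
have [tT|tT] := boolP (1 <= t <= Tn)%N; last by apply: aeW.
by apply: filterS (H t tT) => w.
Qed.

(* Hypothesis (iii) for a single increment [X], [G] being the information before it. *)
Definition loss_condition {dO : measure_display} {Omega : measurableType dO} {R : realType}
    (P : probability Omega R) (G : set (set Omega)) {d : nat} (X : Omega -> d.-tuple R) : Prop :=
  exists beta kappa : Omega -> R,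
    Gmeas G beta /\ Gmeas G kappa /\
    (\forall w \ae P, 0 < beta w) /\ (\forall w \ae P, 0 < kappa w) /\
    (forall D, is_Dset P G X D ->
       forall Z, is_essinf P
         [set Y | exists xi : Omega -> d.-tuple R,
            Gmeas G xi /\ (\forall w \ae P, D w (xi w)) /\
            is_condprob P G
              [set w | dotv (xi w) (X w) <= - beta w * enorm (xi w)] Y] Z ->
       \forall w \ae P, D w <> [set zerov] -> kappa w <= Z w) /\
    Wmom P (fun w => (beta w)^-1) /\ Wmom P (fun w => (kappa w)^-1) /\
    Wmom P (fun w => enorm (X w)).

Section market_data.
Context {dO : measure_display} {Omega : measurableType dO} {R : realType}.
Variables (P : probability Omega R) (d Tn : nat) (F : nat -> set (set Omega)).
Hypothesis HF : is_filtration P Tn F.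
Variable S : Process Omega R d.
Hypothesis adS : adapted Tn F S.

Let sF t : (t <= Tn)%N -> sigma_algebra setT (F t). Proof. by have [+ _] := HF; apply. Qed.
Let FM t : (t <= Tn)%N -> F t `<=` measurable. Proof. by have [_ [+ _]] := HF; apply. Qed.
Let predT_le t : (1 <= t <= Tn)%N -> (t.-1 <= Tn)%N.
Proof. by case: t => // t /=; exact: ltnW. Qed.

Lemma measurable_incr t : (1 <= t <= Tn)%N -> measurable_fun setT (incr S t).
Proof.
move=> tT; have tT' : (t <= Tn)%N by case/andP: tT.
exact: (Gmeas_measurable (FM tT') (Gmeas_incr HF adS tT)).
Qed.

(** An arbitrage in period [t] alone extends to a strategy that does not trade in any other
    period. *)
Lemma NA_one_step t : NA P Tn F S -> (1 <= t <= Tn)%N ->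
  forall xi : Omega -> d.-tuple R, Gmeas (F t.-1) xi ->
  (\forall w \ae P, 0 <= dotv (xi w) (incr S t w)) ->
  (\forall w \ae P, dotv (xi w) (incr S t w) = 0).
Proof.
move=> na tT xi Gxi Hxi.
pose phi : Process Omega R d := fun s => if s == t then xi else fun=> zerov.
have sphi : strategies d Tn F phi.
  move=> s sT; rewrite /phi; case: eqP => [->//|_].
  by apply: Gmeas_cst; exact/sF/predT_le.
have WE w : wealth S 0 phi Tn w = dotv (xi w) (incr S t w).
  rewrite /wealth add0r (bigD1_seq t) ?mem_index_iota ?iota_uniq ?ltnS//=.
  rewrite {1}/phi eqxx big1 ?addr0// => s /negbTE st.
  by rewrite /phi st dotv0l.
have := na phi sphi; move=> H.
have : \forall w \ae P, wealth S 0 phi Tn w = 0.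
  by apply: H; apply: filterS Hxi => w; rewrite WE.
by apply: filterS => w; rewrite WE.
Qed.

Variable nu : nat -> Omega -> probability (d.-tuple R) R.
Hypothesis Hnu : forall t, (1 <= t <= Tn)%N -> is_rcd P (F t.-1) (incr S t) (nu t).
Let D t w := affhull (msupport (nu t w)).
Hypothesis naS : NA P Tn F S.
Hypothesis H3 : forall t, (1 <= t <= Tn)%N -> loss_condition P (F t.-1) (incr S t).

Lemma hull_zero t : (1 <= t <= Tn)%N -> \forall w \ae P, D t w zerov.
Proof.
move=> tT; have t'T := predT_le tT.
apply: (zero_in_hull (sF t'T) (FM t'T) (measurable_incr tT) (Hnu tT)).
exact: NA_one_step.
Qed.

(** The constants of (iii) are positive only almost surely. Changed on null sets, and with [kappa]
    capped at 1, they are positive everywhere and keep measurability and moments, the latter because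
    the inverse of the capped [kappa] is at most [1 / kappa + 1]. Outside the horizon the value 1 is
    a default. *)
Lemma positive_constants t : exists bk : (Omega -> R) * (Omega -> R),
  [/\ forall w, 0 < bk.1 w, forall w, 0 < bk.2 w, forall w, bk.2 w <= 1 &
  (1 <= t <= Tn)%N -> [/\ Gmeas (F t.-1) bk.1, Gmeas (F t.-1) bk.2,
    Wmom P (fun w => (bk.1 w)^-1), Wmom P (fun w => (bk.2 w)^-1) &
    forall xi : Omega -> d.-tuple R, Gmeas (F t.-1) xi ->
    (\forall w \ae P, D t w (xi w)) ->
    forall z : Omega -> R, Gmeas (F t.-1) z -> (forall w, 0 <= z w) ->
    (EE P (fun w => (z w * bk.2 w)%R) <=
     EE P (fun w => (z w * \1_[set w | dotv (xi w) (incr S t w) <= - bk.1 w * enorm (xi w)] w)%R))%E]].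
Proof.
have [tT|tT] := boolP (1 <= t <= Tn)%N; last first.
  by exists (fun=> 1, fun=> 1); split.
have t'T := predT_le tT.
have [beta [kappa [Gb [Gk [b0 [k0 [Hess [Wb [Wk _]]]]]]]]] := H3 tT.
pose b1 w := if 0 < beta w then beta w else 1.
pose k1 w := if 0 < kappa w then Num.min (kappa w) 1 else 1.
have b10 w : 0 < b1 w by rewrite /b1; case: ifP.
have k10 w : 0 < k1 w by rewrite /k1; case: ifP => // k; rewrite lt_min k ltr01.
have k11 w : k1 w <= 1 by rewrite /k1; case: ifP => // k; rewrite ge_min lexx orbT.
have Gb1 : Gmeas (F t.-1) b1.
  apply/(GmeasP (sF t'T)); apply: measurable_fun_ifT => //.
    by apply: measurable_fun_ltr => //; exact/(GmeasP (sF t'T)).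
  exact/(GmeasP (sF t'T)).
have Gk1 : Gmeas (F t.-1) k1.
  apply/(GmeasP (sF t'T)); apply: measurable_fun_ifT => //.
    by apply: measurable_fun_ltr => //; exact/(GmeasP (sF t'T)).
  by apply: measurable_minr => //; exact/(GmeasP (sF t'T)).
have mb1 := Gmeas_measurable (FM t'T) Gb1.
have mk1 := Gmeas_measurable (FM t'T) Gk1.
exists (b1, k1); split; [exact: b10|exact: k10|exact: k11|move=> _].
split; [exact: Gb1|exact: Gk1| | |].
- apply: (Wmom_le _ Wb); first exact: (measurableT_comp measurable_invr mb1).
  by apply: filterS b0 => w bw /=; rewrite /b1 bw.
- apply: (Wmom_le (X := fun w => (kappa w)^-1 + 1)).
  + exact: (measurableT_comp measurable_invr mk1).
  + by apply: Wmom_add; [exact: Wk|exact: Wmom_cst].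
  + apply: filterS k0 => w kw /=; rewrite !ger0_norm ?addr_ge0 ?invr_ge0 ?(ltW kw) ?(ltW (k10 w))//.
    rewrite /k1 kw; case: (leP (kappa w) 1) => _; first by rewrite lerDl.
    by rewrite invr1 lerDr invr_ge0 ltW.
- move=> xi Gxi Dxi z Gz z0 /=.
  have DD : is_Dset P (F t.-1) (incr S t) (D t).
    by exists (nu t); split; [exact: Hnu|exact: aeW].
  have := @one_step_bound _ _ _ P (F t.-1) (sF t'T) (FM t'T) d _ (measurable_incr tT) (nu t)
    beta kappa k1 Gb Gk1 _ _ (hull_zero tT) (Hess _ DD) xi Gxi Dxi z Gz z0.
  move=> /(_ _ _)/le_trans; apply.
  + by move=> w; rewrite (ltW (k10 w))/=.
  + by apply: filterS k0 => w kw; rewrite /k1 kw ge_min lexx.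
  have mA (be : Omega -> R) : Gmeas (F t.-1) be ->
      measurable [set w | dotv (xi w) (incr S t w) <= - be w * enorm (xi w)].
    move=> Gbe; have mbe := Gmeas_measurable (FM t'T) Gbe.
    have mxi := Gmeas_measurable (FM t'T) Gxi.
    rewrite (_ : [set _ | _] = (fun w => dotv (xi w) (incr S t w) <=
      - be w * enorm (xi w)) @^-1` [set true]); last by apply/seteqP; split.
    rewrite -[X in measurable X]setTI; apply: measurable_fun_ler => //.
      by apply: measurable_dotv => //; exact: measurable_incr.
    by apply: measurable_funM; [exact: measurable_funN|exact: measurable_enorm].
  have mz := Gmeas_measurable (FM t'T) Gz.
  rewrite le_eqVlt; apply/orP; left; apply/eqP; apply: EE_eq_ae.
  + by apply: measurable_funM => //; exact/measurable_indic/mA.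
  + by apply: measurable_funM => //; exact/measurable_indic/mA.
  + apply: filterS b0 => w bw; rewrite !indicE.
    have -> : (w \in [set w | dotv (xi w) (incr S t w) <= - beta w * enorm (xi w)]) =
        (w \in [set w | dotv (xi w) (incr S t w) <= - b1 w * enorm (xi w)]) => //.
    by apply/idP/idP => /set_mem /= h; apply/mem_set => /=; move: h; rewrite /b1 bw.
Qed.

Lemma market_data : exists theta : nat -> Omega -> R,
  [/\ forall t w, 0 < theta t w,
      forall t, (1 <= t <= Tn)%N -> Wmom P (theta t),
      forall t, (1 <= t <= Tn)%N -> Wmom P (fun w => enorm (incr S t w)) &
      forall (w0 : R) phi m, strategies d Tn F phi -> in_hull P Tn D phi -> 0 <= m ->
        (EE P (fun w => Num.max (- wealth S w0 phi Tn w)%R 0%R) <= m%:E)%E ->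
        forall t, (1 <= t <= Tn)%N ->
        (EE P (fun w => (enorm (phi t w) / theta t w)%R) <=
           (Tn.+1%:R ^+ t * (m + `|w0|))%:E)%E].
Proof.
have Winc t : (1 <= t <= Tn)%N -> Wmom P (fun w => enorm (incr S t w)).
  by move=> /H3[beta [kappa [_ [_ [_ [_ [_ [_ [_ ?]]]]]]]]].
have /choice[bk Hbk] := positive_constants.
have [||||||||theta [th0 Wth Hth]] :=
  @strategy_bound _ _ _ P d Tn F HF S adS (fun t => (bk t).1) (fun t => (bk t).2) D.
- by move=> t; have [] := Hbk t.
- by move=> t; have [] := Hbk t.
- by move=> t tT; have [_ _ _ /(_ tT)[]] := Hbk t.
- by move=> t tT; have [_ _ _ /(_ tT)[]] := Hbk t.
- by move=> t tT; have [_ _ _ /(_ tT)[]] := Hbk t.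
- by move=> t tT; have [_ _ _ /(_ tT)[]] := Hbk t.
- exact: Winc.
- by move=> t tT; have [_ _ _ /(_ tT)[]] := Hbk t.
by exists theta.
Qed.

End market_data.

(** * Optimal strategies *)

Section strategies_as_pairs.
Context {dO : measure_display} {Omega : measurableType dO} {R : realType} {d Tn : nat}.
Local Notation J := ('I_Tn * ('I_d * bool))%type.

(* Long and short positions are kept apart because [komlos] needs nonnegative functions;
   [h (i, _)] is the position over period [i.+1], known at time [i]. *)
Definition pair_strategy (h : J -> Omega -> R) : Process Omega R d := fun s w =>
  if @insub nat (fun x => x < Tn)%N 'I_Tn s.-1 is Some i then
    [tuple h (i, (k, true)) w - h (i, (k, false)) w | k < d] else zerov.

Lemma pair_strategyE t : (1 <= t <= Tn)%N -> exists2 i : 'I_Tn, (i : nat) = t.-1 &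
  forall h w k, tnth (pair_strategy h t w) k = h (i, (k, true)) w - h (i, (k, false)) w.
Proof.
move=> /andP[t1 tT]; have tT' : (t.-1 < Tn)%N by rewrite prednK.
exists (Ordinal tT') => // h w k.
by rewrite /pair_strategy insubT tnth_mktuple.
Qed.

Lemma wealth_eq (S : Process Omega R d) w0 (phi psi : Process Omega R d) w :
  (forall t, (1 <= t <= Tn)%N ->
     dotv (phi t w) (incr S t w) = dotv (psi t w) (incr S t w)) ->
  wealth S w0 phi Tn w = wealth S w0 psi Tn w.
Proof.
move=> H; rewrite /wealth; congr (_ + _); apply: eq_big_nat => s sT; exact: H.
Qed.

Lemma pair_strategy_mid (S : Process Omega R d) w0 (h h' : J -> Omega -> R) w :
  wealth S w0 (pair_strategy (fun j w => (h j w + h' j w) / 2)) Tn w =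
  1 / 2 * wealth S w0 (pair_strategy h) Tn w +
  (1 - 1 / 2) * wealth S w0 (pair_strategy h') Tn w.
Proof.
rewrite /wealth.
set x := \sum_(_ <= _ < _) _; set a := \sum_(_ <= _ < _) _; set b := \sum_(_ <= _ < _) _.
suff -> : x = 1 / 2 * a + (1 - 1 / 2) * b by lra.
rewrite /x /a /b !mulr_sumr -big_split; apply: eq_big_nat => s sT /=.
have [i _ E] := pair_strategyE sT.
rewrite -dotv_combvl; congr dotv; apply: eq_from_tnth => k.
by rewrite tnth_mktuple !E; field.
Qed.

Lemma cvg_sum_seq (I : eqType) (s : seq I) (f : nat -> I -> R) (l : I -> R) :
  (forall i, i \in s -> f n i @[n --> \oo] --> l i) ->
  \sum_(i <- s) f n i @[n --> \oo] --> \sum_(i <- s) l i.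
Proof.
elim: s => [|i s IH] H.
  by rewrite big_nil; under eq_fun do rewrite big_nil; exact: cvg_cst.
rewrite big_cons; under eq_fun do rewrite big_cons.
apply: cvgD; first by apply: H; rewrite mem_head.
by apply: IH => j js; apply: H; rewrite inE js orbT.
Qed.

Lemma pair_strategy_cvg (S : Process Omega R d) w0 (h : nat -> J -> Omega -> R)
    (hl : J -> Omega -> R) w :
  (forall j, h n j w @[n --> \oo] --> hl j w) ->
  wealth S w0 (pair_strategy (h n)) Tn w @[n --> \oo] -->
  wealth S w0 (pair_strategy hl) Tn w.
Proof.
move=> H; rewrite /wealth; apply: cvgD; first exact: cvg_cst.
apply: cvg_sum_seq => s; rewrite mem_index_iota ltnS => sT.
have [i _ E] := pair_strategyE sT.
rewrite /dotv; apply: cvg_sum_seq => k _; under eq_fun do rewrite E.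
by rewrite E; apply: cvgMl; exact: cvgB.
Qed.

End strategies_as_pairs.

Lemma rcd_family {dO : measure_display} {Omega : measurableType dO} {R : realType}
    (P : probability Omega R) (d Tn : nat) (F : nat -> set (set Omega))
    (S : Process Omega R d) : is_filtration P Tn F -> adapted Tn F S ->
  exists nu : nat -> Omega -> probability (d.-tuple R) R,
  forall t, (1 <= t <= Tn)%N -> is_rcd P (F t.-1) (incr S t) (nu t).
Proof.
move=> HF adS; have [sF [FM _]] := HF.
have H t : exists nu : Omega -> probability (d.-tuple R) R,
    (1 <= t <= Tn)%N -> is_rcd P (F t.-1) (incr S t) nu.
  have [tT|tT] := boolP (1 <= t <= Tn)%N; last by exists (fun=> \d_(zerov : d.-tuple R)).
  have t'T : (t.-1 <= Tn)%N by case/andP: tT => t1 /(leq_trans (leq_pred _)).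
  have [nu Hnu] := rcd_exists P (sF _ t'T) (FM _ t'T) (measurable_incr HF adS tT).
  by exists nu.
by have [nu Hnu] := choice H; exists nu.
Qed.

(** * One hull for all models *)

Section common_hull.
Context {dO : measure_display} {Omega : measurableType dO} {R : realType}.
Variables (P : probability Omega R) (d Tn : nat) (F : nat -> set (set Omega)).
Variable Sfam : set (Process Omega R d).
Hypothesis HF : is_filtration P Tn F.
Hypothesis Had : forall S, Sfam S -> adapted Tn F S.
Hypothesis Sst : forall S, Sfam S -> Sstar P Tn F Sfam S.
Variable S0 : Process Omega R d.
Hypothesis S0fam : Sfam S0.
Variable nu0 : nat -> Omega -> probability (d.-tuple R) R.
Hypothesis Hnu0 : forall t, (1 <= t <= Tn)%N -> is_rcd P (F t.-1) (incr S0 t) (nu0 t).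
Let D0 t w := affhull (msupport (nu0 t w)).

Let sF t : (t <= Tn)%N -> sigma_algebra setT (F t). Proof. by have [+ _] := HF; apply. Qed.
Let FM t : (t <= Tn)%N -> F t `<=` measurable. Proof. by have [_ [+ _]] := HF; apply. Qed.
Let predT_le t : (1 <= t <= Tn)%N -> (t.-1 <= Tn)%N.
Proof. by case: t => // t /=; exact: ltnW. Qed.

Lemma is_Dset_hull (S : Process Omega R d) nu t : is_rcd P (F t.-1) (incr S t) nu ->
  is_Dset P (F t.-1) (incr S t) (fun w => affhull (msupport (nu w))).
Proof. by move=> H; exists nu; split => //; exact: aeW. Qed.

(** Orthogonality to the support of [S0] passes to every other model because its hull is contained
    in that of [S0]. One projection therefore serves all models, with a null set depending on
    [S]. *)
Lemma strategy_projection w0 phi : strategies d Tn F phi ->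
  exists psi, [/\ strategies d Tn F psi, in_hull P Tn D0 psi &
    forall S, Sfam S -> \forall w \ae P, wealth S w0 psi Tn w = wealth S w0 phi Tn w].
Proof.
move=> sphi.
have /choice[psi Hpsi] : forall t, exists psi : Omega -> d.-tuple R,
    (1 <= t <= Tn)%N -> [/\ Gmeas (F t.-1) psi, (\forall w \ae P, D0 t w (psi w)) &
    forall w x, msupport (nu0 t w) x -> dotv (subv (phi t w) (psi w)) x = 0].
  move=> t; have [tT|tT] := boolP (1 <= t <= Tn)%N; last by exists (phi t).
  have t'T := predT_le tT.
  have na := (Sst S0fam).2.1.
  have [psi Hpsi] := hull_projection (sF t'T) (Hnu0 tT) (sphi t tT)
    (hull_zero HF (Had S0fam) Hnu0 na tT).
  by exists psi.
exists psi; split.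
- by move=> t tT; have [] := Hpsi t tT.
- by move=> t tT; have [] := Hpsi t tT.
move=> S Sf; have [nu Hnu] := rcd_family HF (Had Sf).
have H t : (1 <= t <= Tn)%N ->
    \forall w \ae P, dotv (psi t w) (incr S t w) = dotv (phi t w) (incr S t w).
  move=> tT; have t'T := predT_le tT; have [Gpsi _ orth] := Hpsi t tT.
  pose r w := subv (phi t w) (psi t w).
  have Gr : Gmeas (F t.-1) r.
    apply/(GmeasP (sF t'T)); apply: measurable_subv; apply/(GmeasP (sF t'T)) => //.
    exact: sphi.
  have sub := (Sst S0fam).2.2 S t Sf tT _ _ (is_Dset_hull (Hnu t tT)) (is_Dset_hull (Hnu0 tT)).
  have orthS : \forall w \ae P, forall x, msupport (nu t w) x -> 0 + dotv (r w) x = 0.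
    apply: filterS sub => w sub x sx; apply: (@affhull_affine _ _ (msupport (nu0 t w))).
      by move=> y sy; rewrite add0r; exact: orth.
    by apply: sub; exact: affhull_sub.
  have := @orth_support_ae _ _ _ P (F t.-1) (sF t'T) (FM t'T) d _ (measurable_incr HF (Had Sf) tT)
    (nu t) (Hnu t tT) (fun=> 0) r (Gmeas_cst (sF t'T) _) Gr orthS.
  apply: filterS => w; rewrite add0r /r dotv_subl => /eqP; rewrite subr_eq0 => /eqP e.
  exact: esym.
by apply: filterS (range_ae H) => w Hw; exact: wealth_eq.
Qed.

Hypothesis H3 : forall S t, Sfam S -> (1 <= t <= Tn)%N ->
  loss_condition P (F t.-1) (incr S t).

(** Here the opposite inclusion is used: strategies in the hull of [S0] lie in that of [S], to which
    (iii) for [S] refers. *)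
Lemma common_market_data S : Sfam S -> exists theta : nat -> Omega -> R,
  [/\ forall t w, 0 < theta t w,
      forall t, (1 <= t <= Tn)%N -> Wmom P (theta t),
      forall t, (1 <= t <= Tn)%N -> Wmom P (fun w => enorm (incr S t w)) &
      forall (w0 : R) phi m, strategies d Tn F phi -> in_hull P Tn D0 phi -> 0 <= m ->
        (EE P (fun w => Num.max (- wealth S w0 phi Tn w)%R 0%R) <= m%:E)%E ->
        forall t, (1 <= t <= Tn)%N ->
        (EE P (fun w => (enorm (phi t w) / theta t w)%R) <=
           (Tn.+1%:R ^+ t * (m + `|w0|))%:E)%E].
Proof.
move=> Sf; have [nu Hnu] := rcd_family HF (Had Sf).
have [theta [th0 Wth Winc Hth]] := market_data HF (Had Sf) Hnu (Sst Sf).2.1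
  (fun t tT => H3 Sf tT).
exists theta; split; [exact: th0|exact: Wth|exact: Winc|].
move=> w0 phi m sphi Dphi; apply: Hth => // t tT.
have sub := (Sst Sf).2.2 S0 t S0fam tT _ _ (is_Dset_hull (Hnu0 tT)) (is_Dset_hull (Hnu t tT)).
by apply: filterS2 sub (Dphi t tT) => w sub; exact: sub.
Qed.

End common_hull.

Section pair_strategy_facts.
Context {dO : measure_display} {Omega : measurableType dO} {R : realType}.
Variables (P : probability Omega R) (d Tn : nat) (F : nat -> set (set Omega)).
Hypothesis HF : is_filtration P Tn F.
Local Notation J := ('I_Tn * ('I_d * bool))%type.

Let sF t : (t <= Tn)%N -> sigma_algebra setT (F t). Proof. by have [+ _] := HF; apply. Qed.

Lemma strategies_pair (h : J -> Omega -> R) : (forall j : J, Gmeas (F j.1) (h j)) ->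
  strategies d Tn F (pair_strategy h).
Proof.
move=> Gh t tT; have [i it E] := pair_strategyE (Omega := Omega) (R := R) (d := d) tT.
have -> : pair_strategy h t = fun w => [tuple h (i, (k, true)) w - h (i, (k, false)) w | k < d].
  by apply/funext => w; apply: eq_from_tnth => k; rewrite E tnth_mktuple.
have iT : (i <= Tn)%N by exact: ltnW.
rewrite -it; apply/(GmeasP (sF iT)); apply: measurable_mktuple => k.
apply: measurable_funB; apply/(GmeasP (sF iT)).
- exact: (Gh (i, (k, true))).
- exact: (Gh (i, (k, false))).
Qed.

Lemma pair_strategy_combv (h h' : J -> Omega -> R) t w : (1 <= t <= Tn)%N ->
  pair_strategy (fun j w => (h j w + h' j w) / 2) t w =
  combv (1 / 2) (pair_strategy h t w) (pair_strategy h' t w).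
Proof.
move=> tT; have [i _ E] := pair_strategyE (Omega := Omega) (R := R) (d := d) tT.
by apply: eq_from_tnth => k; rewrite tnth_mktuple !E; lra.
Qed.

Lemma pair_strategy_parts (psi : Process Omega R d) : strategies d Tn F psi ->
  exists h : J -> Omega -> R, [/\ forall j : J, Gmeas (F j.1) (h j), forall j w, 0 <= h j w,
    forall j w, h j w <= enorm (psi j.1.+1 w) &
    forall t w, (1 <= t <= Tn)%N -> pair_strategy h t w = psi t w].
Proof.
move=> spsi.
(* The sign is plus for long and minus for short positions, so these are the positive and negative
   parts of the coordinates. *)
exists (fun (j : J) w => Num.max ((-1) ^+ (~~ j.2.2) * tnth (psi j.1.+1 w) j.2.1) 0); split.
- move=> [i [k b]] /=; have iT : (i <= Tn)%N by exact: ltnW.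
  apply/(GmeasP (sF iT)); apply: measurable_maxr => //.
  apply: measurable_funM => //.
  by apply: measurable_coord; apply/(GmeasP (sF iT)); exact: (spsi i.+1 (ltn_ord i)).
- by move=> j w; rewrite le_max lexx orbT.
- move=> j w; rewrite ge_max sqrtr_ge0 andbT; apply: le_trans (coord_le_enorm _ j.2.1).
  by apply: le_trans (ler_norm _) _; rewrite normrM normrX normrN1 expr1n mul1r.
move=> t w tT; have [i it E] := pair_strategyE (Omega := Omega) (R := R) (d := d) tT.
have {}it : i.+1 = t by rewrite it prednK//; case/andP: tT.
apply: eq_from_tnth => k; rewrite E /= it expr0 expr1 mul1r mulN1r.
move: (tnth _ _) => x; case: (leP 0 x) => x0.
  by rewrite max_r ?oppr_le0// subr0.
by rewrite max_l ?oppr_ge0 ?(ltW x0)// sub0r opprK.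
Qed.

End pair_strategy_facts.

Section optimal_strategy.
Context {dO : measure_display} {Omega : measurableType dO} {R : realType}.
Variables (P : probability Omega R) (d Tn : nat) (F : nat -> set (set Omega)).
Variables (Sfam : set (Process Omega R d)) (S0 : Process Omega R d).
Hypothesis HF : is_filtration P Tn F.
Hypothesis Had : forall S, Sfam S -> adapted Tn F S.
Hypothesis S0fam : Sfam S0.
Variables (D : nat -> Omega -> set (d.-tuple R)) (U : R -> R) (w0 : R).
Hypothesis HU : utility_assumption U.

Let sF t : (t <= Tn)%N -> sigma_algebra setT (F t). Proof. by have [+ _] := HF; apply. Qed.
Let FM t : (t <= Tn)%N -> F t `<=` measurable. Proof. by have [_ [+ _]] := HF; apply. Qed.

Local Notation J := ('I_Tn * ('I_d * bool))%type.
Local Notation wc := (worst_case P Tn Sfam U w0).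
Local Notation V S phi := (fun w => U (wealth S w0 phi Tn w)).

Let zs : Process Omega R d := fun _ _ => zerov.

Lemma zero_strategy : strategies d Tn F zs.
Proof. by case=> // t tT; apply: Gmeas_cst; apply: sF; rewrite ltnW. Qed.

Lemma worst_case_zero : wc zs = (U w0)%:E.
Proof.
have WE (S : Process Omega R d) : V S zs = fun=> U w0.
  apply/funext => w; congr U; rewrite /wealth big1 ?addr0// => s _; exact: dotv0l.
rewrite /worst_case; apply/eqP; rewrite eq_le; apply/andP; split.
  by apply: ereal_inf_lbound; exists S0 => //; rewrite WE Econv_cst.
by apply: le_ereal_inf_tmp => _ [S _ <-]; rewrite WE Econv_cst.
Qed.

Lemma value_ge phi : strategies d Tn F phi -> (wc phi <= value P Tn F Sfam U w0)%E.
Proof. by move=> sphi; apply: ereal_sup_ubound; exists phi. Qed.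

Lemma worst_case_le phi S : Sfam S -> (wc phi <= Econv P (V S phi))%E.
Proof. by move=> Sf; apply: ereal_inf_lbound; exists S. Qed.

Hypothesis Daff : forall t w, is_affine (D t w).
Hypothesis Hproj : forall phi, strategies d Tn F phi ->
  exists psi, [/\ strategies d Tn F psi, in_hull P Tn D psi &
    forall S, Sfam S -> \forall w \ae P, wealth S w0 psi Tn w = wealth S w0 phi Tn w].
Hypothesis Hdata : forall S, Sfam S -> exists theta : nat -> Omega -> R,
  [/\ forall t w, 0 < theta t w,
      forall t, (1 <= t <= Tn)%N -> Wmom P (theta t),
      forall t, (1 <= t <= Tn)%N -> Wmom P (fun w => enorm (incr S t w)) &
      forall phi m, strategies d Tn F phi -> in_hull P Tn D phi -> 0 <= m ->
        (EE P (fun w => Num.max (- wealth S w0 phi Tn w)%R 0%R) <= m%:E)%E ->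
        forall t, (1 <= t <= Tn)%N ->
        (EE P (fun w => (enorm (phi t w) / theta t w)%R) <=
           (Tn.+1%:R ^+ t * (m + `|w0|))%:E)%E].
Variables (c1 c2 g : R).
Hypotheses (c1_gt0 : 0 < c1) (c2_ge0 : 0 <= c2) (g0 : 0 < g) (g1 : g < 1).
Hypothesis HUb : forall x,
  U x <= c2 + c2 * Num.max x 0 `^ g - c1 * Num.max (- x) 0.

Lemma worst_case_admissible (k : R) phi S : Sfam S -> strategies d Tn F phi ->
  in_hull P Tn D phi -> (k%:E <= wc phi)%E -> admissible P Tn F S D w0 U k phi.
Proof. by move=> Sf sphi Dphi kphi; split => //; exact: le_trans (worst_case_le _ Sf). Qed.

Lemma worst_case_projection phi : strategies d Tn F phi ->
  exists psi, [/\ strategies d Tn F psi, in_hull P Tn D psi & wc psi = wc phi].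
Proof.
move=> sphi; have [psi [spsi Dpsi E]] := Hproj sphi.
exists psi; split => //; rewrite /worst_case; congr ereal_inf.
apply: eq_imagel => S Sf; apply: Econv_eq_ae.
- exact: (measurable_utility_wealth HF (Had Sf)).
- exact: (measurable_utility_wealth HF (Had Sf)).
- by apply: filterS (E S Sf) => w ->.
Qed.

(** One model suffices for the upper bound: strategies whose worst case is at least [U w0], the
    utility of not trading, are admissible in [S0] and have uniformly bounded expected positive
    utility there. *)
Lemma value_fin : exists2 v : R, U w0 <= v & value P Tn F Sfam U w0 = v%:E.
Proof.
have [theta [th0 Wth Wi Hth]] := Hdata S0fam.
have [B B0 HB] := admissible_gain HF (Had S0fam) Wi th0 Wth Hth HU (U w0) c1_gt0 c2_ge0 g0 g1 HUb.
have lo : ((U w0)%:E <= value P Tn F Sfam U w0)%E.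
  by rewrite -worst_case_zero; exact: value_ge zero_strategy.
have hi : (value P Tn F Sfam U w0 <= (Num.max (U w0) B)%:E)%E.
  apply: ub_ereal_sup => _ [phi sphi <-].
  have [psi [spsi Dpsi <-]] := worst_case_projection sphi.
  have [Kpsi|Kpsi] := leP (U w0)%:E (wc psi); last first.
    by apply: le_trans (ltW Kpsi) _; rewrite lee_fin le_max lexx.
  have Apsi := worst_case_admissible S0fam spsi Dpsi Kpsi.
  have mV := measurable_utility_wealth HF (Had S0fam) w0 HU spsi.
  have [_ _ /(Econv_neg_fin mV) nfin] := Apsi.
  apply: le_trans (worst_case_le psi S0fam) _; rewrite EconvE//.
  apply: (@le_trans _ _ B%:E); last by rewrite lee_fin le_max lexx orbT.
  apply: le_trans (HB psi Apsi); rewrite leeBlDr ?leeDl//.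
    by apply: EE_ge0 => w; rewrite le_max lexx orbT.
  rewrite ge0_fin_numE//; apply: EE_ge0 => w; by rewrite le_max lexx orbT.
case: (value P Tn F Sfam U w0) lo hi => [v| |]//; rewrite lee_fin => lo _.
by exists v.
Qed.

(** [Econv] is not additive in general; admissibility makes the utilities of both strategies
    integrable, so that the concavity inequality can be integrated. *)
Lemma worst_case_mid (k : R) (h h' : J -> Omega -> R) :
  let hm := fun j w => (h j w + h' j w) / 2 in
  strategies d Tn F (pair_strategy h) -> strategies d Tn F (pair_strategy h') ->
  strategies d Tn F (pair_strategy hm) ->
  in_hull P Tn D (pair_strategy h) -> in_hull P Tn D (pair_strategy h') ->
  (k%:E <= wc (pair_strategy h))%E -> (k%:E <= wc (pair_strategy h'))%E ->
  (k%:E <= wc (pair_strategy hm))%E.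
Proof.
move=> hm sh sh' shm Dh Dh' kh kh'; apply: le_ereal_inf_tmp => _ [S Sf <-].
have [theta [th0 Wth Wi Hth]] := Hdata Sf.
have Ah := worst_case_admissible Sf sh Dh kh.
have Ah' := worst_case_admissible Sf sh' Dh' kh'.
have [iV EV] := admissible_Econv HF (Had Sf) Wi th0 Wth Hth HU c1_gt0 c2_ge0 g0 g1 HUb Ah.
have [iV' EV'] := admissible_Econv HF (Had Sf) Wi th0 Wth Hth HU c1_gt0 c2_ge0 g0 g1 HUb Ah'.
have mV := measurable_utility_wealth HF (Had Sf) w0 HU sh.
have mV' := measurable_utility_wealth HF (Had Sf) w0 HU sh'.
apply: (@Econv_ge _ _ _ _ _ (fun w => 1 / 2 * V S (pair_strategy h) w +
    (1 - 1 / 2) * V S (pair_strategy h') w)).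
- exact: (measurable_utility_wealth HF (Had Sf)).
- by apply: measurable_funD; exact: measurable_funM.
- by move=> w; rewrite pair_strategy_mid; apply: HU.2.1; lra.
have [_ _ Kh] := Ah; have [_ _ Kh'] := Ah'.
rewrite EV in Kh; rewrite EV' in Kh'.
under eq_integral do rewrite EFinD !EFinM.
rewrite integralD//; [|exact: integrableZl|exact: integrableZl].
rewrite !integralZl//.
have -> : k%:E = ((1 / 2)%:E * k%:E + (1 - 1 / 2)%:E * k%:E)%E by rewrite -!EFinM -EFinD; congr EFin; lra.
by apply: leeD; apply: lee_wpmul2l => //; rewrite lee_fin; lra.
Qed.

Lemma optimal_strategy : exists phihat, strategies d Tn F phihat /\
    value P Tn F Sfam U w0 = wc phihat /\ (value P Tn F Sfam U w0 < +oo)%E.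
Proof.
have [v v0 vE] := value_fin.
(* The value is at least [U w0], so every strategy within 1 of the value is admissible for this one
   [K], and the bounds are uniform in [n]. *)
pose K := U w0 - 1.
have [theta [th0 Wth Wi Hth]] := Hdata S0fam.
have [M0 M00 HM0] := admissible_loss HF (Had S0fam) Wi th0 Wth Hth HU K c1_gt0 c2_ge0 g0 g1 HUb.
pose rho (j : J) w := (theta j.1.+1 w)^-1.
pose M := Tn.+1%:R ^+ Tn * (M0 + `|w0|).
have jT (j : J) : (1 <= j.1.+1 <= Tn)%N by rewrite /=.
have jT' (j : J) : (j.1 <= Tn)%N by exact: ltnW.
have mrho j : measurable_fun setT (rho j).
  by apply: (measurableT_comp measurable_invr); have [] := Wth _ (jT j).
have mG (j : J) (f : Omega -> R) : Gmeas (F j.1) f -> measurable_fun setT f.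
  by move=> Gf; have := Gmeas_measurable (FM (jT' j)) Gf.
(* The weighted bound is imposed on the pair itself: a midpoint of positive and negative parts need
   not consist of the parts of the midpoint strategy, so a bound on the norm of the strategy would
   not control it. *)
pose H (n : nat) : set (J -> Omega -> R) := [set h : J -> Omega -> R |
  [/\ forall j : J, Gmeas (F j.1) (h j), forall j w, 0 <= h j w,
      in_hull P Tn D (pair_strategy h),
      ((v - n.+1%:R^-1)%:E <= wc (pair_strategy h))%E &
      forall j, (EE P (fun w => (rho j w * h j w)%R) <= M%:E)%E]].
have vK n : K <= v - n.+1%:R^-1.
  have : n.+1%:R^-1 <= 1 :> R by rewrite invf_le1// ler1n.
  by rewrite /K; move: (n.+1%:R^-1) v0 => x; lra.
have mH n h j : H n h -> measurable_fun setT (h j).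
  by move=> [Gh _ _ _ _]; exact: mG (Gh j).
have H_neq0 n : H n !=set0.
  have n0 : 0 < n.+1%:R^-1 :> R by rewrite invr_gt0.
  have [|_ [phi sphi <-]] := @ub_ereal_sup_adherent _
    [set wc phi | phi in strategies d Tn F] _ n0.
    by have := vE; rewrite /value => ->.
  rewrite -/(value P Tn F Sfam U w0) vE -EFinB => /ltW.
  have [psi [spsi Dpsi <-]] := worst_case_projection sphi.
  move=> Hpsi; have [h [Gh h0 hle hE]] := pair_strategy_parts HF spsi.
  have WE S : V S (pair_strategy h) = V S psi.
    by apply/funext => w; congr U; apply: wealth_eq => t tT; rewrite hE.
  have wcE : wc (pair_strategy h) = wc psi.
    by rewrite /worst_case; congr ereal_inf; apply: eq_imagel => S _; rewrite WE.
  have Apsi : admissible P Tn F S0 D w0 U K psi.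
    apply: worst_case_admissible => //; apply: le_trans Hpsi; rewrite lee_fin; exact: vK.
  exists h; split => //.
  - by move=> t tT; apply: filterS (Dpsi t tT) => w; rewrite hE.
  - by rewrite wcE.
  - move=> j; apply: le_trans (_ : (EE P (fun w => (enorm (psi j.1.+1 w) / theta j.1.+1 w)%R) <= _)%E).
      apply: EE_le.
      + by apply: measurable_funM => //; exact: mG (Gh j).
      + apply: measurable_funM; last exact: mrho.
        apply: measurable_enorm; have := Gmeas_measurable (FM (jT' j)) (spsi _ (jT j)).
        exact.
      + by move=> w; rewrite mulr_ge0// invr_ge0 ltW.
      + by move=> w; rewrite mulrC ler_wpM2r// invr_ge0 ltW.
    apply: le_trans (Hth psi M0 spsi Dpsi M00 (HM0 psi Apsi) _ (jT j)) _.
    rewrite lee_fin ler_wpM2r ?addr_ge0//.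
    by rewrite ler_weXn2l ?ler1n.
have H_dec n : H n.+1 `<=` H n.
  move=> h [Gh h0 Dh vh Mh]; split => //; apply: le_trans vh.
  by rewrite lee_fin lerD2l lerN2 lef_pV2 ?posrE// ler_nat.
have H_mid n h h' : H n h -> H n h' -> H n (fun j w => (h j w + h' j w) / 2).
  move=> [Gh h0 Dh vh Mh] [Gh' h0' Dh' vh' Mh'].
  have Gm (j : J) : Gmeas (F j.1) (fun w => (h j w + h' j w) / 2).
    apply/(GmeasP (sF (jT' j))); apply: measurable_funM => //.
    by apply: measurable_funD; apply/(GmeasP (sF (jT' j))).
  split.
  - exact: Gm.
  - by move=> j w; rewrite divr_ge0// addr_ge0.
  - move=> t tT; apply: filterS2 (Dh t tT) (Dh' t tT) => w Dw Dw'.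
    by rewrite pair_strategy_combv//; exact: Daff.
  - by apply: worst_case_mid => //; exact: (strategies_pair HF).
  - move=> j.
    have mh := mG j _ (Gh j).
    have mh' := mG j _ (Gh' j).
    have r0 w : 0 <= rho j w by rewrite invr_ge0 ltW.
    have -> : (fun w => rho j w * ((h j w + h' j w) / 2)) =
        (fun w => 2^-1 * (rho j w * h j w + rho j w * h' j w)).
      by apply/funext => w; field.
    have m1 : measurable_fun setT (fun w => rho j w * h j w) by exact: measurable_funM.
    have m2 : measurable_fun setT (fun w => rho j w * h' j w) by exact: measurable_funM.
    have p1 w : 0 <= rho j w * h j w by rewrite mulr_ge0.
    have p2 w : 0 <= rho j w * h' j w by rewrite mulr_ge0.
    rewrite EE_scale//; [|by [exact: measurable_funD|move=> w; rewrite addr_ge0]..].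
    rewrite EE_add//.
    have -> : M%:E = (2^-1%:E * (M%:E + M%:E))%E by rewrite -EFinD -EFinM; congr EFin; field.
    by rewrite lee_wpmul2l ?lee_fin ?invr_ge0// leeD.
have [h [hl [Hh hcvg]]] : exists (h : nat -> J -> Omega -> R) (hl : J -> Omega -> R),
    (forall n, H n (h n)) /\ \forall w \ae P, forall j, h n j w @[n --> \oo] --> hl j w.
  apply: (@komlos _ _ _ P _ rho M mrho _ _ H).
  - by move=> j w; rewrite invr_ge0 ltW.
  - by move=> j; apply: aeW => w; rewrite invr_gt0.
  - by move=> n h Hh j; exact: mH Hh.
  - by move=> n h [_ h0 _ _ _]; exact: h0.
  - exact: H_neq0.
  - exact: H_dec.
  - exact: H_mid.
  - by move=> n h j [_ _ _ _]; apply.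
(* The limit [hl] is given only almost everywhere and need not be adapted; the upper limit is
   measurable for [F j.1] and agrees with it off a null set. *)
pose hh (j : J) w := fine (limn_esup (fun n => (h n j w)%:E)).
have Ghh (j : J) : Gmeas (F j.1) (hh j).
  apply/(GmeasP (sF (jT' j))); apply: (measurableT_comp (fine_measurable measurableT)).
  apply: (@measurable_fun_limn_esup _ (g_sigma_algebraType (F j.1)) _ setT
    (fun n w => (h n j w)%:E)) => n.
  apply/measurable_EFinP; apply/(GmeasP (sF (jT' j))).
  by have [+ _ _ _ _] := Hh n; apply.
have hhcvg : \forall w \ae P, forall j, h n j w @[n --> \oo] --> hh j w.
  apply: filterS hcvg => w cw j; rewrite /hh.
  have /cvg_limn_einf_sup[_ ->] : (h n j w)%:E @[n --> \oo] --> (hl j w)%:E.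
    by apply/fine_cvgP; split; [exact: nearW|exact: cw].
  exact: cw.
have shh : strategies d Tn F (pair_strategy hh) by exact: (strategies_pair HF).
exists (pair_strategy hh); split; first exact: shh.
split; last by rewrite vE ltry.
apply/eqP; rewrite eq_le value_ge// andbT vE.
apply: le_ereal_inf_tmp => _ [S Sf <-].
have [th [t0 Wt Winc Ht]] := Hdata Sf.
have sh n : strategies d Tn F (pair_strategy (h n)).
  by apply: (strategies_pair HF); have [] := Hh n.
apply: (admissible_limit HF (Had Sf) Winc t0 Wt Ht HU (K := K) c1_gt0 c2_ge0 g0 g1 HUb
  (phi := fun n => pair_strategy (h n))) => //.
- move=> n; have [_ _ Dh vh _] := Hh n; apply: worst_case_admissible => //.
  by apply: le_trans vh; rewrite lee_fin; exact: vK.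
- by move=> n; have [_ _ _ vh _] := Hh n; exact: le_trans (worst_case_le _ Sf).
- by apply: filterS hhcvg => w cw; exact: pair_strategy_cvg.
Qed.

End optimal_strategy.

Unset Implicit Arguments.

Theorem theorem3p5
  (R : realType) (dO : measure_display) (Omega : measurableType dO)
  (P : probability Omega R) (d Tn : nat) (F : nat -> set (set Omega))
  (Sfam : set (Process Omega R d)) (U : R -> R) (w0 : R) :
  is_filtration P Tn F ->
  Sfam !=set0 ->
  (forall S, Sfam S -> adapted Tn F S) ->
  utility_assumption U ->
  (* (i) *)
  Sfam = Sstar P Tn F Sfam ->
  (* (ii) *)
  (exists (C alpha : R), 0 < C /\ 0 <= alpha < 1 /\
     forall x, 0 <= x -> U x <= C * (x `^ alpha + 1)) ->
  (* (iii) *)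
  (forall S t, Sfam S -> (1 <= t <= Tn)%N ->
     exists beta kappa : Omega -> R,
       Gmeas (F t.-1) beta /\ Gmeas (F t.-1) kappa /\
       (\forall w \ae P, 0 < beta w) /\ (\forall w \ae P, 0 < kappa w) /\
       (forall D, is_Dset P (F t.-1) (incr S t) D ->
          forall Z, is_essinf P
            [set Y | exists xi : Omega -> d.-tuple R,
               Gmeas (F t.-1) xi /\ (\forall w \ae P, D w (xi w)) /\
               is_condprob P (F t.-1)
                 [set w | dotv (xi w) (incr S t w) <= - beta w * enorm (xi w)] Y] Z ->
          \forall w \ae P, D w <> [set zerov] -> kappa w <= Z w) /\
       Wmom P (fun w => (beta w)^-1) /\ Wmom P (fun w => (kappa w)^-1) /\
       Wmom P (fun w => enorm (incr S t w))) ->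
  exists phihat, strategies d Tn F phihat /\
    value P Tn F Sfam U w0 = worst_case P Tn Sfam U w0 phihat /\
    (value P Tn F Sfam U w0 < +oo)%E.
Proof.
move=> HF [S0 S0fam] Had HU Hi [C [alpha [C0 [al HC]]]] H3.
have Sst S : Sfam S -> Sstar P Tn F Sfam S by rewrite -Hi.
(* A constant [U] has no linear decay at -oo, so [utility_bounds] excludes it; then every strategy
   attains [U w0]. *)
have [Ucst|Uncst] := pselect (forall x y : R, U x = U y).
  have wcE phi : worst_case P Tn Sfam U w0 phi = (U w0)%:E.
    rewrite -(worst_case_zero P Tn S0fam U w0) /worst_case; congr ereal_inf.
    by apply: eq_imagel => S _; congr Econv; apply/funext => w; exact: Ucst.
  have vE : value P Tn F Sfam U w0 = (U w0)%:E.
    apply/eqP; rewrite eq_le; apply/andP; split.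
      by apply: ub_ereal_sup => _ [phi _ <-]; rewrite wcE.
    by rewrite -(wcE (fun _ _ => zerov)); exact: value_ge (zero_strategy HF).
  exists (fun _ _ => zerov); split; first exact: zero_strategy HF.
  by rewrite vE wcE; split => //; exact: ltry.
have [c1 [c2 [c10 c20 HUb]]] := utility_bounds HU C0 al HC Uncst.
have [nu Hnu] := rcd_family HF (Had _ S0fam).
apply: (@optimal_strategy _ _ _ P d Tn F Sfam S0 HF Had S0fam
  (fun t w => affhull (msupport (nu t w))) U w0 HU _ _ _ c1 c2 ((1 + alpha) / 2) c10 c20).
- by move=> t w; exact: affhull_is_affine.
- exact: (strategy_projection HF Had Sst S0fam Hnu).
- move=> S Sf; have [theta [t0 Wt Wi Ht]] :=
    common_market_data HF Had Sst S0fam Hnu H3 Sf.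
  by exists theta; split => //; exact: Ht.
- by case/andP: al; lra.
- by case/andP: al; lra.
- exact: HUb.
Qed.
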